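(* Fix real numbers $0<x_{\min}<x_{\max}$, $a>0$, $b\ge 0$. There exist constants $C>0$ and $n_0\in\mathbb N$, depending only on $x_{\max},x_{\min},a,b$, such that the following holds for all integers $n> n_0$, $m,L\ge 1$, $1\le k\le n$ and all real $\sigma_z\ge 0$ with $mL\le n^4k\log n$. Suppose that $A_1,\dots,A_L$ are independent $m\times n$ random matrices with i.i.d. $N(0,1)$ entries, and let $\mathcal C_k\in\mathcal F_{a,b,k,n}$. Then $$R_2(\mathcal C_k,m,n,\sigma_z)\le C\,\min\left(\frac{\max(\sigma_z^4,m^2,n^2)\,k\log n}{m^2nL},\,1\right).$$
   Context: Model: $\boldsymbol x_o\in\mathbb R^n$ is an unknown vector and $X_o=\mathrm{diag}(\boldsymbol x_o)$. One observes $\boldsymbol y_l=A_lX_o\boldsymbol w_l+\boldsymbol z_l\in\mathbb R^m$ for $l=1,\dots,L$, where $\boldsymbol w_1,\dots,\boldsymbol w_L$ are i.i.d. $N(0,I_n)$, $\boldsymbol z_1,\dots,\boldsymbol z_L$ are i.i.d. $N(0,\sigma_z^2I_m)$, and the families $(A_l)$, $(\boldsymbol w_l)$, $(\boldsymbol z_l)$ are mutually independent. The matrices $A_1,\dots,A_L$ are known to the estimator. Minimax risk: $R_2(\mathcal C,m,n,\sigma_z)=\inf_{\hat{\boldsymbol x}}\sup_{\boldsymbol x_o\in\mathcal C}\mathbb E\left[\|\hat{\boldsymbol x}-\boldsymbol x_o\|_2^2/n\right]$, where the infimum is over all measurable estimators $\hat{\boldsymbol x}$ that are functions of $\boldsymbol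 y_1,\dots,\boldsymbol y_L$ and $A_1,\dots,A_L$, and the expectation is over all the randomness (including the $A_l$). The dependence on $L$ is suppressed in the notation. Signal classes: for $\mathcal C\subset\mathbb R^n$, $N_\varepsilon(\mathcal C)$ denotes the $\varepsilon$-covering number, i.e. the least number of $\ell_2$-balls of radius $\varepsilon$ covering $\mathcal C$. $\mathcal F_{a,b,k,n}$ denotes the collection of all nonempty subsets $\mathcal C\subset[x_{\min},x_{\max}]^n$ such that $N_\varepsilon(\mathcal C)\le (an^b/\varepsilon)^k$ for every $0<\varepsilon\le an^b$. *)

(* Defs.v *)
From HB Require Import structures.
From mathcomp Require Import all_boot all_order all_algebra.
From mathcomp Require Import all_classical all_reals all_analysis.

Set Implicit Arguments.
Unset Strict Implicit.
Unset Printing Implicit Defensive.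

Import Order.TTheory GRing.Theory Num.Theory.
Import numFieldNormedType.Exports.

Local Open Scope classical_set_scope.
Local Open Scope ring_scope.

(* Matrices carry the product sigma-algebra of their entries; over a realType
   this is the Borel sigma-algebra of R^(p * q).  As for the library's tuples,
   the display is only a tag. *)
Definition measure_mx_display : measure_display -> measure_display.
Proof. exact. Qed.

Section measurable_matrix.
Context {d : measure_display} {T : measurableType d}.
Variables p q : nat.

Definition mx_measurable : set (set 'M[T]_(p, q)) :=
  <<s \bigcup_(ij in [set: 'I_p * 'I_q])
        preimage_set_system setT (fun M : 'M[T]_(p, q) => M ij.1 ij.2)
                            measurable >>.

Let mx_set0 : mx_measurable set0.
Proof. exact: sigma_algebra0. Qed.

Let mx_setC A : mx_measurable A -> mx_measurable (~` A).
Proof. exact: sigma_algebraC. Qed.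

Let mx_bigcup (F : (set 'M[T]_(p, q))^nat) :
  (forall i, mx_measurable (F i)) -> mx_measurable (\bigcup_i (F i)).
Proof. exact: sigma_algebra_bigcup. Qed.

HB.instance Definition _ := @isMeasurable.Build (measure_mx_display d)
  'M[T]_(p, q) mx_measurable mx_set0 mx_setC mx_bigcup.

End measurable_matrix.

Section signal_classes.
Context {R : realType} {n : nat}.
Implicit Types (x c : 'cV[R]_n) (S : set 'cV[R]_n).

Definition l2norm x : R := Num.sqrt (\sum_(i < n) x i 0 ^+ 2).

Definition l2ball c (e : R) : set 'cV[R]_n := [set x | l2norm (x - c) <= e].

(* +oo when S has no finite cover; the centers need not lie in S. *)
Definition covering_number S (e : R) : \bar R :=
  ereal_inf [set (N%:R)%:E | N in
    [set N : nat | exists c : 'I_N -> 'cV[R]_n,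
                     S `<=` \bigcup_(i in setT) l2ball (c i) e]].

Definition signal_class (x_min x_max a b : R) (k : nat) :
    set (set 'cV[R]_n) :=
  [set S : set 'cV[R]_n | [/\ S !=set0,
      S `<=` [set x : 'cV[R]_n | forall i, x_min <= x i 0 <= x_max] &
      forall e : R, 0 < e -> e <= a * n%:R `^ b ->
        (covering_number S e <= ((a * n%:R `^ b / e) ^+ k)%:E)%E]].

End signal_classes.

Section gaussian_model.
Context {R : realType} {d : measure_display} {Omega : measurableType d}.
Variable P : probability Omega R.

(* N(0, s^2), with N(0, 0) the Dirac mass at 0: the library's [normal_prob]
   takes the standard deviation, and for s = 0 it is the uniform law on
   [0, 1]. *)
Definition centered_normal (s : R) : set R -> \bar R :=
  if s == 0 then dirac (0 : R) else normal_prob 0 s.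

Definition sigma_of {d' : measure_display} {T : measurableType d'}
    (X : Omega -> T) : set (set Omega) :=
  preimage_set_system setT X measurable.

Definition mutually_independent {I : finType} (F : I -> set (set Omega)) :=
  forall (J : {set I}) (E : I -> set Omega),
    (forall i, i \in J -> F i (E i)) ->
    P (\bigcap_(i in [set` J]) E i) = (\prod_(i in J) P (E i))%E.

(* In the case q = 1, X has law N(0, s^2 I_p). *)
Definition iid_normal_entries (s : R) {p q : nat} (X : Omega -> 'M[R]_(p, q)) :=
  (forall i j (B : set R), measurable B ->
     P [set o | B (X o i j)] = centered_normal s B) /\
  mutually_independent
    (fun ij : 'I_p * 'I_q => sigma_of (fun o => X o ij.1 ij.2)).

Variables m n L : nat.

(* Independence of all 3L matrices amounts to independence within each of the
   families A, w, z together with mutual independence of these families. *)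
Record gaussian_model (sigma_z : R)
    (A : 'I_L -> {RV P >-> 'M[R]_(m, n)})
    (w : 'I_L -> {RV P >-> 'cV[R]_n})
    (z : 'I_L -> {RV P >-> 'cV[R]_m}) : Prop := GaussianModel {
  model_A : forall l, iid_normal_entries 1 (A l);
  model_w : forall l, iid_normal_entries 1 (w l);
  model_z : forall l, iid_normal_entries sigma_z (z l);
  model_indep : mutually_independent
    (fun i : 'I_L + 'I_L + 'I_L =>
       match i with
       | inl (inl l) => sigma_of (A l)
       | inl (inr l) => sigma_of (w l)
       | inr l => sigma_of (z l)
       end)
}.

Variables (A : 'I_L -> {RV P >-> 'M[R]_(m, n)})
          (w : 'I_L -> {RV P >-> 'cV[R]_n})
          (z : 'I_L -> {RV P >-> 'cV[R]_m}).

Definition observation (x : 'cV[R]_n) (l : 'I_L) (o : Omega) : 'cV[R]_m :=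
  A l o *m diag_mx x^T *m w l o + z l o.

Definition data (x : 'cV[R]_n) (o : Omega) :
    L.-tuple 'cV[R]_m * L.-tuple 'M[R]_(m, n) :=
  ([tuple observation x l o | l < L], [tuple A l o | l < L]).

Definition mean_squared_error
    (xhat : L.-tuple 'cV[R]_m * L.-tuple 'M[R]_(m, n) -> 'cV[R]_n)
    (x : 'cV[R]_n) : \bar R :=
  'E_P[fun o => l2norm (xhat (data x o) - x) ^+ 2 / n%:R].

Definition minimax_risk (S : set 'cV[R]_n) : \bar R :=
  ereal_inf [set ereal_sup [set mean_squared_error xhat x | x in S] |
             xhat in [set xhat | measurable_fun setT xhat]].

End gaussian_model.

(* Main.v *)
From HB Require Import structures.
Require Import Defs.
From mathcomp Require Import all_boot all_order all_algebra.
From mathcomp Require Import all_classical all_reals all_analysis.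
From mathcomp Require Import measurable_realfun.
From mathcomp Require Import zify ring lra.

Set Implicit Arguments.
Unset Strict Implicit.
Unset Printing Implicit Defensive.

Import Order.TTheory GRing.Theory Num.Theory.
Import numFieldNormedType.Exports.

Local Open Scope classical_set_scope.
Local Open Scope ring_scope.

(** The covariance of an observation given its sensing matrix A is V + sigma^2 I
    with V = A diag(x_o^2) A^T, so a candidate signal c can be scored by
    comparing V(c) = A diag(c^2) A^T with y y^T - sigma^2 I in Frobenius norm and
    adding up over the L observations.  The estimator is the average of the
    points of a fine net of the signal class, weighted by exp(- lambda score).
    It is measurable by construction, and its risk needs no uniform control of
    the score: a weight is at most exp(- lambda (score of c - score of c0)), with
    c0 the net point closest to x_o, so it is enough to bound the expectation of
    that ratio for each fixed c.  The expectation factors over the L independent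
    blocks, and is computed in two stages for each block.

    Given A, the observation is Gaussian and the score difference is a quadratic
    form in it.  The Laplace transform of such a form is bounded by induction on
    the number of Gaussian variables, integrating them out one at a time
    ([gaussian_chaos]): a Schur complement step keeps the form small and does not
    increase trace + 3 * (squared Frobenius norm).  For lambda of order 1 / s^2,
    s = max (sigma^2, m, n), this leaves exp(- (lambda / 4) |V(c) - V(c0)|^2), up
    to a discretisation error ([score_diff_exp]), as long as the operator norm of
    A is at most of order sqrt (m + n).

    Averaging over A gives exp(- const lambda m^2 |c^2 - c0^2|^2) ([signal_exp]).
    For m > 1 only the off-diagonal blocks of V(c) - V(c0) are kept, so that two
    disjoint groups of rows are integrated one after the other, each with the
    Laplace bound above.  For m = 1 the matrix is a single number, a weighted sum
    of squared normal variables, and second and fourth moments are enough.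

    The operator norm condition is expressed by finitely many inequalities, one
    for each point of a lattice net, so it is a measurable event; it fails with
    probability at most exp(- 2 n) ([spectral_test_tail]).

    With a net of radius of order n^-3 the logarithm of its cardinality is of
    order k log n, which is beaten by the exponent of all the candidates with
    |c^2 - c0^2|^2 at least a constant times s^2 k log n / (m^2 L).  These
    contribute O(n^-5), the nearer ones are within the announced distance of x_o
    because the coordinates stay above x_min, and the sample size condition
    m L <= n^4 k log n makes the rate at least n^-5. *)

(** * Laws of finite families of real random variables *)

(** Measurability of a function of a whole family of reals, tested along
    arbitrary measurable families; this avoids putting a sigma-algebra on the
    function space [S -> R], and is checked by the same lemmas as the
    measurability of any composite. *)
Definition env_measurable {R : realType} (S : Type) (F : (S -> R) -> R) : Prop :=
  forall d (T : measurableType d) (h : S -> T -> R),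
    (forall s, measurable_fun setT (h s)) ->
    measurable_fun setT (fun t => F (fun s => h s t)).

Section matrix_sigma_algebra.
Context {R : realType}.
Variables p q : nat.

Lemma measurable_mx_coord (i : 'I_p) (j : 'I_q) :
  measurable_fun setT (fun M : 'M[R]_(p, q) => M i j).
Proof.
move=> _ B mB; rewrite setTI.
apply: sub_sigma_algebra; exists (i, j) => //=.
by exists B => //; rewrite setTI.
Qed.

Lemma measurable_mxP d (T : measurableType d) (f : T -> 'M[R]_(p, q)) :
  (forall i j, measurable_fun setT (fun t => f t i j)) ->
  measurable_fun setT f.
Proof.
move=> mf.
apply: (@measurability _ _ _ _ _ _ (\bigcup_(ij in [set: 'I_p * 'I_q])
        preimage_set_system setT (fun M : 'M[R]_(p, q) => M ij.1 ij.2)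
                            measurable)) => //.
move=> _ [_ [[i j] _ [B mB <-]] <-].
by rewrite setTI; have := mf i j measurableT B mB; rewrite !setTI.
Qed.

End matrix_sigma_algebra.

Section same_law.
Context {R : realType} {S : finType}.

Let N := #|S|.
Let vec (T : Type) (g : S -> T -> R) (t : T) : 'M[R]_(N, 1) :=
  \col_i g (enum_val i) t.

Let vecE T (g : S -> T -> R) t s : vec g t (enum_rank s) 0 = g s t.
Proof. by rewrite mxE enum_rankK. Qed.

Let measurable_vec d (T : measurableType d) (g : S -> T -> R) :
  (forall s, measurable_fun setT (g s)) -> measurable_fun setT (vec g).
Proof.
move=> mg; apply: measurable_mxP => i j.
by under eq_fun do rewrite mxE; exact: mg.
Qed.

(* the rectangles: a pi-system that generates the product sigma-algebra *)
Let rect : set (set 'M[R]_(N, 1)) :=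
  [set A | exists2 B : S -> set R, (forall s, measurable (B s)) &
     A = \bigcap_s [set M : 'M[R]_(N, 1) | B s (M (enum_rank s) 0)]].

Let rect_setI : setI_closed rect.
Proof.
move=> _ _ [A mA ->] [B mB ->].
exists (fun s => A s `&` B s); first by move=> s; exact: measurableI.
by rewrite -bigcapI; apply: eq_bigcapr => s _.
Qed.

Let rect_gen : @measurable _ 'M[R]_(N, 1) = <<s rect >>.
Proof.
apply/seteqP; split.
- apply: smallest_sub; first exact: smallest_sigma_algebra.
  move=> _ [[i j] _ [B mB <-]]; apply: sub_sigma_algebra.
  exists (fun s => if s == enum_val i then B else setT).
    by move=> s; case: ifP.
  rewrite setTI; apply/seteqP; split => [M MB s _|M MB] /=.
    case: ifPn => // /eqP ->; rewrite enum_valK.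
    by move: MB => /=; rewrite (ord1 j).
  by have /= := MB (enum_val i) I; rewrite eqxx enum_valK (ord1 j).
- apply: smallest_sub; first exact: sigma_algebra_measurable.
  move=> _ [B mB ->]; apply: fin_bigcap_measurable => // s _.
  rewrite -[X in measurable X]setTI.
  exact: (@measurable_mx_coord R _ _ (enum_rank s) 0 measurableT _ (mB s)).
Qed.

(** The law of a finite family is determined by its values on rectangles, which
    form a pi-system.  The family is turned into a column vector, whose
    sigma-algebra those rectangles generate. *)
Lemma same_law_integral d d' (T : measurableType d) (T' : measurableType d')
    (mu : {measure set T -> \bar R}) (mu' : {measure set T' -> \bar R})
    (g : S -> T -> R) (g' : S -> T' -> R) (F : (S -> R) -> R) :
  (mu setT < +oo)%E ->
  (forall s, measurable_fun setT (g s)) ->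
  (forall s, measurable_fun setT (g' s)) ->
  (forall B : S -> set R, (forall s, measurable (B s)) ->
     mu (\bigcap_s (g s @^-1` B s)) = mu' (\bigcap_s (g' s @^-1` B s))) ->
  env_measurable F -> (forall x, 0 <= F x) ->
  (\int[mu]_t (F (fun s => g s t))%:E = \int[mu']_t (F (fun s => g' s t))%:E)%E.
Proof.
move=> fmu mg mg' gg' mF F0.
pose Fv (M : 'M[R]_(N, 1)) : \bar R := (F (fun s => M (enum_rank s) 0))%:E.
have mFv : measurable_fun setT Fv.
  by apply/measurable_EFinP; apply: mF => s; exact: measurable_mx_coord.
have Fv0 : {in setT, forall M, (0 <= Fv M)%E} by move=> M _; rewrite lee_fin.
transitivity (\int[pushforward mu (vec g)]_M Fv M)%E.
  rewrite (ge0_integral_pushforward (measurable_vec mg))//.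
  by apply: eq_integral => t _ /=; rewrite /Fv; congr (F _)%:E; apply/funext => s;
    rewrite vecE.
transitivity (\int[pushforward mu' (vec g')]_M Fv M)%E; last first.
  rewrite (ge0_integral_pushforward (measurable_vec mg'))//.
  by apply: eq_integral => t _ /=; rewrite /Fv; congr (F _)%:E; apply/funext => s;
    rewrite vecE.
pose X : {mfun T >-> 'M[R]_(N, 1)} :=
  HB.pack (vec g) (isMeasurableFun.Build _ _ _ _ _ (measurable_vec mg)).
pose X' : {mfun T' >-> 'M[R]_(N, 1)} :=
  HB.pack (vec g') (isMeasurableFun.Build _ _ _ _ _ (measurable_vec mg')).
rewrite -[vec g]/(X : _ -> _) -[vec g']/(X' : _ -> _).
apply: eq_measure_integral => A mA _.
apply: (@measure_unique _ _ _ rect (fun=> setT) rect_gen rect_setI) => //.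
- move=> _; exists (fun=> setT) => //.
  by apply/seteqP; split.
- by rewrite bigcup_const.
- move=> _ [B mB ->] /=; rewrite /pushforward.
  have := gg' B mB; congr (_ = _); congr (_ _); apply/seteqP; split => t /= Bt s _;
    by have := Bt s I; rewrite /= vecE.
Qed.

End same_law.

Section independent_family.
Context {R : realType} {d : measure_display} {Omega : measurableType d}.
Variable P : probability Omega R.

(** The product rule over the whole index set; the rule for a subfamily is the
    case where the other sets are full. *)
Definition independent_family (S : finType) (g : S -> Omega -> R) : Prop :=
  (forall s, measurable_fun setT (g s)) /\
  forall B : S -> set R, (forall s, measurable (B s)) ->
    P (\bigcap_s (g s @^-1` B s)) = (\prod_s P (g s @^-1` B s))%E.

(** A Fubini theorem without product laws: drawing the coordinates in [J] and
    the others from two independent copies of the family does not change its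
    law. *)
Lemma independent_resample (S : finType) (g : S -> Omega -> R) (J : pred S)
    (F : (S -> R) -> R) :
  independent_family g -> env_measurable F -> (forall x, 0 <= F x) ->
  (\int[P]_o (F (fun s => g s o))%:E =
   \int[P]_o \int[P]_o' (F (fun s => if J s then g s o else g s o'))%:E)%E.
Proof.
move=> [mg gE] mF F0.
pose h s (o : Omega * Omega) := if J s then g s o.1 else g s o.2.
have mh s : measurable_fun setT (h s).
  rewrite /h; case: (J s).
    by apply: (measurableT_comp (mg s)); exact: measurable_fst.
  by apply: (measurableT_comp (mg s)); exact: measurable_snd.
transitivity (\int[P \x P]_o (F (fun s => h s o))%:E)%E; last first.
  rewrite fubini_tonelli1//; first exact/measurable_EFinP/mF.
  by move=> o; rewrite lee_fin.
apply: same_law_integral => //; first exact: fin_num_fun_lty.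
move=> B mB.
pose B1 s := if J s then B s else setT.
pose B2 s := if J s then setT else B s.
have mB1 s : measurable (B1 s) by rewrite /B1; case: ifP.
have mB2 s : measurable (B2 s) by rewrite /B2; case: ifP.
have mbig C : (forall s, measurable (C s)) ->
    measurable (\bigcap_s (g s @^-1` C s)).
  move=> mC; apply: fin_bigcap_measurable => // s _.
  by rewrite -[X in measurable X]setTI; exact: mg.
have -> : \bigcap_s (h s @^-1` B s) =
    (\bigcap_s (g s @^-1` B1 s)) `*` (\bigcap_s (g s @^-1` B2 s)).
  apply/seteqP; split => [[x y] /= H|[x y] /= [H1 H2] s _].
    by split => s _ /=; have /= := H s I; rewrite /h /B1 /B2 /=; case: (J s).
  have /= := H1 s I; have /= := H2 s I.
  by rewrite /h /B1 /B2 /=; case: (J s).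
transitivity (\prod_s P (g s @^-1` B s))%E; first exact: gE.
rewrite [RHS](_ : _ = (\prod_s P (g s @^-1` B1 s)) *
  (\prod_s P (g s @^-1` B2 s)))%E; last first.
  by rewrite -(gE B1)// -(gE B2)//; apply: product_measure1E; exact: mbig.
rewrite -big_split /=; apply: eq_bigr => s _; rewrite /B1 /B2.
by case: (J s); rewrite preimage_setT probability_setT ?mule1 ?mul1e.
Qed.

(** Subfamilies and reindexings, by taking full sets outside the range of [f]. *)
Lemma independent_family_comp (S S' : finType) (f : S' -> S)
    (g : S -> Omega -> R) :
  injective f -> independent_family g ->
  independent_family (fun s => g (f s)).
Proof.
move=> injf [mg gE]; split => // B mB.
pose C s := if [pick s' | f s' == s] is Some s' then B s' else setT.
have Cf s' : C (f s') = B s'.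
  rewrite /C; case: pickP => [s'' /eqP /injf -> //|/(_ s')].
  by rewrite eqxx.
have mC s : measurable (C s) by rewrite /C; case: pickP.
have CT s : s \notin codom f -> C s = setT.
  rewrite /C; case: pickP => [s' /eqP <-|//].
  by rewrite codom_f.
have := gE C mC.
have -> : \bigcap_s (g s @^-1` C s) = \bigcap_s (g (f s) @^-1` B s).
  apply/seteqP; split => o /= H s _.
    by have := H (f s) I; rewrite /= Cf.
  have [/codomP[s' ->]|/CT ->//] := boolP (s \in codom f).
  by rewrite /= Cf; exact: H.
move=> ->; rewrite (bigID (mem (codom f)))/= [X in (_ * X)%E]big1 ?mule1; last first.
  by move=> s /CT ->; rewrite preimage_setT probability_setT.
have uf : uniq (codom f) by exact/injectiveP.
rewrite -(big_uniq _ uf) big_image /=.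
by apply: eq_bigr => s' _; rewrite Cf.
Qed.

End independent_family.

Section independent_blocks.
Context {R : realType} {d : measure_display} {Omega : measurableType d}.
Variable P : probability Omega R.

Lemma independent_prod_integral (S1 S2 : finType) (g : S1 * S2 -> Omega -> R)
    (F : S1 -> (S2 -> R) -> R) :
  independent_family P g -> (forall i, env_measurable (F i)) ->
  (forall i x, 0 <= F i x) ->
  forall s : seq S1, uniq s ->
  (\int[P]_o (\prod_(i <- s) F i (fun j => g (i, j) o))%:E =
   \prod_(i <- s) \int[P]_o (F i (fun j => g (i, j) o))%:E)%E.
Proof.
move=> gind mF F0; have [mg _] := gind.
elim=> [_|i s IHs /= /andP[iNs us]].
  under eq_integral do rewrite big_nil.
  by rewrite big_nil integral_cst// mul1e; exact: probability_setT.
rewrite big_cons -IHs//.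
pose G (x : S1 * S2 -> R) : R :=
  F i (fun j => x (i, j)) * \prod_(i' <- s) F i' (fun j => x (i', j)).
have mG : env_measurable G.
  move=> d' T h mh; apply: measurable_funM; first exact: mF.
  by apply: measurable_prod => i' _; exact: mF.
have G0 x : 0 <= G x by rewrite mulr_ge0// prodr_ge0.
transitivity (\int[P]_o (G (fun u => g u o))%:E)%E.
  by apply: eq_integral => o _; rewrite big_cons.
rewrite (independent_resample [pred u | u.1 == i] gind mG G0).
have mFi : measurable_fun setT (fun o => (F i (fun j => g (i, j) o))%:E).
  by apply/measurable_EFinP; exact: mF.
have mprod : measurable_fun setT
    (fun o => (\prod_(i' <- s) F i' (fun j => g (i', j) o))%:E).
  by apply/measurable_EFinP; apply: measurable_prod => i' _; exact: mF.
rewrite -ge0_integralZr//; first last.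
- by apply: integral_ge0 => o _; rewrite lee_fin prodr_ge0.
- by move=> o _; rewrite lee_fin.
apply: eq_integral => o _.
rewrite -ge0_integralZl//; first last.
- by rewrite lee_fin.
- by move=> o' _; rewrite lee_fin prodr_ge0.
apply: eq_integral => o' _; rewrite /G /= eqxx EFinM; congr (_ * (_)%:E)%E.
rewrite !big_seq; apply: eq_bigr => i' i's; congr (F i' _).
by apply/funext => j; case: eqP i's iNs => // -> ->.
Qed.

End independent_blocks.

(** * Integration against normal laws *)

Section density.
Context {R : realType} {d : measure_display} {T : measurableType d}.
Variables (mu nu : {measure set T -> \bar R}) (p : T -> R).
Hypothesis mp : measurable_fun setT p.
Hypothesis p0 : forall x, 0 <= p x.
Hypothesis nuE : forall A, measurable A ->
  nu A = (\int[mu]_(x in A) (p x)%:E)%E.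

Import HBNNSimple.

Let integral_density_nnsfun (f : {nnsfun T >-> R}) :
  (\int[nu]_x (f x)%:E = \int[mu]_x (f x * p x)%:E)%E.
Proof.
under [LHS]eq_integral do rewrite fimfunE -fsumEFin//.
rewrite [LHS]ge0_integral_fsum//; last 2 first.
  - by move=> r; exact/measurable_EFinP/measurableT_comp.
  - by move=> n x _; rewrite EFinM nnfun_muleindic_ge0.
under [RHS]eq_integral.
  move=> x xD; rewrite EFinM fimfunE -fsumEFin// ge0_mule_fsuml; last first.
    by move=> r; rewrite EFinM nnfun_muleindic_ge0.
  over.
rewrite [RHS]ge0_integral_fsum//; last 2 first.
  - move=> r; apply: emeasurable_funM; last exact/measurable_EFinP.
    by apply/measurable_EFinP; apply: measurable_funM => //; exact: measurable_indic.
  - move=> n x _; apply: mule_ge0; last by rewrite lee_fin.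
    by rewrite EFinM nnfun_muleindic_ge0.
apply: eq_fsbigr => r _; rewrite integralZl_indic_nnsfun//= integral_indic// setIT.
have mr : measurable (f @^-1` [set r]) by [].
rewrite nuE// integral_mkcond.
have [r0|r0] := ltP r 0.
  rewrite preimage_nnfun0// !integral0_eq ?mule0// => x _.
    by rewrite /= indicE in_set0 mulr0 mul0e.
  by rewrite /patch in_set0.
rewrite -ge0_integralZl//; first last.
- by move=> x _; rewrite /patch; case: ifP => // _; rewrite lee_fin.
- apply/(measurable_restrictT _ _).1 => //.
  by apply: measurable_funTS; exact/measurable_EFinP.
apply: eq_integral => x _; rewrite /patch indicE.
by case: ifP; rewrite /= ?mulr1 ?mulr0 ?mule0 ?mul0e.
Qed.

(** Change of density; true for simple functions by definition of [nu], then by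
    monotone convergence. *)
Lemma ge0_integral_density (f : T -> \bar R) :
  measurable_fun setT f -> (forall x, (0 <= f x)%E) ->
  (\int[nu]_x f x = \int[mu]_x (f x * (p x)%:E))%E.
Proof.
move=> mf f0.
pose f_ := nnsfun_approx measurableT mf.
transitivity (lim (\int[nu]_x (f_ n x)%:E @[n --> \oo])%E).
  rewrite -monotone_convergence//=.
  - apply: eq_integral => ? /[!inE] xD; apply/esym/cvg_lim => //=.
    exact: cvg_nnsfun_approx.
  - by move=> n; exact/measurable_EFinP/measurable_funTS.
  - by move=> n ? _; rewrite lee_fin.
  - by move=> ? _ ? ? mn; rewrite lee_fin; exact/lefP/nd_nnsfun_approx.
under eq_fun do rewrite integral_density_nnsfun.
rewrite -monotone_convergence//=.
- apply: eq_integral => x _; apply/cvg_lim => //=.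
  under eq_fun do rewrite EFinM.
  by apply: cvgeMr => //; apply: cvg_nnsfun_approx.
- by move=> n; apply/measurable_EFinP/measurable_funM => //; exact/measurable_funTS.
- by move=> n ? _; rewrite lee_fin mulr_ge0.
- move=> x _ a b ab; rewrite lee_fin ler_wpM2r//.
  exact/lefP/nd_nnsfun_approx.
Qed.

End density.

Section normal_mgf.
Context {R : realType}.

Definition normal_law {d} {Omega : measurableType d} (P : probability Omega R)
    (s : R) (X : Omega -> R) : Prop :=
  measurable_fun setT X /\
  forall B, measurable B -> P [set o | B (X o)] = centered_normal s B.

(** Completing the square: the integrand times the density of N(0, s^2) is, up to
    the constant on the right, the density of the normal law with variance
    s^2 / (1 - 2 al s^2) and mean be times that variance. *)
Lemma normal_exp_quadratic (s al be : R) : s != 0 -> 2 * al * s ^+ 2 < 1 ->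
  (\int[normal_prob 0 s]_x (expR (al * x ^+ 2 + be * x))%:E =
   ((Num.sqrt (1 - 2 * al * s ^+ 2))^-1 *
    expR (be ^+ 2 * s ^+ 2 / (2 * (1 - 2 * al * s ^+ 2))))%:E)%E.
Proof.
move=> s0 als.
set k := 1 - 2 * al * s ^+ 2.
have k0 : 0 < k by rewrite subr_gt0.
have s20 : 0 < s ^+ 2 by rewrite exprn_even_gt0.
pose s' := s / Num.sqrt k; pose m' := be * s ^+ 2 / k.
have sk0 : 0 < Num.sqrt k by rewrite sqrtr_gt0.
have s'0 : s' != 0 by rewrite mulf_neq0// invr_neq0// gt_eqF.
have s'2 : s' ^+ 2 = s ^+ 2 / k by rewrite /s' exprMn exprVn sqr_sqrtr// ltW.
set C := (X in _ = X%:E).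
rewrite (@ge0_integral_density _ _ _ lebesgue_measure (normal_prob 0 s)
  (normal_pdf 0 s))//; first last.
- apply/measurable_EFinP; apply: measurableT_comp => //.
  by apply: measurable_funD; apply: measurable_funM => //; exact: measurable_funX.
- by move=> x; exact: normal_pdf_ge0.
- exact: measurable_normal_pdf.
transitivity (\int[lebesgue_measure]_x (C%:E * (normal_pdf m' s' x)%:E))%E.
  apply: eq_integral => x _; rewrite -!EFinM; congr (_%:E).
  rewrite !normal_pdfE//.
  have -> : normal_peak s' = normal_peak s * Num.sqrt k.
    rewrite /normal_peak s'2.
    have -> : s ^+ 2 / k * pi *+ 2 = (s ^+ 2 * pi *+ 2) * k^-1 by rewrite mulrnAl mulrAC.
    rewrite sqrtrM; last by rewrite mulrn_wge0// mulr_ge0 ?pi_ge0// ltW.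
    by rewrite sqrtrV ?ltW// invfM invrK.
  rewrite /C mulrACA.
  have -> : (Num.sqrt k)^-1 * (normal_peak s * Num.sqrt k) = normal_peak s.
    by rewrite mulrCA mulVf ?mulr1// gt_eqF.
  rewrite [LHS]mulrCA; congr (_ * _).
  rewrite /normal_fun -!expRD; congr expR.
  rewrite s'2 /m' /k; field.
  by rewrite -/k; rewrite s0 gt_eqF.
rewrite ge0_integralZl//; first last.
- by rewrite lee_fin mulr_ge0// ?expR_ge0// invr_ge0 ltW.
- by move=> x _; rewrite lee_fin normal_pdf_ge0.
- by apply/measurable_EFinP; exact: measurable_normal_pdf.
by rewrite integral_normal_pdf mule1.
Qed.

Lemma ge0_integral_normal_law d (Omega : measurableType d)
    (P : probability Omega R) s X (f : R -> \bar R) :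
  normal_law P s X -> measurable_fun setT f -> (forall x, (0 <= f x)%E) ->
  (\int[P]_o f (X o) =
   if (s == 0)%R then f 0%R else \int[normal_prob 0 s]_x f x)%E.
Proof.
move=> [mX XE] mf f0.
(* The canonical measurable structure on R and the one carrying the normal
   laws have the same sets but distinct displays. *)
have mX' : @measurable_fun _ _ Omega (measurableTypeR R) setT X by exact: mX.
have mf' : @measurable_fun _ _ (measurableTypeR R) (\bar R) setT f by exact: mf.
pose Y : {mfun Omega >-> measurableTypeR R} :=
  HB.pack X (isMeasurableFun.Build _ _ _ _ _ mX').
transitivity (\int[pushforward P Y]_x f x)%E.
  by rewrite ge0_integral_pushforward.
have {}XE B : measurable B -> pushforward P Y B = centered_normal s B.
  exact: XE.
case: ifPn => s0.
  transitivity (\int[dirac (0%R : measurableTypeR R)]_x f x)%E.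
    apply: eq_measure_integral => B mB _.
    by have := XE B mB; rewrite /centered_normal s0.
  rewrite integral_dirac// diracT mul1e//.
apply: eq_measure_integral => B mB _.
by have := XE B mB; rewrite /centered_normal (negbTE s0).
Qed.

(** The formula also holds for s = 0, where both sides are 1; the noise level is
    allowed to vanish. *)
Lemma normal_law_exp_quadratic d (Omega : measurableType d)
    (P : probability Omega R) s X (al be : R) :
  normal_law P s X -> 2 * al * s ^+ 2 < 1 ->
  (\int[P]_o (expR (al * X o ^+ 2 + be * X o))%:E =
   ((Num.sqrt (1 - 2 * al * s ^+ 2))^-1 *
    expR (be ^+ 2 * s ^+ 2 / (2 * (1 - 2 * al * s ^+ 2))))%:E)%E.
Proof.
move=> HX als.
rewrite (ge0_integral_normal_law (f := fun x => (expR (al * x ^+ 2 + be * x))%:E) HX).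
- case: ifPn => [/eqP ->|s0]; last exact: normal_exp_quadratic.
  by rewrite expr0n /= !mulr0 !addr0 subr0 sqrtr1 invr1 mul0r expR0 mul1r.
- apply/measurable_EFinP; apply: measurableT_comp => //.
  by apply: measurable_funD; apply: measurable_funM => //; exact: measurable_funX.
- by move=> x; rewrite lee_fin expR_ge0.
Qed.

End normal_mgf.

(** * Laplace transform of a Gaussian quadratic form *)

Section quadratic_form.
Context {R : realType}.

Definition qform {N : nat} (M : 'I_N -> 'I_N -> R) (x : 'I_N -> R) : R :=
  \sum_i \sum_j M i j * x i * x j.

(** The form that remains once the coordinate 0 has been integrated out: for a
    standard normal variable g0 and z the linear form given by the first row,
    the expectation of exp(u g0^2 + 2 z g0) is a constant times
    exp(c z^2) with c = 2 / (1 - 2 u). *)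
Definition schur_step {N : nat} (M : 'I_N.+1 -> 'I_N.+1 -> R) (c : R)
    (i j : 'I_N) : R :=
  M (lift ord0 i) (lift ord0 j) +
  c * (M ord0 (lift ord0 i) * M ord0 (lift ord0 j)).

Definition fcons {N : nat} (t : R) (x : 'I_N -> R) (i : 'I_N.+1) : R :=
  if unlift ord0 i is Some j then x j else t.

Lemma fcons0 N t (x : 'I_N -> R) : fcons t x ord0 = t.
Proof. by rewrite /fcons unlift_none. Qed.

Lemma fconsS N t (x : 'I_N -> R) j : fcons t x (lift ord0 j) = x j.
Proof. by rewrite /fcons liftK. Qed.

Lemma qform_recl N (M : 'I_N.+1 -> 'I_N.+1 -> R) x :
  (forall i j, M i j = M j i) ->
  qform M x = M ord0 ord0 * x ord0 ^+ 2 +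
    2 * (\sum_i M ord0 (lift ord0 i) * x (lift ord0 i)) * x ord0 +
    qform (fun i j => M (lift ord0 i) (lift ord0 j)) (fun i => x (lift ord0 i)).
Proof.
move=> symM; rewrite /qform big_ord_recl big_ord_recl /=.
under [X in _ + X]eq_bigr do rewrite big_ord_recl /=.
rewrite big_split /= -mulrA -expr2 -!addrA; congr (_ + _).
rewrite addrA; congr (_ + _).
rewrite mulr_sumr mulr_suml -big_split /=; apply: eq_bigr => i _.
by rewrite (symM (lift ord0 i) ord0); ring.
Qed.

Lemma qform_schur N (M : 'I_N.+1 -> 'I_N.+1 -> R) c x :
  qform (schur_step M c) x =
  qform (fun i j => M (lift ord0 i) (lift ord0 j)) x +
  c * (\sum_i M ord0 (lift ord0 i) * x i) ^+ 2.
Proof.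
rewrite expr2 big_distrlr /= /qform mulr_sumr -big_split /=.
apply: eq_bigr => i _; rewrite mulr_sumr -big_split /=; apply: eq_bigr => j _.
by rewrite /schur_step; ring.
Qed.

(** Spectral norm at most 1/16, for symmetric [M]. *)
Definition small_form {N : nat} (M : 'I_N -> 'I_N -> R) : Prop :=
  forall x, `|qform M x| <= 16^-1 * \sum_i x i ^+ 2.

Section step.
Variables (N : nat) (M : 'I_N.+1 -> 'I_N.+1 -> R).
Hypothesis symM : forall i j, M i j = M j i.
Hypothesis smallM : small_form M.

Let u := M ord0 ord0.
Let b (i : 'I_N) := M ord0 (lift ord0 i).
Let M' (i j : 'I_N) := M (lift ord0 i) (lift ord0 j).
Let k := 1 - 2 * u.
Let c := 2 / k.

Let form_le t x : `|u * t ^+ 2 + 2 * (\sum_i b i * x i) * t + qform M' x| <=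
  16^-1 * (t ^+ 2 + \sum_i x i ^+ 2).
Proof.
have := smallM (fcons t x).
rewrite qform_recl// big_ord_recl !fcons0.
under eq_bigr do rewrite fconsS.
under [X in _ <= _ * (_ + X)]eq_bigr do rewrite fconsS.
have -> : (fun i => fcons t x (lift ord0 i)) = x.
  by apply/funext => i; rewrite fconsS.
by [].
Qed.

Let qform0 (K : 'I_N -> 'I_N -> R) : qform K (fun=> 0) = 0.
Proof. by rewrite /qform big1// => i _; rewrite big1// => j _; rewrite mulr0. Qed.

Lemma small_form_corner : `|u| <= 16^-1.
Proof.
have := form_le 1 (fun=> 0).
rewrite qform0 big1 ?big1; [|by move=> i _; rewrite expr0n|by move=> i _; rewrite mulr0].
by rewrite expr1n !mulr1 !mulr0 !addr0 mulr1.
Qed.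

Let uP : - 16^-1 <= u <= 16^-1.
Proof. by rewrite -ler_norml small_form_corner. Qed.

Let k_ge : 7 / 8 <= k. Proof. by move: uP => /andP[_ ?]; rewrite /k; lra. Qed.
Let k_gt0 : 0 < k. Proof. by apply: lt_le_trans k_ge; lra. Qed.
Let kV_le : k^-1 <= 8 / 7.
Proof. by rewrite -(invrK (8 / 7)) lef_pV2 ?posrE// ?invf_div//; lra. Qed.
Let kV_gt0 : 0 < k^-1. Proof. by rewrite invr_gt0. Qed.

Let qform'_le x : `|qform M' x| <= 16^-1 * \sum_i x i ^+ 2.
Proof.
have := form_le 0 x.
by rewrite expr0n /= !mulr0 !add0r.
Qed.

(** The upper bound is the bound on [M] at the point whose eliminated coordinate
    is t = 2 z / k, with z the linear form of the first row; the choice leaves a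
    slack of (7/4) (z/k)^2.  The lower bound only loses a nonnegative square. *)
Lemma small_form_schur : small_form (schur_step M c).
Proof.
move=> x; rewrite qform_schur -/M' -/b ler_norml; apply/andP; split.
  have := qform'_le x; rewrite ler_norml => /andP[+ _].
  have : 0 <= c * (\sum_i b i * x i) ^+ 2.
    by rewrite mulr_ge0 ?sqr_ge0// /c divr_ge0// ltW.
  by rewrite -/b -/M' /b; lra.
pose z := \sum_i b i * x i.
have := form_le (2 * z / k) x; rewrite -/z ler_norml => /andP[_].
set X := \sum_i x i ^+ 2; set Q := qform M' x => H.
rewrite -/z -/Q /c.
suff E : 16^-1 * X - (Q + 2 / k * z ^+ 2) =
  (16^-1 * ((2 * z / k) ^+ 2 + X) -
   (u * (2 * z / k) ^+ 2 + 2 * z * (2 * z / k) + Q)) +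
  (7 / 4) * (z / k) ^+ 2.
  rewrite -subr_ge0 E addr_ge0 ?subr_ge0//.
  by rewrite mulr_ge0 ?sqr_ge0//; lra.
rewrite /k; field; rewrite -/k; exact: lt0r_neq0.
Qed.

Let B := \sum_i b i ^+ 2.

Let B_ge0 : 0 <= B. Proof. by apply: sumr_ge0 => i _; exact: sqr_ge0. Qed.

Let bb : \sum_i b i * b i = B.
Proof. by apply: eq_bigr => i _; rewrite expr2. Qed.

(* test the form at the first row itself, with weight 8 B on coordinate 0 *)
Let B_le : B <= 64^-1.
Proof.
have := form_le (8 * B) b; rewrite bb -/B ler_norml => /andP[_].
have := qform'_le b; rewrite -/B ler_norml => /andP[+ _].
move: (qform M' b) => Q HQ H.
have H2 : 2 * B * (8 * B) <= 8^-1 * (8 * B) ^+ 2 + 8^-1 * B.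
  have : - u * (8 * B) ^+ 2 <= 16^-1 * (8 * B) ^+ 2.
    by rewrite ler_wpM2r ?sqr_ge0//; move: uP => /andP[]; lra.
  by move: H HQ; lra.
have [B0|B0] := eqVneq B 0; first by rewrite B0; lra.
have Bp : 0 < B by rewrite lt_neqAle eq_sym B0.
have : B * (8 * B) <= B * 8^-1 by move: H2; rewrite !expr2; lra.
by rewrite ler_pM2l//; lra.
Qed.

(** The potential trace + 3 * (squared Frobenius norm) decreases at each step by
    at least u / k, which is the price of the integrated coordinate
    ([sqrtrV_le_expR]).  The increase of the trace, c * B, is paid by the 2 * B
    of off-diagonal mass that disappears from the Frobenius norm; the factor 3
    leaves enough room for that. *)
Lemma schur_step_potential :
  u / k + \sum_i schur_step M c i i + 3 * (\sum_i \sum_j schur_step M c i j ^+ 2) <=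
  \sum_i M i i + 3 * (\sum_i \sum_j M i j ^+ 2).
Proof.
pose F' := \sum_i \sum_j M' i j ^+ 2.
have -> : \sum_i \sum_j M i j ^+ 2 = u ^+ 2 + 2 * B + F'.
  rewrite big_ord_recl big_ord_recl -/u.
  under [X in _ + X]eq_bigr do rewrite big_ord_recl symM.
  by rewrite big_split /= -/B -/F'; ring.
have -> : \sum_i schur_step M c i i = \sum_i M' i i + c * B.
  by rewrite /schur_step big_split /= -mulr_sumr bb.
have -> : \sum_i \sum_j schur_step M c i j ^+ 2 =
    F' + 2 * c * qform M' b + c ^+ 2 * B ^+ 2.
  have -> : B ^+ 2 = \sum_i \sum_j (b i * b i) * (b j * b j).
    by rewrite -bb expr2 big_distrlr.
  rewrite /F' /qform !mulr_sumr -!big_split /=; apply: eq_bigr => i _.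
  rewrite !mulr_sumr -!big_split /=; apply: eq_bigr => j _.
  by rewrite /schur_step -/(b i) -/(b j) -/(M' i j); ring.
have -> : \sum_i M i i = u + \sum_i M' i i by rewrite big_ord_recl.
have := qform'_le b; rewrite -/B ler_norml => /andP[_].
move: (qform M' b) => Q HQ.
have uk : u / k = u + 2 * u ^+ 2 * k^-1.
  by rewrite /k; field; rewrite -/k; exact: lt0r_neq0.
rewrite uk /c.
have H1 : u ^+ 2 * k^-1 <= u ^+ 2 * (8 / 7) by rewrite ler_wpM2l// sqr_ge0.
have H2 : B * k^-1 <= B * (8 / 7) by rewrite ler_wpM2l.
have H3 : k^-1 * Q <= k^-1 * (16^-1 * B) by rewrite ler_wpM2l// ltW.
have H4 : (k^-1) ^+ 2 * B ^+ 2 <= (8 / 7) ^+ 2 * (64^-1 * B).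
  rewrite [B ^+ 2]expr2; apply: ler_pM; rewrite ?sqr_ge0 ?mulr_ge0//.
    by rewrite lerXn2r// ?nnegrE; [exact: ltW|lra].
  by rewrite ler_wpM2r.
have := sqr_ge0 u.
rewrite exprMn.
move: H1 H2 H3 H4 B_ge0; move: (u ^+ 2) (k^-1) => U K.
by lra.
Qed.

End step.
End quadratic_form.

Section gaussian_chaos.
Context {R : realType} {d : measure_display} {Omega : measurableType d}.
Variable P : probability Omega R.

Lemma integral_probability_cst (r : \bar R) : (\int[P]__ r = r)%E.
Proof.
rewrite integral_cst// -[RHS]mule1; congr (_ * _)%E; exact: probability_setT.
Qed.

Lemma env_measurable_qform N (M : 'I_N -> 'I_N -> R) :
  env_measurable (qform M).
Proof.
move=> d' T h mh; apply: measurable_sum => i; apply: measurable_sum => j.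
by apply: measurable_funM => //; apply: measurable_funM.
Qed.

Lemma env_measurable_expR (S : Type) (F : (S -> R) -> R) :
  env_measurable F -> env_measurable (fun x => expR (F x)).
Proof.
by move=> mF d' T h mh; apply: measurableT_comp => //; exact: mF.
Qed.

(** The normalising constant of one Gaussian integration; equality to first
    order in [u]. *)
Lemma sqrtrV_le_expR (u : R) : 0 < 1 - 2 * u ->
  (Num.sqrt (1 - 2 * u))^-1 <= expR (u / (1 - 2 * u)).
Proof.
move=> k0; rewrite -sqrtrV ?(ltW k0)//.
rewrite -[leRHS]ger0_norm ?expR_ge0// -sqrtr_sqr ler_sqrt; last first.
  by rewrite exprn_ge0// expR_ge0.
rewrite -expRM_natl; apply: le_trans (expR_ge1Dx _).
suff E : (1 - 2 * u)^-1 = 1 + 2 * (u / (1 - 2 * u)) by rewrite -E.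
by field; exact: lt0r_neq0.
Qed.

(** The exact value is a determinant to the power -1/2.  Integrating one variable
    at a time avoids determinants and spectral decompositions altogether. *)
Lemma gaussian_chaos N (g : 'I_N -> Omega -> R) (s : 'I_N -> R)
    (M : 'I_N -> 'I_N -> R) :
  independent_family P g -> (forall i, normal_law P (s i) (g i)) ->
  (forall i j, M i j = M j i) ->
  small_form (fun i j => M i j * s i * s j) ->
  (\int[P]_o (expR (qform M (fun i => g i o)))%:E <=
   (expR (\sum_i M i i * s i * s i +
          3 * (\sum_i \sum_j (M i j * s i * s j) ^+ 2)))%:E)%E.
Proof.
elim: N => [|N IH] in g s M *.
  move=> _ _ _ _; rewrite !big_ord0 mulr0 addr0 expR0.
  under eq_integral do rewrite /qform big_ord0 expR0.
  by rewrite integral_probability_cst.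
move=> gind gN symM smallM.
pose Mt i j := M i j * s i * s j.
have symMt i j : Mt i j = Mt j i by rewrite /Mt symM mulrAC.
pose u := Mt ord0 ord0; pose k := 1 - 2 * u.
have u16 := small_form_corner symMt smallM.
have k0 : 0 < k.
  by move: u16; rewrite ler_norml /k /u => /andP[_ ?]; lra.
pose c := 2 * s ord0 ^+ 2 / k.
pose M2 := schur_step M c.
have [mg _] := gind.
have sE i j : M2 i j * s (lift ord0 i) * s (lift ord0 j) =
    schur_step Mt (2 / k) i j.
  by rewrite /M2 /schur_step /Mt /c; ring.
have IHM : (\int[P]_o (expR (qform M2 (fun i => g (lift ord0 i) o)))%:E <=
    (expR (\sum_i schur_step Mt (2 / k) i i +
          3 * (\sum_i \sum_j schur_step Mt (2 / k) i j ^+ 2)))%:E)%E.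
  have := IH (fun i => g (lift ord0 i)) (fun i => s (lift ord0 i)) M2.
  under eq_bigr do rewrite sE.
  under [X in _ + 3 * X]eq_bigr do under eq_bigr do rewrite sE.
  apply.
  - by apply: (independent_family_comp (f := lift ord0)) gind; exact: lift_inj.
  - by move=> i; exact: gN.
  - by move=> i j; rewrite /M2 /schur_step [M (lift _ _) _]symM; ring.
  - have -> : (fun i j => M2 i j * s (lift ord0 i) * s (lift ord0 j)) =
        schur_step Mt (2 / k) by apply/funext => i; apply/funext => j; exact: sE.
    exact: small_form_schur.
have mF := env_measurable_expR (env_measurable_qform M).
rewrite (independent_resample (pred_of_simpl (predC1 ord0)) gind mF)//.
have inner o : (\int[P]_o' (expR (qform M
      (fun i => if predC1 ord0 i then g i o else g i o')))%:E =
    ((Num.sqrt k)^-1)%:E * (expR (qform M2 (fun i => g (lift ord0 i) o)))%:E)%E.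
  pose z := \sum_i M ord0 (lift ord0 i) * g (lift ord0 i) o.
  pose Q := qform (fun i j => M (lift ord0 i) (lift ord0 j))
              (fun i => g (lift ord0 i) o).
  transitivity (\int[P]_o' ((expR Q)%:E *
      (expR (M ord0 ord0 * g ord0 o' ^+ 2 + (2 * z) * g ord0 o'))%:E))%E.
    apply: eq_integral => o' _; rewrite -EFinM -expRD; congr (expR _)%:E.
    by rewrite qform_recl//= addrC.
  rewrite ge0_integralZl//; last first.
    apply/measurable_EFinP; apply: measurableT_comp => //.
    apply: measurable_funD; apply: measurable_funM => //.
    exact: measurable_funX.
  have kE : k = 1 - 2 * M ord0 ord0 * s ord0 ^+ 2 by rewrite /k /u /Mt; ring.
  rewrite (normal_law_exp_quadratic (s := s ord0))//; last first.
    by rewrite -subr_gt0 -kE.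
  rewrite -kE -!EFinM; congr (_%:E).
  rewrite mulrCA; congr (_ * _); rewrite -expRD; congr expR.
  rewrite /M2 qform_schur -/z -/Q; congr (_ + _).
  by rewrite /c; field; exact: lt0r_neq0.
under eq_integral do rewrite inner.
have mM2 : measurable_fun setT
    (fun o => (expR (qform M2 (fun i => g (lift ord0 i) o)))%:E).
  by apply/measurable_EFinP/(env_measurable_expR (env_measurable_qform M2)).
rewrite ge0_integralZl//.
have pot := schur_step_potential symMt smallM.
apply: (@le_trans _ _ ((expR (u / k))%:E *
  (expR (\sum_i schur_step Mt (2 / k) i i +
          3 * (\sum_i \sum_j schur_step Mt (2 / k) i j ^+ 2)))%:E)%E).
  apply: lee_pmul; rewrite ?lee_fin ?invr_ge0 ?sqrtr_ge0 ?sqrtrV_le_expR//.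
  by apply: integral_ge0 => o _; rewrite lee_fin expR_ge0.
by rewrite -EFinM -expRD lee_fin ler_expR addrA.
Qed.

End gaussian_chaos.

(** * Frobenius inner product and weighted Gram matrices *)

Section frobenius.
Context {R : realType}.

Definition frob {p q} (M N : 'M[R]_(p, q)) : R := \tr (M^T *m N).
Definition sqnorm {p q} (M : 'M[R]_(p, q)) : R := frob M M.
Definition op_bounded {p q} (A : 'M[R]_(p, q)) (t : R) : Prop :=
  forall x : 'cV[R]_q, sqnorm (A *m x) <= t * sqnorm x.

Lemma frobE p q (M N : 'M[R]_(p, q)) : frob M N = \sum_i \sum_j M i j * N i j.
Proof.
rewrite /frob /mxtrace exchange_big /=; apply: eq_bigr => i _.
by rewrite mxE; apply: eq_bigr => j _; rewrite mxE.
Qed.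

Lemma sqnormE p q (M : 'M[R]_(p, q)) : sqnorm M = \sum_i \sum_j M i j ^+ 2.
Proof.
by rewrite /sqnorm frobE; apply: eq_bigr => i _; apply: eq_bigr => j _;
  rewrite expr2.
Qed.

Lemma sqnorm_colE p (x : 'cV[R]_p) : sqnorm x = \sum_i x i 0 ^+ 2.
Proof. by rewrite sqnormE; apply: eq_bigr => i _; rewrite big_ord1. Qed.

Lemma frob_colE p (x y : 'cV[R]_p) : frob x y = \sum_i x i 0 * y i 0.
Proof. by rewrite frobE; apply: eq_bigr => i _; rewrite big_ord1. Qed.

Lemma sqnorm_ge0 p q (M : 'M[R]_(p, q)) : 0 <= sqnorm M.
Proof.
by rewrite sqnormE; apply: sumr_ge0 => i _; apply: sumr_ge0 => j _; exact: sqr_ge0.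
Qed.

Lemma frobC p q (M N : 'M[R]_(p, q)) : frob M N = frob N M.
Proof. by rewrite /frob -mxtrace_tr trmx_mul trmxK. Qed.

Lemma frob_tr p q (M N : 'M[R]_(p, q)) : frob M^T N^T = frob M N.
Proof. by rewrite /frob trmxK mxtrace_mulC; exact: frobC. Qed.

Lemma sqnorm_tr p q (M : 'M[R]_(p, q)) : sqnorm M^T = sqnorm M.
Proof. exact: frob_tr. Qed.

Lemma frobDr p q (M N K : 'M[R]_(p, q)) : frob M (N + K) = frob M N + frob M K.
Proof. by rewrite /frob mulmxDr mxtraceD. Qed.

Lemma frobDl p q (M N K : 'M[R]_(p, q)) : frob (N + K) M = frob N M + frob K M.
Proof. by rewrite frobC frobDr !(frobC M). Qed.

Lemma frobZr p q c (M N : 'M[R]_(p, q)) : frob M (c *: N) = c * frob M N.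
Proof. by rewrite /frob -scalemxAr mxtraceZ. Qed.

Lemma frobNr p q (M N : 'M[R]_(p, q)) : frob M (- N) = - frob M N.
Proof. by rewrite -scaleN1r frobZr mulN1r. Qed.

Lemma frobZl p q c (M N : 'M[R]_(p, q)) : frob (c *: M) N = c * frob M N.
Proof. by rewrite frobC frobZr frobC. Qed.

Lemma sqnormZ p q c (M : 'M[R]_(p, q)) : sqnorm (c *: M) = c ^+ 2 * sqnorm M.
Proof. by rewrite /sqnorm frobZr frobZl mulrA expr2. Qed.

Lemma sqnormD p q (M N : 'M[R]_(p, q)) :
  sqnorm (M + N) = sqnorm M + 2 * frob M N + sqnorm N.
Proof. by rewrite /sqnorm frobDr !frobDl (frobC N M); ring. Qed.

Lemma sqnormB p q (M N : 'M[R]_(p, q)) :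
  sqnorm (M - N) = sqnorm M - 2 * frob M N + sqnorm N.
Proof.
by rewrite sqnormD frobNr -[- N]scaleN1r sqnormZ sqrrN expr1n mul1r mulrN.
Qed.

Lemma frob_mulmxl p q r (A : 'M[R]_(p, q)) (M : 'M[R]_(q, r)) (N : 'M[R]_(p, r)) :
  frob (A *m M) N = frob M (A^T *m N).
Proof. by rewrite /frob trmx_mul mulmxA. Qed.

(** Cauchy-Schwarz, from the nonnegativity of |N - t M|^2 for all [t]. *)
Lemma frob_CS p q (M N : 'M[R]_(p, q)) : frob M N ^+ 2 <= sqnorm M * sqnorm N.
Proof.
have H (t : R) : 0 <= sqnorm N - 2 * t * frob M N + t ^+ 2 * sqnorm M.
  have := sqnorm_ge0 (N - t *: M); rewrite sqnormB frobZr sqnormZ frobC.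
  by rewrite mulrA.
have [M0|M0] := eqVneq (sqnorm M) 0.
  rewrite M0 mul0r.
  have [->|f0] := eqVneq (frob M N) 0; first by rewrite expr0n.
  have := H ((sqnorm N + 1) / (2 * frob M N)); rewrite M0 mulr0 addr0.
  have -> : 2 * ((sqnorm N + 1) / (2 * frob M N)) * frob M N = sqnorm N + 1.
    by field.
  by lra.
have Mp : 0 < sqnorm M by rewrite lt_neqAle eq_sym M0 sqnorm_ge0.
have := H (frob M N / sqnorm M).
have -> : sqnorm N - 2 * (frob M N / sqnorm M) * frob M N +
   (frob M N / sqnorm M) ^+ 2 * sqnorm M =
   (sqnorm M * sqnorm N - frob M N ^+ 2) / sqnorm M by field.
by rewrite pmulr_lge0 ?invr_gt0// subr_ge0.
Qed.

Lemma sqnorm_colsum p q (M : 'M[R]_(p, q)) : sqnorm M = \sum_j sqnorm (col j M).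
Proof.
rewrite sqnormE exchange_big /=; apply: eq_bigr => j _.
by rewrite sqnorm_colE; apply: eq_bigr => i _; rewrite mxE.
Qed.

Lemma op_bounded_mulmx p q r (A : 'M[R]_(p, q)) t (M : 'M[R]_(q, r)) :
  op_bounded A t -> sqnorm (A *m M) <= t * sqnorm M.
Proof.
move=> At; rewrite !sqnorm_colsum mulr_sumr; apply: ler_sum => j _.
by rewrite colE -mulmxA -colE; exact: At.
Qed.

Lemma op_bounded_tr p q (A : 'M[R]_(p, q)) t :
  0 <= t -> op_bounded A t -> op_bounded A^T t.
Proof.
move=> t0 At y; set z := A^T *m y.
have E : sqnorm z = frob y (A *m z) by rewrite /sqnorm {1}/z frob_mulmxl trmxK.
have H : sqnorm z ^+ 2 <= sqnorm y * (t * sqnorm z).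
  rewrite [in leLHS]E; apply: le_trans (frob_CS _ _) _.
  by rewrite ler_wpM2l ?sqnorm_ge0//; exact: At.
have [z0|z0] := eqVneq (sqnorm z) 0; first by rewrite z0 mulr_ge0 ?sqnorm_ge0.
have zp : 0 < sqnorm z by rewrite lt_neqAle eq_sym z0 sqnorm_ge0.
by rewrite -(ler_pM2r zp) -expr2; apply: le_trans H _; rewrite mulrCA mulrA.
Qed.

Lemma op_bounded_mulmxr p q r (A : 'M[R]_(p, q)) t (M : 'M[R]_(r, p)) :
  0 <= t -> op_bounded A t -> sqnorm (M *m A) <= t * sqnorm M.
Proof.
move=> t0 At; rewrite -sqnorm_tr trmx_mul -[sqnorm M]sqnorm_tr.
exact/op_bounded_mulmx/op_bounded_tr.
Qed.

Lemma qform_frob N (M : 'M[R]_N) (u : 'cV[R]_N) :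
  qform (fun i j => M i j) (fun i => u i 0) = frob u (M *m u).
Proof.
rewrite frob_colE; apply: eq_bigr => i _; rewrite mxE mulr_sumr.
by apply: eq_bigr => j _; ring.
Qed.

End frobenius.

Section weighted_gram_matrices.
Context {R : realType}.

Lemma frob_congruence p q (S : 'M[R]_(p, q)) (D : 'M[R]_p) (x : 'cV[R]_q) :
  frob x (S^T *m D *m S *m x) = frob (S *m x) (D *m (S *m x)).
Proof. by rewrite frob_mulmxl !mulmxA. Qed.

(** The covariance of [A *m X *m w] for a standard normal vector [w] and a
    diagonal [X] with squared entries [th]. *)
Definition weighted_gram {p q} (A : 'M[R]_(p, q)) (th : 'rV[R]_q) : 'M[R]_p :=
  A *m diag_mx th *m A^T.

Lemma weighted_gram_sym p q (A : 'M[R]_(p, q)) th :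
  (weighted_gram A th)^T = weighted_gram A th.
Proof. by rewrite /weighted_gram !trmx_mul trmxK tr_diag_mx mulmxA. Qed.

Lemma weighted_gramB p q (A : 'M[R]_(p, q)) (th th' : 'rV[R]_q) :
  weighted_gram A (th - th') = weighted_gram A th - weighted_gram A th'.
Proof. by rewrite /weighted_gram linearB /= mulmxBr mulmxBl. Qed.

Lemma frob_weighted_gram p q (A : 'M[R]_(p, q)) th (y : 'cV[R]_p) :
  frob y (weighted_gram A th *m y) = \sum_i th 0 i * ((A^T *m y) i 0) ^+ 2.
Proof.
rewrite /weighted_gram -!mulmxA frobC frob_mulmxl frobC frob_colE.
move: (A^T *m y) => v.
by apply: eq_bigr => i _; rewrite mul_diag_mx mxE; ring.
Qed.

Lemma frob_weighted_gram_le p q (A : 'M[R]_(p, q)) (th : 'rV[R]_q) (t b : R) (y : 'cV[R]_p) :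
  0 <= t -> op_bounded A t -> (forall i, `|th 0 i| <= b) -> 0 <= b ->
  `|frob y (weighted_gram A th *m y)| <= b * t * sqnorm y.
Proof.
move=> t0 At thb b0; rewrite frob_weighted_gram.
apply: le_trans (ler_norm_sum _ _ _) _.
apply: (@le_trans _ _ (b * sqnorm (A^T *m y))).
  rewrite sqnorm_colE mulr_sumr; apply: ler_sum => i _.
  by rewrite normrM [X in _ * X]ger0_norm ?sqr_ge0// ler_wpM2r ?sqr_ge0.
by rewrite -mulrA ler_wpM2l//; exact: op_bounded_tr.
Qed.

Lemma sqnorm_weighted_gram_le p q (A : 'M[R]_(p, q)) (th : 'rV[R]_q) (t : R) :
  0 <= t -> op_bounded A t ->
  sqnorm (weighted_gram A th) <= t ^+ 2 * \sum_i th 0 i ^+ 2.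
Proof.
move=> t0 At; rewrite /weighted_gram.
have At' := op_bounded_tr t0 At.
apply: le_trans (op_bounded_mulmxr _ t0 At') _.
rewrite expr2 -mulrA ler_wpM2l//.
apply: le_trans (op_bounded_mulmx _ At) _.
rewrite ler_wpM2l// sqnormE.
under eq_bigr => i _.
  rewrite (bigD1 i)//= big1 ?addr0; last first.
    by move=> j ji; rewrite mxE eq_sym (negbTE ji) mulr0n expr0n.
  rewrite mxE eqxx mulr1n; over.
by [].
Qed.

End weighted_gram_matrices.

Section matrix_chaos.
Context {R : realType} {d : measure_display} {Omega : measurableType d}.
Variable P : probability Omega R.

(** [gaussian_chaos] for the form y^T D y of a Gaussian vector y = B g, in terms
    of the covariance (B s) (B s)^T of y; [kap] bounds the norm of the
    covariance. *)
Lemma gaussian_chaos_mx p N (g : 'I_N -> Omega -> R) (s : 'rV[R]_N)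
    (B : 'M[R]_(p, N)) (D : 'M[R]_p) (kap dd l : R) :
  independent_family P g -> (forall i, normal_law P (s 0 i) (g i)) ->
  D^T = D -> 0 <= l -> 0 <= kap -> 0 <= dd ->
  op_bounded (B *m diag_mx s)^T kap ->
  (forall y : 'cV_p, `|frob y (D *m y)| <= dd * sqnorm y) ->
  l * dd * kap <= 16^-1 ->
  (\int[P]_o (expR (l * frob (B *m \col_i g i o) (D *m (B *m \col_i g i o))))%:E <=
   (expR (l * frob ((B *m diag_mx s) *m (B *m diag_mx s)^T) D +
          3 * (l ^+ 2 * kap ^+ 2 * sqnorm D)))%:E)%E.
Proof.
move=> gind gN symD l0 kap0 dd0 opB Ddd small.
set S := B *m diag_mx s.
pose M := l *: (B^T *m D *m B).
pose Mt := l *: (S^T *m D *m S).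
have symM : M^T = M by rewrite /M linearZ /= !trmx_mul trmxK symD mulmxA.
have MtE i j : M i j * s 0 i * s 0 j = Mt i j.
  have -> : Mt = diag_mx s *m M *m diag_mx s.
    rewrite /Mt /M /S trmx_mul tr_diag_mx -scalemxAr -scalemxAl; congr (_ *: _).
    by rewrite !mulmxA.
  by rewrite mul_mx_diag mxE mul_diag_mx mxE; ring.
have opS : op_bounded S kap by rewrite -[S]trmxK; exact: op_bounded_tr.
under eq_integral => o _.
  have -> : l * frob (B *m \col_i g i o) (D *m (B *m \col_i g i o)) =
      qform (fun i j => M i j) (fun i => g i o).
    have <- : (fun i => (\col_i g i o) i 0) = (fun i => g i o).
      by apply/funext => i; rewrite mxE.
    by rewrite qform_frob /M -scalemxAl frobZr frob_congruence.
  over.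
apply: (le_trans (gaussian_chaos (M := fun i j => M i j) gind gN _ _)).
- by move=> i j; rewrite -{1}symM mxE.
- move=> x.
  have -> : (fun i j => M i j * s 0 i * s 0 j) = (fun i j => Mt i j).
    by apply/funext => i; apply/funext => j; exact: MtE.
  have -> : x = (fun i => (\col_i x i) i 0) by apply/funext => i; rewrite mxE.
  rewrite qform_frob -sqnorm_colE /Mt -scalemxAl frobZr frob_congruence.
  rewrite normrM ger0_norm//.
  apply: (@le_trans _ _ (l * (dd * (kap * sqnorm (\col_i x i))))).
    rewrite ler_wpM2l//; apply: le_trans (Ddd _) _.
    by rewrite ler_wpM2l//; exact: opS.
  by rewrite !mulrA ler_wpM2r ?sqnorm_ge0.
- rewrite lee_fin ler_expR; under eq_bigr do rewrite MtE.
  under [X in _ + 3 * X <= _]eq_bigr do under eq_bigr do rewrite MtE.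
  rewrite -sqnormE; apply: lerD.
    have -> : \sum_i Mt i i = \tr Mt by [].
    rewrite /Mt mxtraceZ ler_wpM2l// -mulmxA mxtrace_mulC.
    by rewrite /frob (trmx_mul S) trmxK [leRHS]mxtrace_mulC mulmxA.
  rewrite ler_wpM2l// /Mt sqnormZ -[leRHS]mulrA ler_wpM2l ?sqr_ge0//.
  apply: le_trans (op_bounded_mulmxr _ kap0 opS) _.
  rewrite expr2 -mulrA ler_wpM2l//.
  exact: op_bounded_mulmx.
Qed.

End matrix_chaos.

(** * The score of a candidate signal *)

Section score.
Context {R : realType} {d : measure_display} {Omega : measurableType d}.
Variable P : probability Omega R.

Definition sqrow {n} (x : 'cV[R]_n) : 'rV[R]_n := \row_i x i 0 ^+ 2.

(** |V - (y y^T - sig^2 I)|^2 for V the weighted Gram matrix of [th], minus the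
    part that does not depend on [th]. *)
Definition score {m n} (sig : R) (A : 'M[R]_(m, n)) (y : 'cV[R]_m)
    (th : 'rV[R]_n) : R :=
  sqnorm (weighted_gram A th) + 2 * sig ^+ 2 * \tr (weighted_gram A th) -
  2 * frob y (weighted_gram A th *m y).

Lemma diag_mx_sqrow n (x : 'cV[R]_n) :
  diag_mx x^T *m diag_mx x^T = diag_mx (sqrow x).
Proof.
by rewrite mulmx_diag; congr diag_mx; apply/rowP => i; rewrite !mxE expr2.
Qed.

(** Write V1, V2 and Vx for the three Gram matrices and D = V1 - V2.  The form
    y^T D y has mean tr ((Vx + sig^2 I) D); the trace term of the score removes
    the noise part, and the mean of the score difference becomes
    |V1 - Vx|^2 - |V2 - Vx|^2.  The fluctuation costs 12 l^2 kap^2 |D|^2 in the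
    exponent, kap bounding the norm of the covariance of y, which for small [l] is
    a quarter of l |D|^2.  The parallelogram inequality for D = (V1 - Vx) -
    (V2 - Vx) then leaves a negative multiple of |D|^2. *)
Lemma score_diff_exp m n (A : 'M[R]_(m, n)) (x : 'cV[R]_n)
    (th1 th2 : 'rV[R]_n) (sig t b l : R) (g : 'I_(n + m) -> Omega -> R) :
  independent_family P g ->
  (forall i, normal_law P 1 (g (lshift m i))) ->
  (forall i, normal_law P sig (g (rshift n i))) ->
  0 <= t -> op_bounded A t -> 0 <= b -> (forall i, `|x i 0| <= b) ->
  (forall i, `|th1 0 i - th2 0 i| <= b ^+ 2) ->
  0 <= l -> 48 * l * (b ^+ 2 * t + sig ^+ 2) ^+ 2 <= 1 ->
  (\int[P]_o (expR (- l *
      (let y := A *m diag_mx x^T *m (\col_i g (lshift m i) o) +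
                \col_i g (rshift n i) o in
       score sig A y th1 - score sig A y th2)))%:E <=
   (expR (- (l / 4) * sqnorm (weighted_gram A (th1 - th2)) +
          2 * l * sqnorm (weighted_gram A (th2 - sqrow x))))%:E)%E.
Proof.
move=> gind gw gz t0 At b0 xb thb l0 small.
set kap := b ^+ 2 * t + sig ^+ 2 in small.
have b20 : 0 <= b ^+ 2 by exact: sqr_ge0.
have kap0 : 0 <= kap by rewrite addr_ge0 ?sqr_ge0// mulr_ge0.
pose Vx := weighted_gram A (sqrow x).
pose D := weighted_gram A (th1 - th2).
pose s : 'rV[R]_(n + m) := row_mx (const_mx 1) (const_mx sig).
pose B : 'M[R]_(m, n + m) := row_mx (A *m diag_mx x^T) 1%:M.
have BsE : B *m diag_mx s = row_mx (A *m diag_mx x^T) sig%:M.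
  rewrite /B /s diag_mx_row !diag_const_mx mul_row_block !mulmx0 addr0 add0r.
  by rewrite mulmx1 mul1mx.
have SST : (B *m diag_mx s) *m (B *m diag_mx s)^T = Vx + (sig ^+ 2)%:M.
  rewrite BsE tr_row_mx mul_row_col tr_scalar_mx -scalar_mxM -expr2.
  congr (_ + _); rewrite trmx_mul tr_diag_mx mulmxA -(mulmxA A) diag_mx_sqrow.
  by [].
have frob_sig p (K : 'M[R]_p) : frob ((sig ^+ 2)%:M : 'M[R]_p) K = sig ^+ 2 * \tr K.
  by rewrite /frob tr_scalar_mx mul_scalar_mx mxtraceZ.
have opS : op_bounded (B *m diag_mx s)^T kap.
  move=> y; rewrite {1}/sqnorm frob_mulmxl mulmxA trmxK SST mulmxDl frobDr.
  rewrite mul_scalar_mx frobZr -/(sqnorm y) /kap mulrDl lerD2r.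
  apply: le_trans (ler_norm _) _.
  apply: frob_weighted_gram_le => // i.
  by rewrite mxE normrX lerXn2r ?nnegrE.
have Dt (y : 'cV_m) : `|frob y (D *m y)| <= (b ^+ 2 * t) * sqnorm y.
  by apply: frob_weighted_gram_le => // i; rewrite !mxE.
have bt0 : 0 <= b ^+ 2 * t by exact: mulr_ge0.
have btk : b ^+ 2 * t <= kap by rewrite lerDl sqr_ge0.
have sN i : normal_law P (s 0 i) (g i).
  by rewrite /s; case: (split_ordP i) => j ->; rewrite ?row_mxEl ?row_mxEr mxE.
have small2 : 2 * l * (b ^+ 2 * t) * kap <= 16^-1.
  have : l * (b ^+ 2 * t * kap) <= l * (kap * kap).
    by rewrite ler_wpM2l// ler_wpM2r.
  by move: small; rewrite expr2; lra.
have l20 : 0 <= 2 * l by rewrite mulr_ge0.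
have := gaussian_chaos_mx gind sN (weighted_gram_sym A (th1 - th2))
  l20 kap0 bt0 opS Dt small2.
rewrite SST frobDl frob_sig -/D.
set V1 := weighted_gram A th1; set V2 := weighted_gram A th2.
have DE : D = V1 - V2 by exact: weighted_gramB.
set c0 := - l * (sqnorm V1 - sqnorm V2) - 2 * l * sig ^+ 2 * \tr D.
move=> H.
under eq_integral => o _.
  have -> : - l * (let y := A *m diag_mx x^T *m (\col_i g (lshift m i) o) +
                \col_i g (rshift n i) o in
       score sig A y th1 - score sig A y th2) =
     c0 + 2 * l * frob (B *m \col_i g i o) (D *m (B *m \col_i g i o)).
    have -> : B *m \col_i g i o = A *m diag_mx x^T *m (\col_i g (lshift m i) o) +
                \col_i g (rshift n i) o.
      have -> : \col_i g i o = col_mx (\col_i g (lshift m i) o) (\col_i g (rshift n i) o).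
        apply/colP => i; case: (split_ordP i) => j ->;
        by rewrite ?col_mxEu ?col_mxEd !mxE.
      by rewrite /B mul_row_col mul1mx.
    move: (_ + _) => y /=; rewrite /score /c0 DE mulmxBl frobDr frobNr.
    by rewrite linearB /= -/V1 -/V2; ring.
  rewrite expRD EFinM; over.
rewrite ge0_integralZl//; last first.
  apply/measurable_EFinP; apply: measurableT_comp => //.
  apply: measurable_funM => //.
  have -> : (fun o => frob (B *m \col_i g i o) (D *m (B *m \col_i g i o))) =
    (fun o => qform (fun i j => (B^T *m D *m B) i j) (fun i => g i o)).
    apply/funext => o.
    have <- : (fun i => (\col_i g i o) i 0) = (fun i => g i o).
      by apply/funext => i; rewrite mxE.
    by rewrite qform_frob frob_congruence.
  by apply: env_measurable_qform; case: gind.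
apply: (le_trans (lee_wpmul2l _ H)); first by rewrite lee_fin expR_ge0.
rewrite -EFinM -expRD lee_fin ler_expR.
rewrite weighted_gramB -/V2 -/Vx.
set K := V1 - Vx; set H' := V2 - Vx.
have E1 : sqnorm V1 - sqnorm V2 - 2 * frob Vx D = sqnorm K - sqnorm H'.
  by rewrite DE frobDr frobNr !sqnormB (frobC V1) (frobC V2); ring.
have E2 : sqnorm D <= 2 * sqnorm K + 2 * sqnorm H'.
  have -> : D = K - H' by rewrite DE /K /H' opprB addrA subrK.
  by have := sqnorm_ge0 (K + H'); rewrite sqnormB sqnormD; lra.
rewrite /c0.
have -> : - l * (sqnorm V1 - sqnorm V2) - 2 * l * sig ^+ 2 * \tr D +
    (2 * l * (frob Vx D + sig ^+ 2 * \tr D) +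
      3 * ((2 * l) ^+ 2 * kap ^+ 2 * sqnorm D)) =
    - l * (sqnorm V1 - sqnorm V2 - 2 * frob Vx D) +
    l * sqnorm D * (48 * l * kap ^+ 2) / 4 by field.
rewrite E1.
have H1 : l * sqnorm D * (48 * l * kap ^+ 2) <= l * sqnorm D.
  by rewrite ler_piMr// mulr_ge0// sqnorm_ge0.
have H2 : l * sqnorm D <= l * (2 * sqnorm K + 2 * sqnorm H').
  by rewrite ler_wpM2l.
by move: H1 H2; lra.
Qed.

End score.

(** * Measurability and Gaussian integrals of matrix functions *)

Section measurable_matrix_functions.
Context {R : realType} {d : measure_display} {T : measurableType d}.

Lemma measurable_mx_entry p q (f : T -> 'M[R]_(p, q)) i j :
  measurable_fun setT f -> measurable_fun setT (fun t => f t i j).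
Proof.
by move=> mf; apply: (measurableT_comp (@measurable_mx_coord R p q i j) mf).
Qed.

Lemma measurable_mulmx p q r (f : T -> 'M[R]_(p, q)) (g : T -> 'M[R]_(q, r)) :
  measurable_fun setT f -> measurable_fun setT g ->
  measurable_fun setT (fun t => f t *m g t).
Proof.
move=> mf mg; apply: measurable_mxP => i j; under eq_fun do rewrite mxE.
by apply: measurable_sum => k; apply: measurable_funM; exact: measurable_mx_entry.
Qed.

Lemma measurable_addmx p q (f g : T -> 'M[R]_(p, q)) :
  measurable_fun setT f -> measurable_fun setT g ->
  measurable_fun setT (fun t => f t + g t).
Proof.
move=> mf mg; apply: measurable_mxP => i j; under eq_fun do rewrite mxE.
by apply: measurable_funD; exact: measurable_mx_entry.
Qed.

Lemma measurable_trmx p q (f : T -> 'M[R]_(p, q)) :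
  measurable_fun setT f -> measurable_fun setT (fun t => (f t)^T).
Proof.
move=> mf; apply: measurable_mxP => i j; under eq_fun do rewrite mxE.
exact: measurable_mx_entry.
Qed.

Lemma measurable_frob p q (f g : T -> 'M[R]_(p, q)) :
  measurable_fun setT f -> measurable_fun setT g ->
  measurable_fun setT (fun t => frob (f t) (g t)).
Proof.
move=> mf mg; under eq_fun do rewrite frobE.
apply: measurable_sum => i; apply: measurable_sum => j.
by apply: measurable_funM; exact: measurable_mx_entry.
Qed.

Lemma measurable_mxtrace p (f : T -> 'M[R]_p) :
  measurable_fun setT f -> measurable_fun setT (fun t => \tr (f t)).
Proof. by move=> mf; apply: measurable_sum => i; exact: measurable_mx_entry. Qed.

Lemma measurable_weighted_gram p q (f : T -> 'M[R]_(p, q)) th :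
  measurable_fun setT f -> measurable_fun setT (fun t => weighted_gram (f t) th).
Proof.
move=> mf; apply: measurable_mulmx; last exact: measurable_trmx.
exact: measurable_mulmx.
Qed.

Lemma measurable_score m n sig (f : T -> 'M[R]_(m, n)) (g : T -> 'cV[R]_m) th :
  measurable_fun setT f -> measurable_fun setT g ->
  measurable_fun setT (fun t => score sig (f t) (g t) th).
Proof.
move=> mf mg; have mV := measurable_weighted_gram th mf.
apply: measurable_funB; first apply: measurable_funD.
- exact: measurable_frob.
- by apply: measurable_funM => //; exact: measurable_mxtrace.
- apply: measurable_funM => //; apply: measurable_frob => //.
  exact: measurable_mulmx.
Qed.

(** A finite, hence measurable, substitute for a bound on the operator norm. *)
Definition spectral_test {p q} (net : seq 'cV[R]_q) (t : R) (A : 'M[R]_(p, q)) :=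
  all (fun v => sqnorm (A *m v) <= t * sqnorm v) net.

Lemma measurable_spectral_test p q (net : seq 'cV[R]_q) t (f : T -> 'M[R]_(p, q)) :
  measurable_fun setT f ->
  measurable_fun setT (fun x => spectral_test net t (f x)).
Proof.
move=> mf; rewrite /spectral_test; elim: net => [|v net IH] //=.
apply: measurable_and => //; apply: measurable_fun_ler => //.
by apply: measurable_frob; exact: measurable_mulmx.
Qed.

Lemma measurable_spectral_test_indicator p q (net : seq 'cV[R]_q) t
    (f : T -> 'M[R]_(p, q)) :
  measurable_fun setT f ->
  measurable_fun setT (fun x => (spectral_test net t (f x))%:R : R).
Proof.
move=> mf.
rewrite (_ : (fun x => _) = fun x => if spectral_test net t (f x) then 1 else 0).
  by apply: measurable_fun_ifT => //; exact: measurable_spectral_test.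
by apply/funext => x; case: ifP.
Qed.

End measurable_matrix_functions.

Section block_bounds.
Context {R : realType} {d : measure_display} {Omega : measurableType d}.
Variable P : probability Omega R.

Lemma independent_prod_le (S1 S2 : finType) (g : S1 * S2 -> Omega -> R)
    (F : S1 -> (S2 -> R) -> R) (C : S1 -> R) :
  independent_family P g -> (forall i, env_measurable (F i)) ->
  (forall i x, 0 <= F i x) ->
  (forall i, (\int[P]_o (F i (fun j => g (i, j) o))%:E <= (C i)%:E)%E) ->
  (\int[P]_o (\prod_i F i (fun j => g (i, j) o))%:E <= (\prod_i C i)%:E)%E.
Proof.
move=> gind mF F0 FC.
rewrite (independent_prod_integral gind mF F0 (index_enum_uniq S1)).
elim: (index_enum S1) => [|i s IH]; first by rewrite !big_nil.
rewrite !big_cons EFinM; apply: lee_pmul => //.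
  by apply: integral_ge0 => o _; rewrite lee_fin.
elim: {IH} s => [|i' s IH]; rewrite ?big_nil// big_cons mule_ge0//.
by apply: integral_ge0 => o _; rewrite lee_fin.
Qed.

(** [gaussian_chaos] for the form c |W g|^2; the quadratic part of the
    bound is absorbed in the linear one by the smallness condition. *)
Lemma gaussian_sqnorm_exp N p (g : 'I_N -> Omega -> R) (W : 'M[R]_(p, N))
    (kap c : R) :
  independent_family P g -> (forall i, normal_law P 1 (g i)) ->
  0 <= kap -> op_bounded W kap -> `|c| * kap <= 16^-1 ->
  (\int[P]_o (expR (c * sqnorm (W *m \col_i g i o)))%:E <=
   (expR ((c + 3 / 16 * `|c|) * sqnorm W))%:E)%E.
Proof.
move=> gind gN kap0 opW small.
pose M := c *: (W^T *m W).
have symM : M^T = M by rewrite /M linearZ /= trmx_mul trmxK.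
have frobM x : frob x (M *m x) = c * sqnorm (W *m x).
  by rewrite /M -scalemxAl frobZr -mulmxA -[W in _ *m (W *m x)]trmxK
     -frob_mulmxl trmxK.
under eq_integral => o _.
  have -> : c * sqnorm (W *m \col_i g i o) =
      qform (fun i j => M i j) (fun i => g i o).
    have <- : (fun i => (\col_i g i o) i 0) = (fun i => g i o).
      by apply/funext => i; rewrite mxE.
    by rewrite qform_frob frobM.
  over.
apply: (le_trans (gaussian_chaos (s := fun=> 1) (M := fun i j => M i j) gind gN _ _)).
- by move=> i j; rewrite -{1}symM mxE.
- move=> x.
  have -> : (fun i j => M i j * 1 * 1) = (fun i j => M i j).
    by apply/funext => i; apply/funext => j; rewrite !mulr1.
  have -> : x = (fun i => (\col_i x i) i 0) by apply/funext => i; rewrite mxE.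
  rewrite qform_frob -sqnorm_colE frobM normrM (ger0_norm (sqnorm_ge0 _)).
  apply: (@le_trans _ _ (`|c| * (kap * sqnorm (\col_i x i)))).
    by rewrite ler_wpM2l.
  by rewrite mulrA ler_wpM2r ?sqnorm_ge0.
- rewrite lee_fin ler_expR; under eq_bigr do rewrite !mulr1.
  under [X in _ + 3 * X <= _]eq_bigr do under eq_bigr do rewrite !mulr1.
  rewrite -sqnormE -/(\tr M) /M mxtraceZ sqnormZ -/(frob W W) -/(sqnorm W).
  have H : sqnorm (W^T *m W) <= kap * sqnorm W.
    by rewrite -[X in _ <= _ * X]sqnorm_tr; exact: op_bounded_mulmxr.
  have H2 : c ^+ 2 * sqnorm (W^T *m W) <= c ^+ 2 * (kap * sqnorm W).
    by rewrite ler_wpM2l ?sqr_ge0.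
  have H3 : `|c| * kap * (`|c| * sqnorm W) <= 16^-1 * (`|c| * sqnorm W).
    by rewrite ler_wpM2r// mulr_ge0// sqnorm_ge0.
  have cE : c ^+ 2 = `|c| * `|c| by rewrite -expr2 real_normK// num_real.
  by move: H2 H3; rewrite cE; lra.
Qed.

End block_bounds.

Section conditioning.
Context {R : realType} {d : measure_display} {Omega : measurableType d}.
Variable P : probability Omega R.

(** A bound on the conditional expectation given the coordinates in [J] can be
    integrated. *)
Lemma independent_conditional_le (S : finType) (g : S -> Omega -> R)
    (J : pred S) (F : (S -> R) -> R) (K : Omega -> \bar R) :
  independent_family P g -> env_measurable F -> (forall x, 0 <= F x) ->
  measurable_fun setT K ->
  (forall o, (\int[P]_o' (F (fun s => if J s then g s o else g s o'))%:E <= K o)%E) ->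
  (\int[P]_o (F (fun s => g s o))%:E <= \int[P]_o K o)%E.
Proof.
move=> gind mF F0 mK FK; have [mg _] := gind.
rewrite (independent_resample J gind mF F0).
apply: ge0_le_integral => //.
- by move=> o _; apply: integral_ge0 => o' _; rewrite lee_fin.
- pose f (o : Omega * Omega) := (F (fun s => if J s then g s o.1 else g s o.2))%:E.
  apply: (@measurable_fun_fubini_tonelli_F _ _ _ _ _ P f); last first.
    by move=> o; rewrite lee_fin.
  apply/measurable_EFinP; apply: mF => s; case: (J s).
    by apply: (measurableT_comp (mg s)); exact: measurable_fst.
  by apply: (measurableT_comp (mg s)); exact: measurable_snd.
Qed.

End conditioning.

(** * Averaging over the sensing matrix: several rows *)

Section signal.
Context {R : realType} {d : measure_display} {Omega : measurableType d}.
Variable P : probability Omega R.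

(** The other rows are set to 0 instead of being removed, so the number of rows
    does not change and the spectral test remains valid
    ([spectral_test_rows_in]). *)
Definition rows_in {m n} (I : pred 'I_m) (A : 'M[R]_(m, n)) : 'M[R]_(m, n) :=
  \matrix_(i, p) if I i then A i p else 0.

Lemma sqnorm_rowsE m n (A : 'M[R]_(m, n)) (v : 'cV[R]_n) :
  sqnorm (A *m v) = \sum_i (\sum_p A i p * v p 0) ^+ 2.
Proof. by rewrite sqnorm_colE; apply: eq_bigr => i _; rewrite mxE. Qed.

Lemma spectral_test_rows_in m n (I : pred 'I_m) net t (A : 'M[R]_(m, n)) :
  spectral_test net t A -> spectral_test net t (rows_in I A).
Proof.
apply: sub_all => v; apply: le_trans.
rewrite !sqnorm_rowsE; apply: ler_sum => i _.
under eq_bigr do rewrite mxE.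
by case: (I i) => //; rewrite big1 ?expr0n ?sqr_ge0// => p _; rewrite mul0r.
Qed.

(** Decoupling: the entries of the Gram matrix with row in [I] and column outside
    [I] are bilinear in two independent groups of rows of [A]. *)
Lemma sqnorm_weighted_gram_split m n (I : pred 'I_m) (A : 'M[R]_(m, n))
    (de : 'rV[R]_n) :
  \sum_(j | ~~ I j) sqnorm (rows_in I A *m diag_mx de *m \col_p A j p) <=
  sqnorm (weighted_gram A de).
Proof.
have VE i j : weighted_gram A de i j = \sum_p A i p * de 0 p * A j p.
  by rewrite /weighted_gram mul_mx_diag mxE; apply: eq_bigr => p _; rewrite !mxE.
rewrite [leRHS]sqnormE [leRHS]exchange_big /= [leRHS](bigID (fun j => I j))/= addrC.
rewrite -[leLHS]addr0; apply: lerD; last first.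
  by apply: sumr_ge0 => j _; apply: sumr_ge0 => i _; exact: sqr_ge0.
apply: ler_sum => j _; rewrite sqnorm_rowsE; apply: ler_sum => i _.
rewrite mul_mx_diag VE.
under eq_bigr do rewrite !mxE.
by case: (I i) => //; rewrite big1 ?expr0n ?sqr_ge0// => p _; rewrite !mul0r.
Qed.

(** Half of the rows form a matrix W.  Given W, each of the m - m/2 other rows a
    contributes exp(- c |W diag(de) a|^2), whose mean is at most
    exp(- (c / 2) |W diag(de)|^2); the spectral test for W makes the form small
    enough for [gaussian_sqnorm_exp].  The same lemma is then applied to the m/2
    rows of W, and m/2 (m - m/2) >= m^2 / 6 when m > 1. *)
Lemma signal_exp_rows m n (a : 'I_m * 'I_n -> Omega -> R) net (t T : R)
    (de : 'rV[R]_n) (dd c : R) :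
  independent_family P a -> (forall u, normal_law P 1 (a u)) ->
  (forall A : 'M[R]_(m, n), spectral_test net t A -> op_bounded A T) ->
  0 <= T -> (forall p, `|de 0 p| <= dd) -> 0 <= c ->
  16 * (c * (dd ^+ 2 * T)) <= 1 -> 16 * (c * (m%:R * dd ^+ 2)) <= 1 ->
  (1 < m)%N ->
  (\int[P]_o ((spectral_test net t (\matrix_(i, p) a (i, p) o))%:R *
     expR (- c * sqnorm (weighted_gram (\matrix_(i, p) a (i, p) o) de)))%:E <=
   (expR (- (c / 24 * m%:R ^+ 2 * \sum_p de 0 p ^+ 2)))%:E)%E.
Proof.
move=> aind aN netP T0 ded c0 small1 small2 m2.
have [ma _] := aind.
pose up : pred 'I_m := fun i => (i < m./2)%N.
pose mat (x : 'I_m * 'I_n -> R) : 'M[R]_(m, n) := \matrix_(i, p) x (i, p).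
pose G x j := if up j then 1
  else expR (- c * sqnorm (rows_in up (mat x) *m diag_mx de *m \col_p x (j, p))).
pose F x : R := (spectral_test net t (rows_in up (mat x)))%:R * \prod_j G x j.
have mmat d' (T' : measurableType d') (h : 'I_m * 'I_n -> T' -> R) :
    (forall s, measurable_fun setT (h s)) ->
    measurable_fun setT (fun t => mat (fun s => h s t)).
  by move=> mh; apply: measurable_mxP => i j; under eq_fun do rewrite mxE; exact: mh.
have mrows d' (T' : measurableType d') (h : 'I_m * 'I_n -> T' -> R) :
    (forall s, measurable_fun setT (h s)) ->
    measurable_fun setT (fun t => rows_in up (mat (fun s => h s t))).
  move=> mh; apply: measurable_mxP => i j.
  rewrite (_ : (fun _ => _) = fun t0 => if up i then h (i, j) t0 else 0).
    by case: (up i) => //; exact: mh.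
  by apply/funext => t0; rewrite !mxE.
have mcol d' (T' : measurableType d') (h : 'I_n -> T' -> R) :
    (forall s, measurable_fun setT (h s)) ->
    measurable_fun setT (fun t => \col_p h p t).
  by move=> mh; apply: measurable_mxP => i j; under eq_fun do rewrite mxE; exact: mh.
have mF : env_measurable F.
  move=> d' T' h mh; apply: measurable_funM.
    by apply: measurable_spectral_test_indicator; exact: mrows.
  apply: measurable_prod => j _; rewrite /G; case: (up j) => //.
  apply: measurableT_comp => //; apply: measurable_funM => //.
  have mw : measurable_fun setT (fun t => rows_in up (mat (fun s => h s t)) *m
      diag_mx de *m \col_p h (j, p) t).
    apply: measurable_mulmx; last exact: mcol.
    by apply: measurable_mulmx => //; exact: mrows.
  exact: measurable_frob.
have F0 x : 0 <= F x.
  by rewrite mulr_ge0// prodr_ge0// => j _; rewrite /G; case: ifP; rewrite ?expR_ge0.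
pose h := m./2.
have dsq p : de 0 p ^+ 2 <= dd ^+ 2.
  rewrite -(real_normK (num_real (de 0 p))) lerXn2r ?nnegrE//.
  exact: le_trans (normr_ge0 _) (ded p).
have diagle k (x : 'M[R]_(n, k)) : sqnorm (diag_mx de *m x) <= dd ^+ 2 * sqnorm x.
  rewrite !sqnormE mulr_sumr; apply: ler_sum => p _; rewrite mulr_sumr.
  apply: ler_sum => j _; rewrite mul_diag_mx !mxE exprMn.
  by rewrite ler_wpM2r ?sqr_ge0.
apply: (@le_trans _ _ (\int[P]_o (F (fun u => a u o))%:E)%E).
  apply: ge0_le_integral => //.
  - apply/measurable_EFinP; apply: measurable_funM.
      by apply: measurable_spectral_test_indicator; exact: (mmat _ _ a).
    apply: measurableT_comp => //; apply: measurable_funM => //.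
    by apply: measurable_frob; apply: measurable_weighted_gram; exact: (mmat _ _ a).
  - by apply/measurable_EFinP; exact: mF.
  - move=> o _; rewrite lee_fin /F -/(mat (fun u => a u o)).
    set A := mat _; have AE : A = \matrix_(i, p) a (i, p) o by [].
    case: (boolP (spectral_test net t A)) => [tA|_]; last first.
      by rewrite mul0r mulr_ge0// prodr_ge0// => j _; rewrite /G; case: ifP; rewrite ?expR_ge0.
    rewrite (spectral_test_rows_in up tA) !mul1r.
    have -> : \prod_j G (fun u => a u o) j = expR (- c *
        \sum_(j | ~~ up j) sqnorm (rows_in up A *m diag_mx de *m \col_p A j p)).
      rewrite mulr_sumr expR_sum [RHS]big_mkcond /=; apply: eq_bigr => j _.
      rewrite /G; case: (up j) => //=; congr (expR (_ * sqnorm (_ *m _))).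
      by apply/colP => p; rewrite !mxE.
    rewrite ler_expR !mulNr lerN2 ler_wpM2l//.
    exact: sqnorm_weighted_gram_split.
pose q : R := c * (m%:R - h%:R) / 2.
pose F2 (x : 'I_m * 'I_n -> R) : R := expR (- q *
   sqnorm (rows_in up (mat x) *m diag_mx de)).
have mF2 : env_measurable F2.
  move=> d' T' h' mh'; apply: measurableT_comp => //; apply: measurable_funM => //.
  have mw : measurable_fun setT
      (fun t => rows_in up (mat (fun s => h' s t)) *m diag_mx de).
    by apply: measurable_mulmx => //; exact: mrows.
  exact: measurable_frob.
have hm : (h <= m)%N by rewrite /h; lia.
have sumI (r : R) : \sum_(i < m) (if up i then r else 0) = h%:R * r.
  rewrite -big_mkcond /= /up -(big_ord_widen m (fun=> r) hm).
  by rewrite sumr_const card_ord mulr_natl.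
have sumJ (r : R) : \sum_(i < m) (if up i then 0 else r) = (m%:R - h%:R) * r.
  rewrite mulrBl -sumI.
  have -> : m%:R * r = \sum_(i < m) r by rewrite sumr_const card_ord mulr_natl.
  rewrite -sumrB; apply: eq_bigr => i _.
  by case: (up i); rewrite ?subrr ?subr0.
apply: (@le_trans _ _ (\int[P]_o (F2 (fun u => a u o))%:E)%E).
  apply: (independent_conditional_le (J := fun u => up u.1) aind mF F0).
    by apply/measurable_EFinP; exact: mF2.
  move=> o.
  set W := rows_in up (mat (fun u => a u o)).
  have WE o' : rows_in up (mat (fun u => if up u.1 then a u o else a u o')) = W.
    by apply/matrixP => i p; rewrite !mxE /=; case: (up i).
  case: (boolP (spectral_test net t W)) => tW; last first.
    under eq_integral => o' _ do rewrite /F WE (negbTE tW) mul0r.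
    by rewrite integral0 lee_fin expR_ge0.
  have opW : op_bounded (W *m diag_mx de) (dd ^+ 2 * T).
    move=> x; rewrite -mulmxA; apply: le_trans (netP _ tW _) _.
    by rewrite (mulrC _ T) -mulrA ler_wpM2l.
  pose G0 j (x : 'I_n -> R) : R := if up j then 1
    else expR (- c * sqnorm (W *m diag_mx de *m \col_p x p)).
  rewrite (eq_integral (fun o' => (\prod_j G0 j (fun p => a (j, p) o'))%:E));
    last first.
    move=> o' _; rewrite /F WE tW mul1r; congr (_%:E); apply: eq_bigr => j _.
    by rewrite /G /G0 WE /=; case: (up j).
  apply: (le_trans (independent_prod_le (C := fun j => if up j then 1
    else expR (- (c / 2) * sqnorm (W *m diag_mx de))) aind _ _ _)).
  - move=> j d' T' h' mh'; rewrite /G0; case: (up j) => //.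
    apply: measurableT_comp => //; apply: measurable_funM => //.
    have mw : measurable_fun setT (fun t => W *m diag_mx de *m \col_p h' p t).
      by apply: measurable_mulmx => //; exact: mcol.
    exact: measurable_frob.
  - by move=> j x; rewrite /G0; case: ifP; rewrite ?expR_ge0.
  - move=> j; rewrite /G0; case: (up j); first by rewrite integral_probability_cst.
    have aj : independent_family P (fun p => a (j, p)).
      by apply: (independent_family_comp (f := fun p => (j, p))) aind => p p' [].
    have dT0 : 0 <= dd ^+ 2 * T by rewrite mulr_ge0 ?sqr_ge0.
    have aNj p : normal_law P 1 (a (j, p)) by [].
    have cs : `|- c| * (dd ^+ 2 * T) <= 16^-1.
      by rewrite normrN ger0_norm//; move: small1; lra.
    apply: (le_trans (gaussian_sqnorm_exp aj aNj dT0 opW cs)).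
    rewrite lee_fin ler_expR normrN ger0_norm// ler_wpM2r ?sqnorm_ge0//.
    by move: c0; lra.
  - rewrite lee_fin /F2 -/W.
    have -> : \prod_(j < m) (if up j then 1
        else expR (- (c / 2) * sqnorm (W *m diag_mx de))) =
      expR (\sum_(j < m) if up j then 0 else - (c / 2) * sqnorm (W *m diag_mx de)).
      by rewrite expR_sum; apply: eq_bigr => j _; case: (up j); rewrite ?expR0.
    by rewrite sumJ ler_expR /q; lra.
have hR : h%:R <= m%:R :> R by rewrite ler_nat.
have q0 : 0 <= q by rewrite /q divr_ge0// mulr_ge0// subr_ge0.
pose G2 i (x : 'I_n -> R) : R := if up i
  then expR (- q * sqnorm (diag_mx de *m \col_p x p)) else 1.
have sqdiag : sqnorm (diag_mx de) = \sum_p de 0 p ^+ 2.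
  rewrite sqnormE; apply: eq_bigr => p _.
  rewrite (bigD1 p)//= big1 ?addr0; last first.
    by move=> j jp; rewrite mxE eq_sym (negbTE jp) mulr0n expr0n.
  by rewrite mxE eqxx mulr1n.
rewrite (eq_integral (fun o => (\prod_i G2 i (fun p => a (i, p) o))%:E));
  last first.
  move=> o _; congr (_%:E).
  have -> : \prod_i G2 i (fun p => a (i, p) o) = expR (\sum_i if up i then
      - q * sqnorm (diag_mx de *m \col_p a (i, p) o) else 0).
    by rewrite expR_sum; apply: eq_bigr => i _; rewrite /G2; case: (up i);
      rewrite ?expR0.
  rewrite /F2; congr expR; rewrite sqnormE mulr_sumr; apply: eq_bigr => i _.
  case Ii : (up i); last first.
    by rewrite big1 ?mulr0// => p _; rewrite mul_mx_diag !mxE Ii mul0r expr0n.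
  rewrite sqnorm_colE; congr (_ * _); apply: eq_bigr => p _.
  by rewrite mul_mx_diag mul_diag_mx !mxE Ii mulrC.
apply: (le_trans (independent_prod_le (C := fun i => if up i then
    expR (- (q / 2) * sqnorm (diag_mx de)) else 1) aind _ _ _)).
- move=> j d' T' h' mh'; rewrite /G2; case: (up j) => //.
  apply: measurableT_comp => //; apply: measurable_funM => //.
  have mw : measurable_fun setT (fun t => diag_mx de *m \col_p h' p t).
    by apply: measurable_mulmx => //; exact: mcol.
  exact: measurable_frob.
- by move=> j x; rewrite /G2; case: ifP; rewrite ?expR_ge0.
- move=> j; rewrite /G2; case: (up j); last by rewrite integral_probability_cst.
  have aj : independent_family P (fun p => a (j, p)).
    by apply: (independent_family_comp (f := fun p => (j, p))) aind => p p' [].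
  have aNj p : normal_law P 1 (a (j, p)) by [].
  have cs : `|- q| * dd ^+ 2 <= 16^-1.
    rewrite normrN ger0_norm// /q.
    have : 0 <= c * (h%:R * dd ^+ 2) by rewrite mulr_ge0// mulr_ge0// sqr_ge0.
    have : 0 <= c * (m%:R * dd ^+ 2) by rewrite mulr_ge0// mulr_ge0// sqr_ge0.
    by move: small2; lra.
  apply: (le_trans (gaussian_sqnorm_exp aj aNj (sqr_ge0 dd) (diagle 1%N) cs)).
  rewrite lee_fin ler_expR normrN ger0_norm// ler_wpM2r ?sqnorm_ge0//.
  by move: q0; lra.
rewrite lee_fin.
have -> : \prod_(i < m) (if up i then expR (- (q / 2) * sqnorm (diag_mx de)) else 1) =
    expR (\sum_(i < m) if up i then - (q / 2) * sqnorm (diag_mx de) else 0).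
  by rewrite expR_sum; apply: eq_bigr => j _; case: (up j); rewrite ?expR0.
rewrite sumI ler_expR sqdiag /q.
set Q := \sum_p _; have Q0 : 0 <= Q by apply: sumr_ge0 => p _; exact: sqr_ge0.
have H : m%:R ^+ 2 <= 6 * (h%:R * (m%:R - h%:R)) :> R.
  rewrite -natrB// -!natrM -natrX ler_nat /h.
  have := odd_double_half m; case: (odd m) => /=; nia.
have : c * Q * m%:R ^+ 2 <= c * Q * (6 * (h%:R * (m%:R - h%:R))).
  by rewrite ler_wpM2l// mulr_ge0.
by lra.
Qed.
End signal.

(** * Averaging over the sensing matrix: a single row *)

Section normal_square_moments.
Context {R : realType}.
Notation T := (measurableTypeR R).
Notation nu := (normal_prob (0 : R) 1).

Let pow8_le (x : R) : x ^+ 8 <= 16 ^+ 4 * expR (4^-1 * x ^+ 2 + 0 * x).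
Proof.
rewrite mul0r addr0 (_ : 4^-1 * x ^+ 2 = 4 * (x ^+ 2 / 16)); last by field.
have -> : x ^+ 8 = (x ^+ 2) ^+ 4 by rewrite -exprM.
rewrite expRM_natl -exprMn lerXn2r ?nnegrE ?sqr_ge0 ?mulr_ge0 ?expR_ge0//.
by have := expR_ge1Dx (x ^+ 2 / 16); lra.
Qed.

Let mX n : measurable_fun [set: T] (fun x : T => (x : R) ^+ n).
Proof. exact: measurable_funX. Qed.

Let integrable_X8 : nu.-integrable [set: T] (fun x : T => ((x : R) ^+ 8)%:E).
Proof.
apply: (@le_integrable _ _ _ _ _ _ _
  (fun x : T => (16 ^+ 4 * expR (4^-1 * x ^+ 2 + 0 * x))%:E)) => //.
- by apply/measurable_EFinP.
- move=> x _; rewrite !abse_EFin lee_fin !ger0_norm ?pow8_le//.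
  have -> : (x : R) ^+ 8 = (x ^+ 2) ^+ 4 by rewrite -exprM.
  by rewrite exprn_ge0// sqr_ge0.
- apply/integrableP; split.
    apply/measurable_EFinP; apply: measurable_funM => //.
    apply: measurableT_comp => //; apply: measurable_funD; exact: measurable_funM.
  under eq_integral => x _.
    rewrite abse_EFin ger0_norm ?mulr_ge0 ?expR_ge0// EFinM; over.
  rewrite ge0_integralZl//; last first.
    apply/measurable_EFinP; apply: measurableT_comp => //.
    by apply: measurable_funD; exact: measurable_funM.
  rewrite (@normal_exp_quadratic R 1 4^-1 0) ?oner_eq0//; last by rewrite expr1n; lra.
  by rewrite -EFinM ltry.
Qed.

Let integrable_Xk k : (k <= 4)%N ->
  nu.-integrable [set: T] (fun x : T => (((x : R) ^+ 2) ^+ k)%:E).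
Proof.
move=> k4.
apply: (@le_integrable _ _ _ _ _ _ _ (fun x : T => (1 + (x : R) ^+ 8)%:E)) => //.
- by apply/measurable_EFinP/measurable_funX.
- move=> x _; rewrite !abse_EFin lee_fin.
  have E8 : (x : R) ^+ 8 = (x ^+ 2) ^+ 4 by rewrite -exprM.
  rewrite E8; have := sqr_ge0 (x : R); move: (x ^+ 2) => y y0.
  rewrite !ger0_norm ?exprn_ge0 ?addr_ge0 ?exprn_ge0//.
  have [y1|y1] := leP y 1.
    by apply: le_trans (exprn_ile1 k y0 y1) _; rewrite lerDl exprn_ge0.
  apply: (@le_trans _ _ (y ^+ 4)); last by rewrite lerDr.
  by rewrite ler_weXn2l// ltW.
- under eq_fun do rewrite EFinD.
  apply: integrableD => //.
  exact: finite_measure_integrable_cst.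
Qed.

Let mu2 : R := fine (\int[nu]_x ((x : R) ^+ 2)%:E).

Let Z (x : R) := x ^+ 2 - mu2.

Let mZ k : measurable_fun [set: T] (fun x : T => Z x ^+ k).
Proof. by apply: measurable_funX; exact: measurable_funB. Qed.

Let integrable_Zk k : (k <= 4)%N ->
  nu.-integrable [set: T] (fun x : T => (Z x ^+ k)%:E).
Proof.
move=> k4; rewrite /Z.
under eq_fun do rewrite exprBn -sumEFin.
apply: integrable_sum => //= i _.
rewrite (_ : (fun _ => _) = (fun x : T => ('C(k, i)%:R * (-1) ^+ i * mu2 ^+ i)%:E *
    ((x ^+ 2) ^+ (k - i))%:E)%E); last first.
  by apply/funext => x; rewrite -EFinM -mulr_natl; congr (_%:E); ring.
apply: integrableZl => //; apply: integrable_Xk.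
exact: leq_trans (leq_subr _ _) k4.
Qed.

Let mom k : R := fine (\int[nu]_x (Z x ^+ k)%:E).

Let momE k : (k <= 4)%N -> (\int[nu]_x (Z x ^+ k)%:E = (mom k)%:E)%E.
Proof.
by move=> k4; rewrite fineK//; apply: integrable_fin_num => //; exact: integrable_Zk.
Qed.

Let integral_poly (c : nat -> R) :
  (\int[nu]_x (\sum_(k < 5) c k * Z x ^+ k)%:E = (\sum_(k < 5) c k * mom k)%:E)%E.
Proof.
under eq_integral do rewrite -sumEFin.
rewrite integral_sum//=; last first.
  move=> k; under eq_fun do rewrite EFinM.
  by apply: integrableZl => //; apply: integrable_Zk; rewrite -ltnS.
rewrite -sumEFin; apply: eq_bigr => k _; under eq_integral do rewrite EFinM.
have k4 : (k <= 4)%N by rewrite -ltnS.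
by rewrite integralZl//=; [rewrite momE// -EFinM|exact: integrable_Zk].
Qed.

Let mom0 : mom 0 = 1.
Proof.
apply: EFin_inj; rewrite -momE//; under eq_integral do rewrite expr0.
by rewrite integral_probability_cst.
Qed.

Let mom1 : mom 1 = 0.
Proof.
apply: EFin_inj; rewrite -momE//.
have iX : nu.-integrable [set: T] (fun x : T => ((x : R) ^+ 2)%:E).
  exact: (@integrable_Xk 1%N).
have i1 : nu.-integrable [set: T] (fun=> mu2%:E).
  exact: finite_measure_integrable_cst.
under eq_integral do rewrite expr1 /Z EFinB.
rewrite integralB// integral_probability_cst /mu2 fineK ?subee//.
  exact: integrable_fin_num.
exact: integrable_fin_num.
Qed.

(* If the square of a standard normal variable g were almost surely a constant mu2,
   the mean of exp(al g^2) would be exp(al mu2) for all al < 1/2; the explicit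
   formula at al = 1/4 and al = -1/2 contradicts this. *)
Let mom2_gt0 : 0 < mom 2.
Proof.
rewrite lt_neqAle; apply/andP; split; last first.
  rewrite fine_ge0//; apply: integral_ge0 => x _.
  by rewrite lee_fin sqr_ge0.
apply/negP => /eqP v0.
have Zae : ae_eq nu setT (fun x : T => (Z x ^+ 2)%:E) (cst 0%E).
  apply/ae_eq_integral_abs => //; first exact/measurable_EFinP.
  under eq_integral do rewrite abse_EFin ger0_norm ?sqr_ge0//.
  by rewrite momE// -v0.
have E (al : R) : 2 * al < 1 ->
    (Num.sqrt (1 - 2 * al))^-1 = expR (al * mu2).
  move=> al1; apply: EFin_inj.
  have := @normal_exp_quadratic R 1 al 0 (oner_neq0 _).
  rewrite expr1n !mulr1 => /(_ al1).
  rewrite expr0n /= mul0r expR0 mulr1 => <-.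
  transitivity (\int[nu]_x (expR (al * mu2))%:E)%E; last exact: integral_probability_cst.
  apply: ge0_ae_eq_integral => //.
  - apply/measurable_EFinP; apply: measurableT_comp => //.
    by apply: measurable_funD; exact: measurable_funM.
  - apply: filterS Zae => x /= H _; have := H I => -[/eqP].
    by rewrite sqrf_eq0 subr_eq0 => /eqP ->; rewrite mul0r addr0.
have := E 4^-1; have := E (- 2^-1).
rewrite (_ : 1 - 2 * - 2^-1 = 2 :> R); last by field.
rewrite (_ : 1 - 2 * 4^-1 = 2^-1 :> R); last by field.
rewrite sqrtrV// invrK => H1 H2.
have {}H1 := H1 ltac:(lra); have {}H2 := H2 ltac:(lra).
have s2 : (Num.sqrt 2) ^+ 2 = 2 :> R by rewrite sqr_sqrtr.
have s0 : Num.sqrt 2 != 0 :> R by rewrite gt_eqF// sqrtr_gt0.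
have H3 : (Num.sqrt 2)^-1 * (Num.sqrt 2) ^+ 2 = 1 :> R.
  rewrite H1 H2 -expRM_natl -expRD (_ : _ + _ = 0) ?expR0//.
  by field.
move: H3; rewrite expr2 mulKf// => H3.
by move: s2; rewrite H3 expr1n; lra.
Qed.

(** [mu] and [v] are the mean and the variance of the square of a standard normal
    variable.  The last two formulas have a form that can be iterated over the
    coordinates of a weighted sum: [rho] and [e] stand for what the other
    coordinates have contributed to the mean and to the variance. *)
Lemma normal_square_moments : exists mu v K : R, [/\ 0 < v, v <= K, 1 <= K,
  forall rho de e, 0 <= e ->
    (\int[nu]_x ((rho + de * ((x : R) ^+ 2 - mu)) ^+ 2 + e)%:E =
     (rho ^+ 2 + (v * de ^+ 2 + e))%:E)%E &
  forall rho de e, 0 <= e ->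
    (\int[nu]_x (((rho + de * ((x : R) ^+ 2 - mu)) ^+ 2 + K * e) ^+ 2)%:E <=
     ((rho ^+ 2 + K * (e + de ^+ 2)) ^+ 2)%:E)%E].
Proof.
pose K := 3 * mom 2 + 2 * `|mom 3| + mom 4 + 1.
have m4 : 0 <= mom 4.
  rewrite fine_ge0//; apply: integral_ge0 => x _.
  by rewrite lee_fin -[4%N]/(2 * 2)%N exprM sqr_ge0.
have m3 := normr_ge0 (mom 3).
have K1 : 1 <= K by rewrite /K; move: mom2_gt0; lra.
exists mu2, (mom 2), K; split => //; first by (rewrite /K; move: mom2_gt0; lra).
- move=> rho de e e0.
  pose c (k : nat) := nth 0 [:: rho ^+ 2 + e; 2 * rho * de; de ^+ 2; 0; 0] k.
  transitivity (\int[nu]_x (\sum_(k < 5) c k * Z x ^+ k)%:E)%E.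
    apply: eq_integral => x _; congr (_%:E).
    by rewrite !big_ord_recl big_ord0 /c /= -/(Z x); ring.
  rewrite integral_poly; congr (_%:E).
  by rewrite !big_ord_recl big_ord0 /c /= mom0 mom1; ring.
- move=> rho de e e0.
  pose c (k : nat) := nth 0 [:: (rho ^+ 2 + K * e) ^+ 2;
    4 * rho * de * (rho ^+ 2 + K * e);
    4 * rho ^+ 2 * de ^+ 2 + 2 * de ^+ 2 * (rho ^+ 2 + K * e);
    4 * rho * de ^+ 3; de ^+ 4] k.
  rewrite (_ : (\int[nu]_x _)%E = (\int[nu]_x (\sum_(k < 5) c k * Z x ^+ k)%:E)%E);
    last first.
    apply: eq_integral => x _; congr (_%:E).
    by rewrite !big_ord_recl big_ord0 /c /= -/(Z x); ring.
  rewrite integral_poly lee_fin !big_ord_recl big_ord0 /c /= mom0 mom1.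
  have H3 : 4 * (rho * de) * de ^+ 2 * mom 3 <=
      2 * `|mom 3| * (rho ^+ 2 * de ^+ 2 + de ^+ 4).
    have := sqr_ge0 (rho * de - de ^+ 2); have := sqr_ge0 (rho * de + de ^+ 2).
    rewrite sqrrB sqrrD exprMn -exprM => Hp Hm.
    have : `|2 * (rho * de * de ^+ 2)| <= rho ^+ 2 * de ^+ 2 + de ^+ 4.
      by rewrite ler_norml; move: Hp Hm; lra.
    move=> H; have := ler_wpM2r m3 H; rewrite -normrM => {}H.
    have := le_trans (ler_norm _) H; lra.
  have D0 : 0 <= rho ^+ 2 * de ^+ 2 by rewrite mulr_ge0 ?sqr_ge0.
  have F0 : 0 <= de ^+ 4 by rewrite -[4%N]/(2 * 2)%N exprM sqr_ge0.
  have H4 : de ^+ 4 * (2 * `|mom 3| + mom 4) <= de ^+ 4 * K ^+ 2.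
    rewrite ler_wpM2l//; apply: (@le_trans _ _ K); first by (rewrite /K; move: mom2_gt0; lra).
    by rewrite ler_eXnr.
  have H5 : K * e * de ^+ 2 * mom 2 <= K * e * de ^+ 2 * K.
    rewrite ler_wpM2l//; last by (rewrite /K; move: mom2_gt0; lra).
    by rewrite mulr_ge0 ?sqr_ge0// mulr_ge0//; move: K1; lra.
  have H6 : rho ^+ 2 * de ^+ 2 * (6 * mom 2 + 2 * `|mom 3|) <= rho ^+ 2 * de ^+ 2 * (2 * K).
    by rewrite ler_wpM2l// /K; move: mom2_gt0; lra.
  move: H3 H4 H5 H6.
  by rewrite !exprS !expr0; lra.
Qed.

End normal_square_moments.

Section single_row_signal.
Context {R : realType} {d : measure_display} {Omega : measurableType d}.
Variable P : probability Omega R.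
Variables mu v K : R.
Hypotheses (v0 : 0 < v) (vK : v <= K) (K1 : 1 <= K).
Hypothesis moment2 : forall rho de e, 0 <= e ->
  (\int[normal_prob 0 1]_x ((rho + de * ((x : R) ^+ 2 - mu)) ^+ 2 + e)%:E =
   (rho ^+ 2 + (v * de ^+ 2 + e))%:E)%E.
Hypothesis moment4 : forall rho de e, 0 <= e ->
  (\int[normal_prob 0 1]_x (((rho + de * ((x : R) ^+ 2 - mu)) ^+ 2 + K * e) ^+ 2)%:E <=
   ((rho ^+ 2 + K * (e + de ^+ 2)) ^+ 2)%:E)%E.

Let csum n (de : 'I_n -> R) (x : 'I_n -> R) : R :=
  \sum_p de p * (x p ^+ 2 - mu).

Let csum_measurable n (de : 'I_n -> R) d' (T : measurableType d')
    (h : 'I_n -> T -> R) : (forall s, measurable_fun setT (h s)) ->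
  measurable_fun setT (fun t => csum de (fun s => h s t)).
Proof.
move=> mh; apply: measurable_sum => p; apply: measurable_funM => //.
by apply: measurable_funB => //; exact: measurable_funX.
Qed.

Let csum_recl n (de : 'I_n.+1 -> R) (a : 'I_n.+1 -> Omega -> R) o o' :
  csum de (fun i => if predC1 ord0 i then a i o else a i o') =
  de ord0 * (a ord0 o' ^+ 2 - mu) +
  csum (fun i => de (lift ord0 i)) (fun i => a (lift ord0 i) o).
Proof. by rewrite /csum big_ord_recl /=. Qed.

Let sum_sq_ge0 n (de : 'I_n -> R) : 0 <= \sum_p de p ^+ 2.
Proof. by apply: sumr_ge0 => p _; exact: sqr_ge0. Qed.

Let csum_moment2 n (a : 'I_n -> Omega -> R) (de : 'I_n -> R) (rho e : R) :
  independent_family P a -> (forall p, normal_law P 1 (a p)) -> 0 <= e ->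
  (\int[P]_o ((rho + csum de (fun p => a p o)) ^+ 2 + e)%:E =
   (rho ^+ 2 + (v * (\sum_p de p ^+ 2) + e))%:E)%E.
Proof.
elim: n => [|n IH] in a de rho e *.
  move=> _ _ _; rewrite big_ord0 mulr0 add0r.
  under eq_integral do rewrite /csum big_ord0 addr0.
  by rewrite integral_probability_cst.
move=> aind aN e0.
have mF : env_measurable (fun x => (rho + csum de x) ^+ 2 + e).
  move=> d' T h mh; apply: measurable_funD => //; apply: measurable_funX.
  by apply: measurable_funD => //; exact: csum_measurable.
rewrite (independent_resample (pred_of_simpl (predC1 ord0)) aind mF); last first.
  by move=> x; rewrite addr_ge0// sqr_ge0.
pose a' i := a (lift ord0 i).
have a'ind : independent_family P a'.
  by apply: (independent_family_comp (f := lift ord0)) aind; exact: lift_inj.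
have a'N p : normal_law P 1 (a' p) by exact: aN.
have E o : (\int[P]_o' ((rho + csum de
      (fun i => if predC1 ord0 i then a i o else a i o')) ^+ 2 + e)%:E =
    ((rho + csum (fun i => de (lift ord0 i)) (fun i => a' i o)) ^+ 2 +
      (v * de ord0 ^+ 2 + e))%:E)%E.
  under eq_integral do rewrite csum_recl [_ * _ + _]addrC addrA.
  rewrite (ge0_integral_normal_law (s := 1) (f := fun y => (((rho +
    csum (fun i => de (lift ord0 i)) (fun i => a' i o)) +
    de ord0 * (y ^+ 2 - mu)) ^+ 2 + e)%:E) (aN ord0)).
  - by rewrite (negbTE (oner_neq0 _)) moment2.
  - apply/measurable_EFinP; apply: measurable_funD => //; apply: measurable_funX.
    apply: measurable_funD => //; apply: measurable_funM => //.
    by apply: measurable_funB => //; exact: measurable_funX.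
  - by move=> y; rewrite lee_fin addr_ge0// sqr_ge0.
under eq_integral do rewrite E.
rewrite IH//; last by rewrite addr_ge0// mulr_ge0 ?sqr_ge0// ltW.
by rewrite big_ord_recl; congr (_%:E); ring.
Qed.

Let csum_moment4 n (a : 'I_n -> Omega -> R) (de : 'I_n -> R) (rho e : R) :
  independent_family P a -> (forall p, normal_law P 1 (a p)) -> 0 <= e ->
  (\int[P]_o (((rho + csum de (fun p => a p o)) ^+ 2 + K * e) ^+ 2)%:E <=
   ((rho ^+ 2 + K * (e + \sum_p de p ^+ 2)) ^+ 2)%:E)%E.
Proof.
elim: n => [|n IH] in a de rho e *.
  move=> _ _ _; rewrite big_ord0 addr0.
  under eq_integral do rewrite /csum big_ord0 addr0.
  by rewrite integral_probability_cst.
move=> aind aN e0.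
have mF : env_measurable (fun x => ((rho + csum de x) ^+ 2 + K * e) ^+ 2).
  move=> d' T h mh; apply: measurable_funX.
  apply: measurable_funD => //; apply: measurable_funX.
  by apply: measurable_funD => //; exact: csum_measurable.
pose a' i := a (lift ord0 i).
have a'ind : independent_family P a'.
  by apply: (independent_family_comp (f := lift ord0)) aind; exact: lift_inj.
have a'N p : normal_law P 1 (a' p) by exact: aN.
have [ma' _] := a'ind.
pose G o : \bar R := (((rho + csum (fun i => de (lift ord0 i)) (fun i => a' i o)) ^+ 2 +
      K * (e + de ord0 ^+ 2)) ^+ 2)%:E.
apply: (@le_trans _ _ (\int[P]_o G o)%E).
  apply: (independent_conditional_le (J := pred_of_simpl (predC1 ord0)) aind mF).
  - by move=> x; exact: sqr_ge0.
  - apply/measurable_EFinP; apply: measurable_funX.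
    apply: measurable_funD => //; apply: measurable_funX.
    by apply: measurable_funD => //; exact: csum_measurable.
  move=> o; under eq_integral do rewrite csum_recl [_ * _ + _]addrC addrA.
  rewrite (ge0_integral_normal_law (s := 1) (f := fun y => ((((rho +
    csum (fun i => de (lift ord0 i)) (fun i => a' i o)) +
    de ord0 * (y ^+ 2 - mu)) ^+ 2 + K * e) ^+ 2)%:E) (aN ord0)).
  - by rewrite (negbTE (oner_neq0 _)); exact: moment4.
  - apply/measurable_EFinP; apply: measurable_funX.
    apply: measurable_funD => //; apply: measurable_funX.
    apply: measurable_funD => //; apply: measurable_funM => //.
    by apply: measurable_funB => //; exact: measurable_funX.
  - by move=> y; rewrite lee_fin sqr_ge0.
apply: (le_trans (IH _ _ _ _ a'ind _ _)) => //.
  by rewrite addr_ge0// sqr_ge0.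
by rewrite big_ord_recl addrA.
Qed.

Let expRN_le (x : R) : 0 <= x -> expR (- x) + x <= 1 + x ^+ 2.
Proof.
move=> x0; have x1 : 0 < 1 + x by rewrite ltr_pwDl.
have H : expR (- x) <= (1 + x)^-1.
  rewrite expRN lef_pV2 ?posrE ?expR_gt0//; exact: expR_ge1Dx.
have : (1 + x)^-1 <= 1 - x + x ^+ 2.
  rewrite -[leLHS]mul1r ler_pdivrMr//.
  have -> : (1 - x + x ^+ 2) * (1 + x) = 1 + x ^+ 3 by ring.
  by rewrite lerDl exprn_ge0.
lra.
Qed.

(** From exp(- x) <= 1 - x + x^2 at x = c X^2, with X the weighted sum: the second
    moment of X is at least v times the sum of squares of the weights, and its
    fourth moment is at most a constant times the square of the second, so the
    quadratic term is at most half of the linear one for small c. *)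
Lemma signal_exp_one_row n (a : 'I_n -> Omega -> R) (de : 'I_n -> R) (dd c : R) :
  independent_family P a -> (forall p, normal_law P 1 (a p)) ->
  0 <= c -> (forall p, `|de p| <= dd) ->
  2 * (K / v) * (mu ^+ 2 + K) * (c * (n%:R * dd) ^+ 2) <= 1 ->
  (\int[P]_o (expR (- c * (\sum_p de p * a p o ^+ 2) ^+ 2))%:E <=
   (expR (- (c * v / 2 * \sum_p de p ^+ 2)))%:E)%E.
Proof.
move=> aind aN c0 ded small; have [ma _] := aind.
set q := \sum_p de p ^+ 2; have q0 : 0 <= q by exact: sum_sq_ge0.
pose s := mu * \sum_p de p.
pose X o := \sum_p de p * a p o ^+ 2.
have XE o : X o = s + csum de (fun p => a p o).
  rewrite /X /s /csum mulr_sumr -big_split /=; apply: eq_bigr => p _; ring.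
have mX : measurable_fun setT X.
  apply: measurable_sum => p; apply: measurable_funM => //.
  exact: measurable_funX.
have m2 : (\int[P]_o (X o ^+ 2)%:E = (s ^+ 2 + v * q)%:E)%E.
  under eq_integral do rewrite XE -[_ ^+ 2]addr0.
  by rewrite csum_moment2// addr0.
have m4 : (\int[P]_o (X o ^+ 2 ^+ 2)%:E <= ((s ^+ 2 + K * q) ^+ 2)%:E)%E.
  under eq_integral do rewrite XE -[(s + _) ^+ 2]addr0 -(mulr0 K).
  by apply: le_trans (csum_moment4 _ _ _ _ _) _; rewrite // add0r.
have mexp : measurable_fun setT (fun o => (expR (- c * X o ^+ 2))%:E).
  apply/measurable_EFinP; apply: measurableT_comp => //.
  by apply: measurable_funM => //; exact: measurable_funX.
have key : (\int[P]_o (expR (- c * X o ^+ 2))%:E + (c * (s ^+ 2 + v * q))%:E <=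
    1 + (c ^+ 2 * (s ^+ 2 + K * q) ^+ 2)%:E)%E.
  have -> : (c * (s ^+ 2 + v * q))%:E = (\int[P]_o (c * X o ^+ 2)%:E)%E.
    rewrite EFinM -m2 -ge0_integralZl//.
      by apply/measurable_EFinP/measurable_funX.
    by move=> o _; rewrite lee_fin sqr_ge0.
  rewrite -ge0_integralD//; first last.
  - by apply/measurable_EFinP/measurable_funM => //; exact: measurable_funX.
  - by move=> o _; rewrite lee_fin mulr_ge0// sqr_ge0.
  apply: (@le_trans _ _ (\int[P]_o (1 + (c ^+ 2)%:E * (X o ^+ 2 ^+ 2)%:E))%E).
    apply: ge0_le_integral => //.
    - by move=> o _; rewrite -EFinD lee_fin addr_ge0 ?expR_ge0// mulr_ge0// sqr_ge0.
    - apply: emeasurable_funD => //.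
      by apply/measurable_EFinP/measurable_funM => //; exact: measurable_funX.
    - apply: emeasurable_funD => //; apply: emeasurable_funM => //.
      by apply/measurable_EFinP/measurable_funX/measurable_funX.
    - move=> o _; rewrite -EFinM -!EFinD lee_fin.
      have := expRN_le (mulr_ge0 c0 (sqr_ge0 (X o))).
      by rewrite exprMn mulNr.
  rewrite ge0_integralD//; first last.
  - apply: emeasurable_funM => //.
    by apply/measurable_EFinP/measurable_funX/measurable_funX.
  - by move=> o _; rewrite -EFinM lee_fin mulr_ge0// sqr_ge0.
  rewrite integral_probability_cst leeD2l//.
  rewrite ge0_integralZl//; first last.
  - by rewrite lee_fin sqr_ge0.
  - by move=> o _; rewrite lee_fin sqr_ge0.
  - by apply/measurable_EFinP/measurable_funX/measurable_funX.
  by rewrite (EFinM (c ^+ 2)); apply: lee_wpmul2l => //; rewrite lee_fin sqr_ge0.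
have {}key : (\int[P]_o (expR (- c * X o ^+ 2))%:E + (c * (s ^+ 2 + v * q))%:E <=
    (1 + c ^+ 2 * (s ^+ 2 + K * q) ^+ 2)%:E)%E by rewrite EFinD.
move: key; rewrite -leeBrDr// => key; apply: (le_trans key).
rewrite -EFinB lee_fin; apply: le_trans (expR_ge1Dx _).
have n2 : n%:R <= n%:R ^+ 2 :> R by rewrite -natrX ler_nat; nia.
have dsq p : de p ^+ 2 <= dd ^+ 2.
  rewrite -(real_normK (num_real (de p))) lerXn2r ?nnegrE//.
  exact: le_trans (normr_ge0 _) (ded p).
have qle : q <= (n%:R * dd) ^+ 2.
  apply: (@le_trans _ _ (\sum_(p < n) dd ^+ 2)); first exact: ler_sum.
  by rewrite sumr_const card_ord -[leLHS]mulr_natl exprMn ler_wpM2r// sqr_ge0.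
have sle : s ^+ 2 <= mu ^+ 2 * (n%:R * dd) ^+ 2.
  have Sle : `|\sum_p de p| <= n%:R * dd.
    apply: (le_trans (ler_norm_sum _ _ _)).
    apply: (@le_trans _ _ (\sum_(p < n) dd)); first exact: ler_sum.
    by rewrite sumr_const card_ord mulr_natl.
  rewrite /s exprMn ler_wpM2l ?sqr_ge0//.
  rewrite -(real_normK (num_real (\sum_p de p))) lerXn2r ?nnegrE//.
  exact: le_trans (normr_ge0 _) Sle.
set U := s ^+ 2 + K * q; set L := s ^+ 2 + v * q.
have K0 : 0 < K by exact: lt_le_trans v0 vK.
have U0 : 0 <= U by rewrite addr_ge0 ?sqr_ge0// mulr_ge0// ltW.
have UL : U <= (K / v) * L.
  rewrite /U /L mulrDr mulrA divfK ?gt_eqF// lerD2r ler_peMl ?sqr_ge0//.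
  by rewrite ler_pdivlMr// mul1r.
have UB : U <= (mu ^+ 2 + K) * (n%:R * dd) ^+ 2.
  by rewrite mulrDl lerD// ler_wpM2l// ltW.
have Kv0 : 0 <= K / v by rewrite divr_ge0// ltW.
have H1 : (K / v) * (c * U) <= 1 / 2.
  have : (K / v) * (c * U) <= (K / v) * (c * ((mu ^+ 2 + K) * (n%:R * dd) ^+ 2)).
    by rewrite ler_wpM2l// ler_wpM2l.
  by move: small; lra.
have L0 : 0 <= L by rewrite addr_ge0 ?sqr_ge0// mulr_ge0// ltW.
have H2 : c ^+ 2 * U ^+ 2 <= c * L * (1 / 2).
  have : c * U * (c * U) <= c * U * (c * (K / v * L)).
    by rewrite ler_wpM2l ?mulr_ge0// ler_wpM2l.
  have : c * L * (K / v * (c * U)) <= c * L * (1 / 2).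
    by rewrite ler_wpM2l// mulr_ge0.
  rewrite !expr2; lra.
have H3 : c * (v * q) <= c * L by rewrite ler_wpM2l// lerDr sqr_ge0.
by move: H2 H3; lra.
Qed.

End single_row_signal.

(** * Operator norm of a Gaussian matrix *)

Section lattice_net.
Context {R : realType}.

(** Integer vectors, as signs and absolute values. *)
Definition lattice_vec {n K} (f : {ffun 'I_n -> bool * 'I_K}) : 'cV[R]_n :=
  \col_p ((-1) ^+ (f p).1 * ((f p).2)%:R).

Definition lattice_net n : seq 'cV[R]_n :=
  [seq lattice_vec f | f <- enum {ffun 'I_n -> bool * 'I_(4 * n).+1} &
     (0 < sqnorm (lattice_vec f) <= (4 * n)%:R)].

Lemma sqnorm_lattice_vec n K (f : {ffun 'I_n -> bool * 'I_K}) :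
  sqnorm (lattice_vec f) = \sum_p ((f p).2)%:R ^+ 2.
Proof.
rewrite sqnorm_colE; apply: eq_bigr => p _.
by rewrite mxE exprMn -signr_odd -exprM mulnC exprM sqrrN expr1n expr1n mul1r.
Qed.

Lemma geometric_half_sum K : \sum_(j < K) (2^-1 : R) ^+ j <= 2.
Proof.
suff -> : \sum_(j < K) (2^-1 : R) ^+ j = 2 - 2 * 2^-1 ^+ K.
  by rewrite gerBl mulr_ge0// exprn_ge0.
elim: K => [|K IH]; first by rewrite big_ord0 expr0; ring.
by rewrite big_ord_recr /= IH exprS; field.
Qed.

(** A net point has absolute values j with sum j <= sum j^2 <= 4 n, so it has
    weight at least 1 under 2^(4n) * prod_p 2^(- j p), and the sum of these
    weights over all f factors over the coordinates. *)
Lemma size_lattice_net n : (size (lattice_net n))%:R <= expR (6 * n%:R) :> R.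
Proof.
set K := (4 * n).+1.
have half_ge0 k : 0 <= (2^-1 : R) ^+ k by rewrite exprn_ge0.
apply: (@le_trans _ _ (\sum_(f : {ffun 'I_n -> bool * 'I_K})
    2 ^+ (4 * n) * \prod_p (2^-1 : R) ^+ (f p).2)).
  rewrite size_map size_filter -sum1_count natr_sum big_mkcond /=.
  rewrite -[in leRHS]big_enum /=; apply: ler_sum => f _.
  case: ifP => [/andP[_]|_]; last by rewrite mulr_ge0 ?exprn_ge0// prodr_ge0.
  rewrite sqnorm_lattice_vec => H.
  have {}H : (\sum_p (f p).2 <= 4 * n)%N.
    rewrite -(ler_nat R); apply: le_trans H; rewrite natr_sum.
    by apply: ler_sum => p _; rewrite -natrX ler_nat; nia.
  rewrite prodrXr -(subnK H) exprD -mulrA -exprMn divff// expr1n mulr1.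
  by rewrite exprn_ege1// ler1n.
rewrite -mulr_sumr -(bigA_distr_bigA (fun (p : 'I_n) (j : bool * 'I_K) =>
  (2^-1 : R) ^+ j.2)) /=.
have col : \sum_(j : bool * 'I_K) (2^-1 : R) ^+ j.2 <= 4.
  rewrite -(pair_big predT predT (fun (_ : bool) (j : 'I_K) => (2^-1 : R) ^+ j)) /=.
  by rewrite big_bool /=; have := geometric_half_sum K; lra.
apply: (@le_trans _ _ (2 ^+ (4 * n) * 4 ^+ n)).
  rewrite ler_wpM2l ?exprn_ge0// -[in leRHS](card_ord n) -prodr_const.
  by apply: ler_prod => p _; rewrite col andbT; apply: sumr_ge0.
have -> : 2 ^+ (4 * n) * 4 ^+ n = 2 ^+ (6 * n) :> R.
  by rewrite !exprM -exprMn; congr (_ ^+ n); ring.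
have -> : 6 * n%:R = 1 * (6 * n)%:R :> R by rewrite mul1r natrM.
rewrite expRM_natr lerXn2r// ?nnegrE ?expR_ge0//.
by have := expR_ge1Dx (1 : R); lra.
Qed.

(** Rescale [x] to squared norm 4 n and round its coordinates towards 0: the
    result lies in the net (or is 0), and the error, at most 1 in each
    coordinate, has squared norm at most n, a quarter of the total. *)
Lemma lattice_net_step p n (A : 'M[R]_(p, n)) (t s : R) : 0 <= t -> 0 <= s ->
  spectral_test (lattice_net n) t A -> op_bounded A s ->
  op_bounded A (2 * t + s / 2).
Proof.
move=> t0 s0 tA As x.
have [x0|x0] := eqVneq (sqnorm x) 0.
  by apply: le_trans (As x) _; rewrite x0 !mulr0.
have xp : 0 < sqnorm x by rewrite lt_neqAle eq_sym x0 sqnorm_ge0.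
case: n A x tA As x0 xp => [|n] A x tA As x0 xp.
  by move: x0; rewrite sqnorm_colE big_ord0 eqxx.
pose c := Num.sqrt (4 * n.+1%:R / sqnorm x).
have cx : c ^+ 2 * sqnorm x = 4 * n.+1%:R.
  by rewrite sqr_sqrtr ?divr_ge0 ?mulr_ge0// ?ltW// divfK.
have c2 : 0 < c ^+ 2 by rewrite sqr_sqrtr ?divr_ge0 ?mulr_ge0// ?ltW// divr_gt0.
pose y := c *: x.
have yn : sqnorm y = 4 * n.+1%:R by rewrite sqnormZ.
pose j (i : 'I_n.+1) := Num.truncn `|y i 0|.
have jle i : (j i)%:R <= `|y i 0| by rewrite truncn_le.
have sumj : \sum_i (j i)%:R ^+ 2 <= (4 * n.+1)%:R :> R.
  rewrite natrM -yn sqnorm_colE; apply: ler_sum => i _.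
  by rewrite -(real_normK (num_real (y i 0))) lerXn2r ?nnegrE.
have jK i : (j i < (4 * n.+1).+1)%N.
  rewrite ltnS -(ler_nat R); apply: le_trans sumj.
  rewrite (bigD1 i)//= -[leLHS]addr0 lerD//; last first.
    by apply: sumr_ge0 => k _; exact: sqr_ge0.
  by rewrite -natrX ler_nat; nia.
pose f : {ffun 'I_n.+1 -> bool * 'I_(4 * n.+1).+1} :=
  [ffun i => ((y i 0 < 0)%R, Ordinal (jK i))].
pose v := lattice_vec f.
have vE i : v i 0 = (-1) ^+ (y i 0 < 0)%R * (j i)%:R by rewrite mxE ffunE.
have vn : sqnorm v <= (4 * n.+1)%:R.
  rewrite sqnorm_lattice_vec; under eq_bigr do rewrite ffunE /=.
  exact: sumj.
have Av : sqnorm (A *m v) <= t * sqnorm v.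
  have [v0|v0] := eqVneq (sqnorm v) 0.
    by apply: le_trans (As v) _; rewrite v0 !mulr0.
  move/allP: tA; apply.
  apply/mapP; exists f => //; rewrite mem_filter mem_enum andbT vn andbT.
  by rewrite lt_neqAle eq_sym v0 sqnorm_ge0.
have ry : sqnorm (y - v) <= n.+1%:R.
  have -> : n.+1%:R = \sum_(i < n.+1) 1 :> R by rewrite sumr_const card_ord.
  rewrite sqnorm_colE.
  apply: ler_sum => i _; rewrite !mxE -/(y i 0) -/(v i 0).
  have -> : (c * x i 0 - (-1) ^+ (f i).1 * (f i).2%:R) ^+ 2 =
    (`|y i 0| - (j i)%:R) ^+ 2.
    have -> : c * x i 0 = y i 0 by rewrite mxE.
    rewrite ffunE /=; case: (ltrP (y i 0) 0) => h.
      by rewrite expr1 ltr0_norm//; ring.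
    by rewrite expr0 ger0_norm//; ring.
  rewrite expr_le1// ?subr_ge0//.
  by have := truncnS_gt `|y i 0|; rewrite -natr1 -/(j i); lra.
have Ay : sqnorm (A *m y) <= 2 * (t * (4 * n.+1%:R)) + 2 * (s * n.+1%:R).
  have -> : A *m y = A *m v + A *m (y - v) by rewrite -mulmxDr addrC subrK.
  have h1 : sqnorm (A *m v) <= t * (4 * n.+1%:R).
    by apply: le_trans Av _; rewrite ler_wpM2l// -natrM.
  have h2 : sqnorm (A *m (y - v)) <= s * n.+1%:R.
    by apply: le_trans (As _) _; rewrite ler_wpM2l.
  have := sqnorm_ge0 (A *m v - A *m (y - v)); rewrite sqnormB sqnormD.
  move: h1 h2; lra.
move: Ay; rewrite /y -scalemxAr sqnormZ => Ay.
rewrite -(ler_pM2l c2); apply: le_trans Ay _.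
have -> : c ^+ 2 * ((2 * t + s / 2) * sqnorm x) = (2 * t + s / 2) * (c ^+ 2 * sqnorm x).
  by ring.
by rewrite cx; lra.
Qed.

(** Start from the Frobenius bound and iterate [lattice_net_step]; the map
    s |-> 2 t + s / 2 contracts to its fixed point 4 t. *)
Lemma lattice_netP p n (A : 'M[R]_(p, n)) (t : R) : 0 <= t ->
  spectral_test (lattice_net n) t A -> op_bounded A (4 * t).
Proof.
move=> t0 tA.
have A0 : op_bounded A (sqnorm A).
  move=> x; rewrite [leLHS]sqnorm_colE [sqnorm A]sqnormE mulr_suml.
  apply: ler_sum => i _.
  have := frob_CS (row i A)^T x; rewrite sqnorm_tr.
  rewrite frob_colE [sqnorm (row i A)]sqnormE big_ord1.
  under eq_bigr do rewrite !mxE.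
  under [X in _ <= X * _ -> _]eq_bigr do rewrite mxE.
  by rewrite mxE.
have step k : op_bounded A (4 * t + sqnorm A * 2^-1 ^+ k).
  elim: k => [|k IH].
    move=> x; apply: le_trans (A0 x) _; rewrite ler_wpM2r ?sqnorm_ge0//.
    by rewrite expr0 mulr1 lerDr mulr_ge0.
  have := lattice_net_step t0 _ tA IH.
  rewrite (_ : 2 * t + _ = 4 * t + sqnorm A * 2^-1 ^+ k.+1); last first.
    by rewrite exprS; field.
  by apply; rewrite addr_ge0// mulr_ge0 ?sqnorm_ge0 ?exprn_ge0.
move=> x; apply/ler_addgt0Pr => e e0.
have [k hk] : exists k : nat, sqnorm A * sqnorm x <= e * k%:R.
  exists (Num.truncn (sqnorm A * sqnorm x / e)).+1.
  by rewrite [leRHS]mulrC -ler_pdivrMr// ltW// truncnS_gt.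
apply: le_trans (step k x) _; rewrite mulrDl lerD2l mulrAC.
rewrite exprVn ler_pdivrMr ?exprn_gt0//; apply: le_trans hk _.
rewrite ler_wpM2l ?(ltW e0)// -natrX ler_nat.
by rewrite ltnW// ltn_expl.
Qed.

End lattice_net.

Section spectral_tail.
Context {R : realType} {d : measure_display} {Omega : measurableType d}.
Variable P : probability Omega R.

(** Exponential Markov bound for |A v|^2, whose rows contribute independently. *)
Lemma gaussian_row_tail m n (a : 'I_m * 'I_n -> Omega -> R) (v : 'cV[R]_n) (t : R) :
  independent_family P a -> (forall u, normal_law P 1 (a u)) ->
  0 < sqnorm v ->
  (\int[P]_o (expR ((16 * sqnorm v)^-1 *
     (sqnorm ((\matrix_(i, p) a (i, p) o) *m v) - t * sqnorm v)))%:E <=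
   (expR (m%:R / 8 - t / 16))%:E)%E.
Proof.
move=> aind aN v0.
set c := (16 * sqnorm v)^-1.
have c0 : 0 < c by rewrite invr_gt0 mulr_gt0.
have cv : c * sqnorm v = 16^-1 by rewrite /c invfM divfK// gt_eqF.
pose F (x : 'I_n -> R) := expR (c * sqnorm (v^T *m \col_p x p)).
have mF : env_measurable F.
  move=> d' T h mh; apply: measurableT_comp => //; apply: measurable_funM => //.
  have mw : measurable_fun setT (fun t => v^T *m \col_p h p t).
    apply: measurable_mulmx => //; apply: measurable_mxP => i j.
    by under eq_fun do rewrite mxE; exact: mh.
  exact: measurable_frob.
rewrite (eq_integral (fun o => (expR (- (t / 16)))%:E *
    (\prod_i F (fun p => a (i, p) o))%:E)%E); last first.
  move=> o _; rewrite -EFinM; congr (_%:E).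
  rewrite -expR_sum -expRD; congr expR; rewrite mulrBr mulrCA cv addrC.
  congr (_ + _); rewrite sqnorm_colE mulr_sumr; apply: eq_bigr => i _.
  congr (_ * _); rewrite sqnorm_colE big_ord1 !mxE; congr (_ ^+ 2).
  by apply: eq_bigr => p _; rewrite !mxE mulrC.
rewrite ge0_integralZl//; first last.
- by move=> o _; rewrite lee_fin prodr_ge0// => i _; exact: expR_ge0.
- apply/measurable_EFinP; apply: measurable_prod => i _.
  by apply: mF => p; case: aind.
rewrite [m%:R / 8 - _]addrC expRD EFinM lee_wpmul2l//.
have -> : expR (m%:R / 8) = \prod_(i < m) expR (8^-1) :> R.
  by rewrite prodr_const card_ord -expRM_natl.
apply: (independent_prod_le (F := fun=> F) (C := fun=> expR 8^-1) aind) => //.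
- by move=> i x; exact: expR_ge0.
- move=> i.
  have ai : independent_family P (fun p => a (i, p)).
    by apply: (independent_family_comp (f := fun p => (i, p))) aind => p p' [].
  have aNi p : normal_law P 1 (a (i, p)) by [].
  have opv : op_bounded v^T (sqnorm v).
    move=> x; suff -> : sqnorm (v^T *m x) = frob v x ^+ 2 by exact: frob_CS.
    by rewrite sqnorm_colE big_ord1 /frob /mxtrace big_ord1.
  have cs : `|c| * sqnorm v <= 16^-1 by rewrite ger0_norm ?(ltW c0)// cv.
  apply: (le_trans (gaussian_sqnorm_exp ai aNi (sqnorm_ge0 v) opv cs)).
  rewrite lee_fin ler_expR sqnorm_tr ger0_norm ?(ltW c0)// mulrDl -mulrA cv; lra.
Qed.

(** Union bound over the net: 6 n + m/8 - 8 (m + n) <= - 2 n. *)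
Lemma spectral_test_tail m n (a : 'I_m * 'I_n -> Omega -> R) :
  independent_family P a -> (forall u, normal_law P 1 (a u)) ->
  (\int[P]_o ((~~ spectral_test (lattice_net n) (128 * (m%:R + n%:R))
      (\matrix_(i, p) a (i, p) o))%:R : R)%:E <= (expR (- (2 * n%:R)))%:E)%E.
Proof.
move=> aind aN; have [ma _] := aind.
set t := 128 * _; set net := lattice_net n.
have mA : measurable_fun setT (fun o => \matrix_(i, p) a (i, p) o).
  by apply: measurable_mxP => i j; under eq_fun do rewrite mxE; exact: ma.
pose E (v : 'cV[R]_n) o : R := expR ((16 * sqnorm v)^-1 *
     (sqnorm ((\matrix_(i, p) a (i, p) o) *m v) - t * sqnorm v)).
have mE v : measurable_fun setT (fun o => (E v o)%:E).
  apply/measurable_EFinP; apply: measurableT_comp => //.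
  apply: measurable_funM => //; apply: measurable_funB => //.
  by apply: measurable_frob; exact: measurable_mulmx.
have net0 v : v \in net -> 0 < sqnorm v.
  by move=> /mapP[f]; rewrite mem_filter => /andP[/andP[f0 _] _] ->.
have mtest : measurable_fun setT (fun o => ((~~ spectral_test net t
      (\matrix_(i, p) a (i, p) o))%:R : R)%:E).
  apply/measurable_EFinP.
  rewrite (_ : (fun _ => _) = fun o => 1 - (spectral_test net t
      (\matrix_(i, p) a (i, p) o))%:R).
    by apply: measurable_funB => //; exact: measurable_spectral_test_indicator.
  by apply/funext => o; case: spectral_test; rewrite ?subrr ?subr0.
apply: (@le_trans _ _ (\int[P]_o (\sum_(v <- net) (E v o)%:E))%E).
  apply: ge0_le_integral => //.
  - by apply: emeasurable_sum => v; exact: mE.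
  move=> o _; rewrite sumEFin lee_fin /spectral_test -has_predC.
  case: hasP => [[v vnet /=]|_]; last by apply: sumr_ge0 => v _; exact: expR_ge0.
  rewrite -ltNge => h; rewrite (big_rem v)//= -[leLHS]addr0 lerD//.
    rewrite /E -[leLHS]expR0 ler_expR mulr_ge0 ?subr_ge0 ?ltW//.
    by rewrite invr_gt0 mulr_gt0// net0.
  by apply: sumr_ge0 => w _; exact: expR_ge0.
rewrite ge0_integral_sum//; last by move=> v o _; rewrite lee_fin expR_ge0.
apply: (@le_trans _ _ (\sum_(v <- net) (expR (m%:R / 8 - t / 16))%:E)%E).
  rewrite big_seq [leRHS]big_seq; apply: lee_sum => v vnet.
  exact: gaussian_row_tail (net0 v vnet).
rewrite sumEFin lee_fin big_const_seq count_predT iter_addr_0 -[leLHS]mulr_natl.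
apply: (@le_trans _ _ (expR (6 * n%:R) * expR (m%:R / 8 - t / 16))).
  by rewrite ler_wpM2r ?expR_ge0// size_lattice_net.
rewrite -expRD ler_expR /t.
have := ler0n R m; have := ler0n R n; lra.
Qed.

End spectral_tail.

(** * One block of observations *)

Section block.
Context {R : realType} {m n : nat}.
Notation U := (('I_m * 'I_n) + 'I_(n + m))%type.

Definition block_sensing (x : U -> R) : 'M[R]_(m, n) :=
  \matrix_(i, p) x (inl (i, p)).

Definition block_observation (x0 : 'cV[R]_n) (x : U -> R) : 'cV[R]_m :=
  block_sensing x *m diag_mx x0^T *m (\col_i x (inr (lshift m i))) +
  \col_i x (inr (rshift n i)).

Definition spectral_threshold : R := 128 * (m%:R + n%:R).

(** The likelihood-type ratio of two candidates for one observation, restricted to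
    the event that the sensing matrix passes the spectral test.  The entries of
    the sensing matrix, of the speckle vector and of the noise are the
    coordinates of [x]. *)
Definition block_ratio (l sig : R) (x0 : 'cV[R]_n) (th1 th2 : 'rV[R]_n)
    (x : U -> R) : R :=
  (spectral_test (lattice_net n) spectral_threshold (block_sensing x))%:R *
  expR (- l * (score sig (block_sensing x) (block_observation x0 x) th1 -
               score sig (block_sensing x) (block_observation x0 x) th2)).

Lemma block_ratio_ge0 l sig x0 th1 th2 x : 0 <= block_ratio l sig x0 th1 th2 x.
Proof. by rewrite mulr_ge0// expR_ge0. Qed.

Section measurability.
Context {d : measure_display} {T : measurableType d}.
Variable h : U -> T -> R.
Hypothesis mh : forall s, measurable_fun setT (h s).

Lemma measurable_block_sensing :
  measurable_fun setT (fun t => block_sensing (fun s => h s t)).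
Proof. by apply: measurable_mxP => i j; under eq_fun do rewrite mxE; exact: mh. Qed.

Lemma measurable_block_observation x0 :
  measurable_fun setT (fun t => block_observation x0 (fun s => h s t)).
Proof.
apply: measurable_addmx; last first.
  by apply: measurable_mxP => i j; under eq_fun do rewrite mxE; exact: mh.
apply: measurable_mulmx; last first.
  by apply: measurable_mxP => i j; under eq_fun do rewrite mxE; exact: mh.
by apply: measurable_mulmx => //; exact: measurable_block_sensing.
Qed.

End measurability.

Lemma env_measurable_block_ratio l sig x0 th1 th2 :
  env_measurable (block_ratio l sig x0 th1 th2).
Proof.
move=> d T h mh; apply: measurable_funM.
  by apply: measurable_spectral_test_indicator; exact: measurable_block_sensing.
apply: measurableT_comp => //; apply: measurable_funM => //.
by apply: measurable_funB; apply: measurable_score;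
  [exact: measurable_block_sensing|exact: measurable_block_observation|
   exact: measurable_block_sensing|exact: measurable_block_observation].
Qed.

End block.
Arguments spectral_threshold {R} m n.

Lemma sqnorm_weighted_gram_row {R : realType} n (A : 'M[R]_(1, n)) (th : 'rV[R]_n) :
  sqnorm (weighted_gram A th) = (\sum_p th 0 p * A 0 p ^+ 2) ^+ 2.
Proof.
rewrite sqnormE big_ord1 big_ord1 !mxE; congr (_ ^+ 2).
by apply: eq_bigr => p _; rewrite mul_mx_diag !mxE; ring.
Qed.

Section block_bound.
Context {R : realType}.

(** The two regimes m > 1 and m = 1 under common smallness conditions. *)
Lemma signal_exp : exists c1 K1 : R, [/\ 0 < c1, 0 <= K1 &
  forall d (Omega : measurableType d) (P : probability Omega R) m n
    (a : 'I_m * 'I_n -> Omega -> R) net (t T : R) (de : 'rV[R]_n) (dd c : R),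
  independent_family P a -> (forall u, normal_law P 1 (a u)) ->
  (forall A : 'M[R]_(m, n), spectral_test net t A -> op_bounded A T) ->
  0 <= T -> (forall p, `|de 0 p| <= dd) -> 0 <= c ->
  16 * (c * (dd ^+ 2 * T)) <= 1 -> 16 * (c * (m%:R * dd ^+ 2)) <= 1 ->
  K1 * (c * (n%:R * dd) ^+ 2) <= 1 -> (0 < m)%N ->
  (\int[P]_o ((spectral_test net t (\matrix_(i, p) a (i, p) o))%:R *
     expR (- c * sqnorm (weighted_gram (\matrix_(i, p) a (i, p) o) de)))%:E <=
   (expR (- (c1 * (c * m%:R ^+ 2 * \sum_p de 0 p ^+ 2))))%:E)%E].
Proof.
have [mu [v [K [v0 vK K1 mom2 mom4]]]] := @normal_square_moments R.
have K0 : 0 < K by exact: lt_le_trans K1.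
exists (Num.min (24^-1) (v / 2)), (2 * (K / v) * (mu ^+ 2 + K)); split.
- by rewrite lt_min invr_gt0 ltr0n divr_gt0.
- apply: mulr_ge0; last by apply: addr_ge0; [exact: sqr_ge0|exact: ltW].
  by apply: mulr_ge0 => //; apply: divr_ge0; exact: ltW.
move=> d Omega P m n a net t T de dd c aind aN netP T0 ded c0 sm1 sm2 sm3 m0.
set Q := \sum_p _.
have Q0 : 0 <= Q by apply: sumr_ge0 => i _; exact: sqr_ge0.
have le_rate r : Num.min 24^-1 (v / 2) <= r ->
    expR (- (r * (c * m%:R ^+ 2 * Q))) <=
    expR (- (Num.min 24^-1 (v / 2) * (c * m%:R ^+ 2 * Q))).
  move=> mr; rewrite ler_expR lerN2 ler_wpM2r//.
  by apply: mulr_ge0 => //; apply: mulr_ge0 => //; exact: sqr_ge0.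
have [m2|] := ltnP 1 m.
  apply: (le_trans (signal_exp_rows aind aN netP T0 ded c0 sm1 sm2 m2)).
  rewrite lee_fin; apply: le_trans (le_rate 24^-1 _); last by rewrite ge_min lexx.
  by rewrite -/Q le_eqVlt; apply/orP; left; apply/eqP; congr (expR (- _)); ring.
move=> m1; have {m1} m1E : m = 1%N by apply/eqP; rewrite eqn_leq m1.
subst m; have [ma _] := aind.
have bind : independent_family P (fun p => a (ord0, p)).
  by apply: (independent_family_comp (f := pair ord0)) aind => ? ? [].
apply: (@le_trans _ _ (expR (- (c * v / 2 * Q)))%:E); last first.
  rewrite lee_fin; apply: le_trans (le_rate (v / 2) _); last by rewrite ge_min lexx orbT.
  by rewrite le_eqVlt; apply/orP; left; apply/eqP; congr (expR (- _)); rewrite expr1n; ring.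
have H := signal_exp_one_row v0 vK K1 mom2 mom4 bind (fun p => aN _) c0 ded sm3.
refine (le_trans _ H).
have mA : measurable_fun setT (fun o => \matrix_(i < 1, p < n) a (i, p) o).
  by apply: measurable_mxP => i j; under eq_fun do rewrite mxE; exact: ma.
apply: ge0_le_integral => //.
- apply/measurable_EFinP; apply: measurable_funM.
    exact: measurable_spectral_test_indicator.
  apply: measurableT_comp => //; apply: measurable_funM => //.
  by apply: measurable_frob; exact: measurable_weighted_gram.
- apply/measurable_EFinP; apply: measurableT_comp => //; apply: measurable_funM => //.
  apply: measurable_funX; apply: measurable_sum => p; apply: measurable_funM => //.
  exact: measurable_funX.
move=> o _; rewrite lee_fin sqnorm_weighted_gram_row.
rewrite (eq_bigr (fun p => de 0 p * a (ord0, p) o ^+ 2)); last first.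
  by move=> p _; rewrite mxE.
by rewrite ger_pMl ?expR_gt0//; case: spectral_test.
Qed.

Definition gaussian_block {d} {Omega : measurableType d} (P : probability Omega R)
    {m n : nat} (sig : R) (h : ('I_m * 'I_n) + 'I_(n + m) -> Omega -> R) :=
  [/\ independent_family P h, forall u, normal_law P 1 (h (inl u)),
      forall i, normal_law P 1 (h (inr (lshift m i))) &
      forall i, normal_law P sig (h (inr (rshift n i)))].

(** Integrate the speckle and the noise for a fixed sensing matrix; on the event
    of the spectral test its operator norm is under control, elsewhere the ratio
    vanishes. *)
Lemma block_ratio_conditional d (Omega : measurableType d) (P : probability Omega R)
    m n (sig : R) (h : ('I_m * 'I_n) + 'I_(n + m) -> Omega -> R) (x0 : 'cV[R]_n)
    (th1 th2 : 'rV[R]_n) (b l : R) :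
  gaussian_block P sig h -> 0 <= b -> (forall i, `|x0 i 0| <= b) ->
  (forall i, `|th1 0 i - th2 0 i| <= b ^+ 2) -> 0 <= l ->
  let t := 4 * spectral_threshold m n in
  48 * l * (b ^+ 2 * t + sig ^+ 2) ^+ 2 <= 1 ->
  (\int[P]_o (block_ratio l sig x0 th1 th2 (fun u => h u o))%:E <=
   (expR (2 * l * (t ^+ 2 * \sum_i (th2 0 i - x0 i 0 ^+ 2) ^+ 2)))%:E *
   \int[P]_o ((spectral_test (lattice_net n) (spectral_threshold m n)
       (\matrix_(i, p) h (inl (i, p)) o))%:R *
     expR (- (l / 4) * sqnorm (weighted_gram (\matrix_(i, p) h (inl (i, p)) o)
                                (th1 - th2))))%:E)%E.
Proof.
move=> [hind hA hw hz] b0 x0b thb l0 t small; have [mh _] := hind.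
have thr0 : 0 <= spectral_threshold m n :> R by rewrite mulr_ge0// addr_ge0.
have t0 : 0 <= t by rewrite mulr_ge0.
set eta := \sum_i _.
have mA : measurable_fun setT (fun o => \matrix_(i, p) h (inl (i, p)) o).
  by apply: measurable_mxP => i j; under eq_fun do rewrite mxE; exact: mh.
pose G o := (spectral_test (lattice_net n) (spectral_threshold m n)
       (\matrix_(i, p) h (inl (i, p)) o))%:R *
     expR (- (l / 4) * sqnorm (weighted_gram (\matrix_(i, p) h (inl (i, p)) o)
                                (th1 - th2))).
have mG : measurable_fun setT (fun o => (G o)%:E).
  apply/measurable_EFinP; apply: measurable_funM.
    exact: measurable_spectral_test_indicator.
  apply: measurableT_comp => //; apply: measurable_funM => //.
  by apply: measurable_frob; exact: measurable_weighted_gram.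
rewrite -ge0_integralZl ?lee_fin ?expR_ge0//.
pose isA (u : ('I_m * 'I_n) + 'I_(n + m)) := if u is inl _ then true else false.
apply: (independent_conditional_le (J := isA) hind
  (env_measurable_block_ratio l sig x0 th1 th2)).
- by move=> x; exact: block_ratio_ge0.
- by apply: emeasurable_funM.
move=> o; set A := \matrix_(i, p) h (inl (i, p)) o.
have AE o' : block_sensing (fun u => if isA u then h u o else h u o') = A.
  by apply/matrixP => i p; rewrite !mxE.
rewrite /block_ratio.
have [tA|tA] : spectral_test (lattice_net n) (spectral_threshold m n) A \/
    ~~ spectral_test (lattice_net n) (spectral_threshold m n) A.
  by case: spectral_test; [left|right].
2: {
  under eq_integral => o' _ do rewrite AE (negbTE tA) mul0r.
  by rewrite integral0 /G -/A (negbTE tA) mul0r mule0. }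
have opA := lattice_netP thr0 tA.
under eq_integral => o' _ do rewrite AE tA mul1r /block_observation AE /=.
rewrite /G -/A tA mul1r -EFinM -expRD addrC.
have gind : independent_family P (fun k : 'I_(n + m) => h (inr k)).
  by apply: (independent_family_comp (f := inr)) hind => ? ? [].
apply: (le_trans (score_diff_exp gind hw hz t0 opA b0 x0b thb l0 small)).
rewrite lee_fin ler_expR lerD2l ler_wpM2l//; first by rewrite mulr_ge0.
apply: (le_trans (sqnorm_weighted_gram_le _ t0 opA)).
by rewrite ler_wpM2l ?sqr_ge0//; apply: ler_sum => i _; rewrite !mxE.
Qed.

(** With l = c0 / s^2 every smallness condition of the previous lemmas becomes a
    bound on c0 alone, because m, n and sig^2 are at most s; [q] collects them. *)
Lemma block_ratio_bound (b : R) : 0 <= b -> exists c0 kap C : R,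
  [/\ 0 < c0, 0 < kap, 0 <= C &
  forall d (Omega : measurableType d) (P : probability Omega R) m n (sig : R)
    (h : ('I_m * 'I_n) + 'I_(n + m) -> Omega -> R) (x0 : 'cV[R]_n)
    (th1 th2 : 'rV[R]_n) (s : R),
  gaussian_block P sig h -> (forall i, `|x0 i 0| <= b) ->
  (forall i, `|th1 0 i - th2 0 i| <= b ^+ 2) ->
  (0 < m)%N -> m%:R <= s -> n%:R <= s -> sig ^+ 2 <= s ->
  (\int[P]_o (block_ratio (c0 / s ^+ 2) sig x0 th1 th2 (fun u => h u o))%:E <=
   (expR (- (kap * m%:R ^+ 2 / s ^+ 2 * \sum_i (th1 0 i - th2 0 i) ^+ 2) +
     C * \sum_i (th2 0 i - x0 i 0 ^+ 2) ^+ 2))%:E)%E].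
Proof.
move=> b0; have [c1 [K1 [c1p K10 signal]]] := signal_exp.
have [M [M0 M1024]] : exists M : R, 0 <= M /\ M = 1024.
  by exists 1024; split; [exact: ler0n|exact: erefl].
have [B [B0 BE]] : exists B : R, 0 <= B /\ B = b ^+ 2.
  by exists (b ^+ 2); split => //; exact: sqr_ge0.
(* 4 * spectral_threshold m n <= 4 * 128 * (s + s) = M * s *)
pose q1 := 48 * (M * B + 1) ^+ 2.
pose q2 := 4 * (B ^+ 2 * M).
pose q3 := K1 * B ^+ 2.
have BB0 : 0 <= B ^+ 2 by exact: sqr_ge0.
have q1_0 : 0 <= q1 by apply: mulr_ge0; [exact: ler0n|exact: sqr_ge0].
have q2_0 : 0 <= q2.
  by apply: mulr_ge0; [exact: ler0n|exact: mulr_ge0].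
have q3_0 : 0 <= q3 by exact: mulr_ge0.
pose q := q1 + q2 + q3 + 1.
have qp : 0 < q by rewrite /q; lra.
pose c0 := q^-1.
have c0p : 0 < c0 by rewrite invr_gt0.
have cq : c0 * q = 1 by rewrite mulVf// gt_eqF.
have cle r : r <= q -> c0 * r <= 1.
  by move=> rq; rewrite -cq ler_wpM2l// ltW.
exists c0, (c1 * c0 / 4), (2 * (c0 * M ^+ 2)); split => //.
- by rewrite divr_gt0 ?ltr0n// mulr_gt0.
- by apply: mulr_ge0; [exact: ler0n|apply: mulr_ge0; [exact: ltW|exact: sqr_ge0]].
move=> d Omega P m n sig h x0 th1 th2 s hblock x0b thb m0 ms ns sigs.
have [hind hA hw hz] := hblock.
have m1 : 1 <= m%:R :> R by rewrite ler1n.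
have s1 : 1 <= s by exact: le_trans ms.
have sp : 0 < s by exact: lt_le_trans s1.
have s2p : 0 < s ^+ 2 by rewrite exprn_gt0.
have s2s : s <= s ^+ 2 by rewrite expr2 ler_peMr// ltW.
pose l := c0 / s ^+ 2.
have lp : 0 < l by rewrite divr_gt0.
have l0 := ltW lp.
have ls : l * s ^+ 2 = c0 by rewrite divfK// gt_eqF.
have lsle r : r <= s ^+ 2 -> l * r <= c0 by move=> rs; rewrite -ls ler_wpM2l.
have n0 : 0 <= n%:R :> R by exact: ler0n.
have thr0 : 0 <= spectral_threshold m n :> R.
  by apply: mulr_ge0; [exact: ler0n|exact: addr_ge0].
pose t : R := 4 * spectral_threshold m n.
have t0 : 0 <= t by apply: mulr_ge0 => //; exact: ler0n.
have ts : t <= M * s by rewrite /t /spectral_threshold M1024; lra.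
have small : 48 * l * (b ^+ 2 * t + sig ^+ 2) ^+ 2 <= 1.
  apply: le_trans (cle q1 _); last by rewrite /q; lra.
  rewrite -BE.
  have H : B * t + sig ^+ 2 <= (M * B + 1) * s.
    by have := ler_wpM2l B0 ts; lra.
  have H2 : (B * t + sig ^+ 2) ^+ 2 <= ((M * B + 1) * s) ^+ 2.
    rewrite lerXn2r ?nnegrE//.
      by apply: addr_ge0; [exact: mulr_ge0|exact: sqr_ge0].
    by apply: mulr_ge0; [apply: addr_ge0 => //; exact: mulr_ge0|exact: ltW].
  have H3 : l * ((M * B + 1) * s) ^+ 2 = c0 * (M * B + 1) ^+ 2 by rewrite -ls; ring.
  by have := ler_wpM2l l0 H2; rewrite H3 /q1 -!mulrA; lra.
apply: (le_trans (block_ratio_conditional hblock b0 x0b thb l0 small)).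
rewrite -/t; set eta := \sum_i (th2 0 i - x0 i 0 ^+ 2) ^+ 2.
have eta0 : 0 <= eta by apply: sumr_ge0 => i _; exact: sqr_ge0.
have aind : independent_family P (fun u => h (inl u)).
  by apply: (independent_family_comp (f := inl)) hind => ? ? [].
pose de := th1 - th2.
have deE i : de 0 i = th1 0 i - th2 0 i by rewrite !mxE.
have deb p : `|de 0 p| <= B by rewrite deE BE.
have SdeE : \sum_i (th1 0 i - th2 0 i) ^+ 2 = \sum_i de 0 i ^+ 2.
  by apply: eq_bigr => i _; rewrite deE.
rewrite SdeE; set Q := \sum_i de 0 i ^+ 2.
have l40 : 0 <= l / 4 by apply: divr_ge0 => //; exact: ler0n.
have netP (A : 'M[R]_(m, n)) : spectral_test (lattice_net n)
    (spectral_threshold m n) A -> op_bounded A t by exact: lattice_netP.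
have small1 : 16 * (l / 4 * (B ^+ 2 * t)) <= 1.
  apply: le_trans (cle q2 _); last by rewrite /q; lra.
  have h1 : l * t <= M * c0.
    have := ler_wpM2l l0 ts; have := ler_wpM2l M0 (lsle s s2s); lra.
  by have := ler_wpM2l BB0 h1; rewrite /q2; lra.
have small2 : 16 * (l / 4 * (m%:R * B ^+ 2)) <= 1.
  apply: le_trans (cle q2 _); last by rewrite /q; lra.
  have h1 : l * m%:R <= M * c0.
    have h1 : l * m%:R <= c0 by apply: lsle; exact: le_trans s2s.
    by rewrite M1024; lra.
  by have := ler_wpM2l BB0 h1; rewrite /q2; lra.
have small3 : K1 * (l / 4 * (n%:R * B) ^+ 2) <= 1.
  apply: le_trans (cle q3 _); last by rewrite /q; lra.
  have h1 : l * n%:R ^+ 2 <= c0.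
    by apply: lsle; rewrite lerXn2r ?nnegrE// ltW.
  have h2 := ler_wpM2l q3_0 h1.
  have q3c : 0 <= q3 * c0 by apply: mulr_ge0 => //; exact: ltW.
  by move: h2 q3c; rewrite /q3; lra.
have H := signal _ _ _ _ _ _ _ _ _ _ _ _ aind hA netP t0 deb l40 small1 small2 small3 m0.
apply: (@le_trans _ _ ((expR (2 * l * (t ^+ 2 * eta)))%:E *
   (expR (- (c1 * (l / 4 * m%:R ^+ 2 * Q))))%:E)%E).
  by apply: lee_wpmul2l H; rewrite lee_fin expR_ge0.
rewrite -EFinM -expRD lee_fin ler_expR addrC.
have -> : c1 * (l / 4 * m%:R ^+ 2 * Q) = c1 * c0 / 4 * m%:R ^+ 2 / s ^+ 2 * Q.
  by rewrite /l; field; rewrite gt_eqF.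
rewrite lerD2l.
have H2 : l * t ^+ 2 <= c0 * M ^+ 2.
  have : t ^+ 2 <= (M * s) ^+ 2.
    by rewrite lerXn2r ?nnegrE//; apply: mulr_ge0 => //; exact: ltW.
  have H3 : l * (M * s) ^+ 2 = c0 * M ^+ 2 by rewrite -ls; ring.
  by move=> /(ler_wpM2l l0); rewrite H3.
by have := ler_wpM2r eta0 H2; lra.
Qed.

End block_bound.

(** * The observation model as an independent family *)

Section model_family.
Context {R : realType} {d : measure_display} {Omega : measurableType d}.
Variable P : probability Omega R.

(** An event on the entries of [X] belongs to the sigma-algebra generated by the
    matrix, to which the independence of the blocks applies. *)
Lemma iid_entries_event (s : R) (p q : nat) (X : Omega -> 'M[R]_(p, q))
    (B : 'I_p * 'I_q -> set R) :
  iid_normal_entries P s X -> (forall ij, measurable (B ij)) ->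
  sigma_of X (\bigcap_ij [set x | B ij (X x ij.1 ij.2)]) /\
  P (\bigcap_ij [set x | B ij (X x ij.1 ij.2)]) =
    (\prod_ij P [set x | B ij (X x ij.1 ij.2)])%E.
Proof.
move=> [_ indX] mB; split.
  exists (\bigcap_ij [set M : 'M[R]_(p, q) | B ij (M ij.1 ij.2)]); last first.
    by rewrite setTI; apply/seteqP; split => x.
  apply: fin_bigcap_measurable => // -[i j] _ /=.
  by have := @measurable_mx_coord R p q i j measurableT _ (mB (i, j)); rewrite setTI.
have := indX [set: 'I_p * 'I_q]%SET (fun ij => [set x | B ij (X x ij.1 ij.2)]).
move=> H; transitivity (P (\bigcap_(ij in [set` [set: 'I_p * 'I_q]%SET])
    [set x | B ij (X x ij.1 ij.2)])).
  by congr (P _); apply/seteqP; split => x Bx ij _; apply: Bx => //=; rewrite inE.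
rewrite H; first by apply: eq_bigl => ij; rewrite inE.
by move=> ij _; exists (B ij) => //; rewrite setTI.
Qed.

Context {m n L : nat} {sig : R}.
Variables (A : 'I_L -> {RV P >-> 'M[R]_(m, n)})
          (w : 'I_L -> {RV P >-> 'cV[R]_n})
          (z : 'I_L -> {RV P >-> 'cV[R]_m}).
Hypothesis model : gaussian_model sig A w z.
Notation U := (('I_m * 'I_n) + 'I_(n + m))%type.

(** All the scalar randomness of the model; the second component indexes one
    block in the order expected by [block_observation]. *)
Definition model_entry (lu : 'I_L * U) (x : Omega) : R :=
  match lu.2 with
  | inl ip => A lu.1 x ip.1 ip.2
  | inr k => col_mx (w lu.1 x) (z lu.1 x) k 0
  end.

Let entry_w l i x : model_entry (l, inr (lshift m i)) x = w l x i 0.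
Proof. by rewrite /model_entry /= col_mxEu. Qed.

Let entry_z l i x : model_entry (l, inr (rshift n i)) x = z l x i 0.
Proof. by rewrite /model_entry /= col_mxEd. Qed.

Let measurable_RV p q (X : {RV P >-> 'M[R]_(p, q)}) i j :
  measurable_fun setT (fun x => X x i j).
Proof. exact: (measurableT_comp (@measurable_mx_coord R p q i j) (measurable_funPT X)). Qed.

Lemma measurable_model_entry lu : measurable_fun setT (model_entry lu).
Proof.
case: lu => l [[i p]|k]; first exact: (measurable_RV (A l) i p).
rewrite /model_entry /=; case: (split_ordP k) => j ->.
  by under eq_fun do rewrite col_mxEu; exact: measurable_RV.
by under eq_fun do rewrite col_mxEd; exact: measurable_RV.
Qed.

(** Independence between the matrices, then within each of them. *)
Lemma independent_model_entry : independent_family P model_entry.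
Proof.
split; first exact: measurable_model_entry.
move=> B mB.
pose E (i : 'I_L + 'I_L + 'I_L) : set Omega := match i with
  | inl (inl l) => \bigcap_ij [set x | B (l, inl ij) (A l x ij.1 ij.2)]
  | inl (inr l) => \bigcap_ij [set x | B (l, inr (lshift m ij.1)) (w l x ij.1 ij.2)]
  | inr l => \bigcap_ij [set x | B (l, inr (rshift n ij.1)) (z l x ij.1 ij.2)]
  end.
have EA l := iid_entries_event (B := fun ij => B (l, inl ij)) (model_A model l)
  (fun ij => mB _).
have Ew l := iid_entries_event (B := fun ij => B (l, inr (lshift m ij.1)))
  (model_w model l) (fun ij => mB _).
have Ez l := iid_entries_event (B := fun ij => B (l, inr (rshift n ij.1)))
  (model_z model l) (fun ij => mB _).
have indE := model_indep model (J := [set: _]%SET) (E := E).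
transitivity (P (\bigcap_(i in [set` [set: 'I_L + 'I_L + 'I_L]%SET]) E i)).
  congr (P _); apply/seteqP; split => x Bx.
    move=> [[l|l]|l] _ [i j] _ /=.
    - exact: (Bx (l, inl (i, j))).
    - by have := Bx (l, inr (lshift m i)) I; rewrite /= entry_w (ord1 j).
    - by have := Bx (l, inr (rshift n i)) I; rewrite /= entry_z (ord1 j).
  move=> [l [[i p]|k]] _ /=.
    by apply: (Bx (inl (inl l)) _ (i, p)) => //=; rewrite inE.
  case: (split_ordP k) => j ->.
    by rewrite entry_w; apply: (Bx (inl (inr l)) _ (j, ord0)) => //=; rewrite inE.
  by rewrite entry_z; apply: (Bx (inr l) _ (j, ord0)) => //=; rewrite inE.
rewrite indE; last first.
  move=> [[l|l]|l] _; [exact: (EA l).1|exact: (Ew l).1|exact: (Ez l).1].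
under eq_bigl => i do rewrite inE.
rewrite big_sumType big_sumType /= -!big_split /=.
transitivity (\prod_l \prod_u P (model_entry (l, u) @^-1` B (l, u)))%E; last first.
  by rewrite pair_bigA; apply: eq_bigr => -[].
apply: eq_bigr => l _; rewrite big_sumType big_split_ord /= -muleA.
congr (_ * (_ * _))%E; first exact: (EA l).2.
  rewrite (Ew l).2 -(pair_bigA _ (fun i j => P [set x | B (l, inr (lshift m i)) (w l x i j)])) /=.
  apply: eq_bigr => i _; rewrite big_ord1; congr (P _).
  by apply/seteqP; split => x; rewrite /= entry_w.
rewrite (Ez l).2 -(pair_bigA _ (fun i j => P [set x | B (l, inr (rshift n i)) (z l x i j)])) /=.
apply: eq_bigr => i _; rewrite big_ord1; congr (P _).
by apply/seteqP; split => x; rewrite /= entry_z.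
Qed.

Lemma gaussian_block_model l : gaussian_block P sig (fun u => model_entry (l, u)).
Proof.
split.
- by apply: (independent_family_comp (f := pair l)) independent_model_entry => ? ? [].
- move=> [i p]; split; first exact: measurable_model_entry.
  by move=> B mB; exact: (model_A model l).1.
- move=> i; split; first exact: measurable_model_entry.
  move=> B mB; rewrite -((model_w model l).1 i ord0 B mB).
  by congr (P _); apply/seteqP; split => x; rewrite /= entry_w.
- move=> i; split; first exact: measurable_model_entry.
  move=> B mB; rewrite -((model_z model l).1 i ord0 B mB).
  by congr (P _); apply/seteqP; split => x; rewrite /= entry_z.
Qed.

Lemma block_sensing_model l x : block_sensing (fun u => model_entry (l, u) x) = A l x.
Proof. by apply/matrixP => i p; rewrite !mxE. Qed.

Lemma block_observation_model x0 l x :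
  block_observation x0 (fun u => model_entry (l, u) x) = observation A w z x0 l x.
Proof.
rewrite /block_observation block_sensing_model; congr (_ *m _ + _).
  by apply/colP => i; rewrite mxE entry_w.
by apply/colP => i; rewrite mxE entry_z.
Qed.

End model_family.

(** * The exponentially weighted estimator *)

Section gibbs_estimator.
Context {R : realType} {m n L N : nat}.
Notation Data := (L.-tuple 'cV[R]_m * L.-tuple 'M[R]_(m, n))%type.
Variables (sig lam : R) (c : 'I_N -> 'cV[R]_n).

Definition total_score (D : Data) (x : 'cV[R]_n) : R :=
  \sum_(l < L) score sig (tnth D.2 l) (tnth D.1 l) (sqrow x).

Definition partition_function (D : Data) : R :=
  \sum_j expR (- lam * total_score D (c j)).

(** The normalisation is inside the exponential: positivity and measurability
    follow from those of [expR] and [ln], without inverses. *)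
Definition gibbs_weight (i : 'I_N) (D : Data) : R :=
  expR (- lam * total_score D (c i) - ln (partition_function D)).

Definition gibbs_mean (D : Data) : 'cV[R]_n := \sum_i gibbs_weight i D *: c i.

Lemma measurable_gibbs_mean : measurable_fun setT gibbs_mean.
Proof.
have mscore x : measurable_fun setT (fun D => total_score D x).
  apply: measurable_sum => l; apply: measurable_score.
    exact: (measurableT_comp (measurable_tnth l) measurable_snd).
  exact: (measurableT_comp (measurable_tnth l) measurable_fst).
have mexp i : measurable_fun setT (fun D => - lam * total_score D (c i)).
  exact: measurable_funM.
apply: measurable_mxP => i j.
under eq_fun => D.
  rewrite /gibbs_mean summxE.
  under eq_bigr do rewrite mxE.
  over.
apply: measurable_sum => k; apply: measurable_funM => //.
apply: measurableT_comp => //; apply: measurable_funB => //.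
apply: measurableT_comp => //; apply: measurable_sum => k'.
exact: measurableT_comp.
Qed.

Lemma partition_function_ge D i :
  expR (- lam * total_score D (c i)) <= partition_function D.
Proof.
rewrite /partition_function (bigD1 i)//= lerDl.
by apply: sumr_ge0 => j _; exact: expR_ge0.
Qed.

(** The point [j] of comparison is arbitrary, and unknown to the estimator. *)
Lemma gibbs_weight_le D i j :
  gibbs_weight i D <= expR (- lam * (total_score D (c i) - total_score D (c j))).
Proof.
rewrite ler_expR mulrBr lerB// -ler_expR lnK ?partition_function_ge//.
by rewrite posrE (lt_le_trans _ (partition_function_ge D j))// expR_gt0.
Qed.

Lemma gibbs_weight_sum D : (0 < N)%N -> \sum_i gibbs_weight i D = 1.
Proof.
move=> N0.
have Z0 : 0 < partition_function D.
  exact: lt_le_trans (expR_gt0 _) (partition_function_ge D (Ordinal N0)).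
under eq_bigr do rewrite /gibbs_weight expRD expRN lnK//.
by rewrite -mulr_suml mulfV// gt_eqF.
Qed.

(** Jensen, one coordinate at a time. *)
Lemma sqnorm_gibbs_mean_le D x : (0 < N)%N ->
  sqnorm (gibbs_mean D - x) <= \sum_i gibbs_weight i D * sqnorm (c i - x).
Proof.
move=> N0; have p1 := gibbs_weight_sum D N0.
rewrite sqnorm_colE.
under [leRHS]eq_bigr do rewrite sqnorm_colE mulr_sumr.
rewrite [leRHS]exchange_big /=; apply: ler_sum => j _.
pose p i := gibbs_weight i D; pose e i := c i j 0 - x j 0.
have -> : (gibbs_mean D - x) j 0 = \sum_i p i * e i.
  rewrite !mxE summxE -[x j 0]mul1r -p1 mulr_suml -sumrB.
  by apply: eq_bigr => i _; rewrite mxE -mulrBr.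
under eq_bigr => i _ do rewrite (_ : (c i - x) j 0 = e i) ?mxE//.
set y := \sum_i _.
have : 0 <= \sum_i p i * (e i - y) ^+ 2.
  by apply: sumr_ge0 => i _; rewrite mulr_ge0 ?sqr_ge0// expR_ge0.
rewrite (eq_bigr (fun i => p i * e i ^+ 2 - 2 * y * (p i * e i) + y ^+ 2 * p i));
  last by (move=> i _; ring).
rewrite big_split sumrB /= -!mulr_sumr p1 -/y.
have -> : 2 * y * y = 2 * y ^+ 2 by ring.
by rewrite -/p; lra.
Qed.

End gibbs_estimator.

Lemma measurable_data {R : realType} {d} {Omega : measurableType d}
    {P : probability Omega R} {m n L} (A : 'I_L -> {RV P >-> 'M[R]_(m, n)})
    (w : 'I_L -> {RV P >-> 'cV[R]_n}) (z : 'I_L -> {RV P >-> 'cV[R]_m}) x0 :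
  measurable_fun setT (data A w z x0).
Proof.
apply: measurable_fun_pair; apply/measurable_fun_tnthP => l.
  rewrite (_ : _ \o _ = observation A w z x0 l); last first.
    by apply/funext => x /=; rewrite tnth_mktuple.
  apply: measurable_addmx; last exact: measurable_funPT.
  by apply: measurable_mulmx; [apply: measurable_mulmx => //|]; exact: measurable_funPT.
rewrite (_ : _ \o _ = A l); last by apply/funext => x /=; rewrite tnth_mktuple.
exact: measurable_funPT.
Qed.

Lemma measurable_gibbs_loss {R : realType} {d} {Omega : measurableType d}
    {P : probability Omega R} {m n L N} (A : 'I_L -> {RV P >-> 'M[R]_(m, n)})
    (w : 'I_L -> {RV P >-> 'cV[R]_n}) (z : 'I_L -> {RV P >-> 'cV[R]_m})
    sig lam (c : 'I_N -> 'cV[R]_n) x0 :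
  measurable_fun setT
    (fun x => sqnorm (gibbs_mean sig lam c (data A w z x0 x) - x0)).
Proof.
apply: measurable_frob; apply: measurable_addmx => //;
  exact: (measurableT_comp (measurable_gibbs_mean _ _ _) (measurable_data A w z x0)).
Qed.

Lemma sqnorm_box_le {R : realType} n (x y : 'cV[R]_n) (b : R) : 0 <= b ->
  (forall i, 0 <= x i 0 <= b) -> (forall i, 0 <= y i 0 <= b) ->
  sqnorm (x - y) <= n%:R * b ^+ 2.
Proof.
move=> b0 xb yb; rewrite sqnorm_colE mulr_natl -[n in leRHS]card_ord -sumr_const.
apply: ler_sum => j _; rewrite !mxE -[leLHS]real_normK ?num_real//.
rewrite lerXn2r ?nnegrE// ler_norml.
by have /andP[h1 h2] := xb j; have /andP[h3 h4] := yb j; lra.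
Qed.

(** [c i0] is the comparison point.  Candidates with |c^2 - c0^2|^2 < r
    contribute at most rho; the total weight of the others is at most the sum of
    their ratios if all the sensing matrices pass the spectral test, and at most
    1 otherwise. *)
Lemma gibbs_risk {R : realType} (b : R) : 0 <= b -> exists c0 kap C : R,
  [/\ 0 < c0, 0 < kap, 0 <= C &
  forall d (Omega : measurableType d) (P : probability Omega R) m n L N (sig : R)
    (A : 'I_L -> {RV P >-> 'M[R]_(m, n)}) (w : 'I_L -> {RV P >-> 'cV[R]_n})
    (z : 'I_L -> {RV P >-> 'cV[R]_m}) (c : 'I_N -> 'cV[R]_n) (x0 : 'cV[R]_n)
    (i0 : 'I_N) (s r rho : R),
  gaussian_model sig A w z ->
  (forall i j, 0 <= c i j 0 <= b) -> (forall j, 0 <= x0 j 0 <= b) ->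
  (0 < m)%N -> m%:R <= s -> n%:R <= s -> sig ^+ 2 <= s -> 0 <= rho ->
  (forall i, \sum_j (c i j 0 ^+ 2 - c i0 j 0 ^+ 2) ^+ 2 < r ->
     sqnorm (c i - x0) <= rho) ->
  (\int[P]_x (sqnorm (gibbs_mean sig (c0 / s ^+ 2) c (data A w z x0 x) - x0))%:E <=
   (rho + n%:R * b ^+ 2 * (L%:R * expR (- (2 * n%:R)) + N%:R *
     expR (L%:R * (- (kap * m%:R ^+ 2 / s ^+ 2 * r) +
       C * \sum_j (c i0 j 0 ^+ 2 - x0 j 0 ^+ 2) ^+ 2))))%:E)%E].
Proof.
move=> b0; have [c0 [kap [C [c0p kapp C0 ratio]]]] := @block_ratio_bound R b b0.
exists c0, kap, C; split => //.
move=> d Omega P m n L N sig A w z c x0 i0 s r rho model cb x0b m0 ms ns sigs rho0 near.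
set lam := c0 / s ^+ 2.
have sp : 0 < s by apply: lt_le_trans ms; rewrite ltr0n.
have N0 : (0 < N)%N by exact: leq_ltn_trans (ltn_ord i0).
pose g := model_entry A w z.
have gind : independent_family P g := independent_model_entry model.
have [mg _] := gind.
pose far i := ~~ (\sum_j (c i j 0 ^+ 2 - c i0 j 0 ^+ 2) ^+ 2 < r).
pose test l x : bool := spectral_test (lattice_net n) (spectral_threshold m n) (A l x).
pose br i l x := block_ratio lam sig x0 (sqrow (c i)) (sqrow (c i0)) (fun u => g (l, u) x).
have brE i l x : br i l x = (test l x)%:R *
    expR (- lam * (score sig (A l x) (observation A w z x0 l x) (sqrow (c i)) -
                   score sig (A l x) (observation A w z x0 l x) (sqrow (c i0)))).
  by rewrite /br /block_ratio /g block_sensing_model block_observation_model.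
pose bad x : R := \sum_l (~~ test l x)%:R.
pose gap x : R := \sum_(i | far i) \prod_l br i l x.
set K := n%:R * b ^+ 2.
have K0 : 0 <= K by rewrite mulr_ge0 ?sqr_ge0.
have br0 i l x : 0 <= br i l x by exact: block_ratio_ge0.
have bad0 x : 0 <= bad x by apply: sumr_ge0.
have gap0 x : 0 <= gap x by apply: sumr_ge0 => i _; apply: prodr_ge0.
have mtest l : measurable_fun setT (fun x => (~~ test l x)%:R : R).
  have mA : measurable_fun setT (A l) by exact: measurable_funPT.
  have := measurable_spectral_test_indicator (lattice_net n) (spectral_threshold m n) mA.
  move=> mt; rewrite (_ : (fun _ => _) = (fun x => 1 - (test l x)%:R)).
    exact: measurable_funB.
  by apply/funext => x; case: (test l x); rewrite ?subrr ?subr0.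
have mbr i l : measurable_fun setT (br i l).
  by apply: env_measurable_block_ratio => u; exact: mg.
have mprod i : measurable_fun setT (fun x => \prod_l br i l x).
  exact: measurable_prod.
have mbad : measurable_fun setT bad by exact: measurable_sum.
have mgap : measurable_fun setT gap.
  rewrite /gap; under eq_fun do rewrite -big_filter; exact: measurable_sum.
have pointwise x : sqnorm (gibbs_mean sig lam c (data A w z x0 x) - x0) <=
    rho + K * (bad x + gap x).
  set D := data A w z x0 x.
  apply: (le_trans (sqnorm_gibbs_mean_le sig lam c D x0 N0)).
  pose p i := gibbs_weight sig lam c i D.
  have p0 i : 0 <= p i by exact: expR_ge0.
  have p1 : \sum_i p i = 1 by exact: gibbs_weight_sum.
  have pfar : \sum_(i | far i) p i <= bad x + gap x.
    have [/forallP tx|] := boolP [forall l, test l x].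
      apply: le_trans (_ : gap x <= _); last by rewrite lerDr.
      apply: ler_sum => i _; apply: (le_trans (gibbs_weight_le sig lam c D i i0)).
      rewrite /total_score -sumrB mulr_sumr expR_sum; apply: ler_prod => l _.
      by rewrite expR_ge0 brE tx mul1r /D /data /= !tnth_mktuple lexx.
    rewrite negb_forall => /existsP[l tl].
    apply: (@le_trans _ _ 1).
      by rewrite -p1 [leRHS](bigID far) /= lerDl; apply: sumr_ge0.
    rewrite -[1]addr0 lerD// /bad (bigD1 l)//= tl lerDl.
    exact: sumr_ge0.
  have Dle i : sqnorm (c i - x0) <= K.
    exact: sqnorm_box_le.
  apply: (@le_trans _ _ (\sum_i p i * rho + \sum_(i | far i) K * p i)).
    rewrite [X in _ + X]big_mkcond -big_split /=; apply: ler_sum => i _; rewrite -/(p i).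
    have [fi|/negPn ni] := boolP (far i).
      by rewrite ler_wpDl ?mulr_ge0// mulrC ler_wpM2r.
    by rewrite addr0 ler_wpM2l// near.
  by rewrite -mulr_suml p1 mul1r lerD2l -mulr_sumr ler_wpM2l.
have intbad : (\int[P]_x (bad x)%:E <= (L%:R * expR (- (2 * n%:R)))%:E)%E.
  under eq_integral do rewrite /bad -sumEFin.
  rewrite ge0_integral_sum//; last first.
    by move=> l; apply/measurable_EFinP; exact: mtest.
  rewrite mulr_natl -[L in leRHS]card_ord -sumr_const -sumEFin; apply: lee_sum => l _.
  have [hind hA _ _] := gaussian_block_model model l.
  have aind : independent_family P (fun u => model_entry A w z (l, inl u)).
    by apply: (independent_family_comp (f := inl)) hind => ? ? [].
  refine (le_trans _ (spectral_test_tail aind hA)).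
  rewrite le_eqVlt; apply/orP; left; apply/eqP/eq_integral => x _.
  have -> : \matrix_(i, q) model_entry A w z (l, inl (i, q)) x = A l x.
    by apply/matrixP => i q; rewrite mxE.
  by [].
have intgap : (\int[P]_x (gap x)%:E <= (N%:R *
     expR (L%:R * (- (kap * m%:R ^+ 2 / s ^+ 2 * r) +
       C * \sum_j (c i0 j 0 ^+ 2 - x0 j 0 ^+ 2) ^+ 2)))%:E)%E.
  set e := _ + C * _.
  under eq_integral do rewrite /gap -big_filter -sumEFin.
  rewrite ge0_integral_sum//; [|by move=> i; apply/measurable_EFinP|
    by move=> i x _; rewrite lee_fin prodr_ge0].
  rewrite big_filter.
  apply: (@le_trans _ _ (\sum_(i | far i) (expR (L%:R * e))%:E)%E).
    apply: lee_sum => i fi.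
    have := @independent_prod_le R _ _ P _ _ g
      (fun=> block_ratio lam sig x0 (sqrow (c i)) (sqrow (c i0))) (fun=> expR e) gind.
    rewrite prodr_const card_ord -expRM_natl; apply => //.
    - by move=> _; exact: env_measurable_block_ratio.
    - by move=> _ x; exact: block_ratio_ge0.
    move=> l; apply: (le_trans (ratio _ _ _ _ _ _ _ _ _ _ s (gaussian_block_model model l)
      _ _ m0 ms ns sigs)).
    - by move=> j; have /andP[h1 h2] := x0b j; rewrite ger0_norm.
    - move=> j; rewrite !mxE ler_norml.
      have /andP[h1 h2] := cb i j; have /andP[h3 h4] := cb i0 j.
      have : c i j 0 ^+ 2 <= b ^+ 2 by rewrite lerXn2r ?nnegrE.
      have : c i0 j 0 ^+ 2 <= b ^+ 2 by rewrite lerXn2r ?nnegrE.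
      have := sqr_ge0 (c i j 0); have := sqr_ge0 (c i0 j 0); lra.
    rewrite lee_fin ler_expR /e.
    have -> : \sum_j (sqrow (c i) 0 j - sqrow (c i0) 0 j) ^+ 2 =
        \sum_j (c i j 0 ^+ 2 - c i0 j 0 ^+ 2) ^+ 2.
      by apply: eq_bigr => j _; rewrite !mxE.
    have -> : \sum_j (sqrow (c i0) 0 j - x0 j 0 ^+ 2) ^+ 2 =
        \sum_j (c i0 j 0 ^+ 2 - x0 j 0 ^+ 2) ^+ 2.
      by apply: eq_bigr => j _; rewrite !mxE.
    rewrite lerD2r lerN2 ler_wpM2l//; last by rewrite leNgt.
    apply: divr_ge0; last exact: sqr_ge0.
    by apply: mulr_ge0; [exact: ltW|exact: sqr_ge0].
  rewrite sumEFin lee_fin sumr_const -[leLHS]mulr_natl ler_wpM2r ?expR_ge0//.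
  by rewrite ler_nat -[N in leqRHS]card_ord max_card.
apply: (@le_trans _ _ (\int[P]_x (rho + K * (bad x + gap x))%:E)%E).
  apply: ge0_le_integral => //.
  - by move=> x _; rewrite lee_fin sqnorm_ge0.
  - by apply/measurable_EFinP; exact: measurable_gibbs_loss.
  - by apply/measurable_EFinP; apply: measurable_funD => //; apply: measurable_funM => //;
      exact: measurable_funD.
  - by move=> x _; rewrite lee_fin.
under eq_integral do rewrite EFinD (EFinM K) (EFinD (bad _)).
rewrite ge0_integralD//=; first last.
- apply: emeasurable_funM => //; apply: emeasurable_funD; exact/measurable_EFinP.
- by move=> x _; rewrite -EFinD -EFinM lee_fin mulr_ge0// addr_ge0.
rewrite integral_probability_cst ge0_integralZl//; first last.
- by move=> x _; rewrite -EFinD lee_fin addr_ge0.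
- by apply: emeasurable_funD; exact/measurable_EFinP.
rewrite ge0_integralD//; try exact/measurable_EFinP; try by move=> x _; rewrite lee_fin.
rewrite [leRHS]EFinD leeD2l// (EFinM K) lee_wpmul2l// EFinD.
exact: leeD.
Qed.

(** * Nets of the signal class *)

Section signal_nets.
Context {R : realType}.

Lemma sqnormB_le n (x y : 'cV[R]_n) : sqnorm (x - y) <= 2 * sqnorm x + 2 * sqnorm y.
Proof. by have := sqnorm_ge0 (x + y); rewrite sqnormB sqnormD; lra. Qed.

Lemma sqnormD_le n (x y : 'cV[R]_n) : sqnorm (x + y) <= 2 * sqnorm x + 2 * sqnorm y.
Proof. by have := sqnorm_ge0 (x - y); rewrite sqnormB sqnormD; lra. Qed.

Lemma l2norm_sqr n (x : 'cV[R]_n) : l2norm x ^+ 2 = sqnorm x.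
Proof.
rewrite /l2norm sqr_sqrtr ?sqnorm_colE//.
by apply: sumr_ge0 => i _; exact: sqr_ge0.
Qed.

(** The centers of a cover need not lie in the class.  Replacing each useful one
    by a point of the class doubles the radius; the factor 2 in the cardinality
    turns the infimum that defines the covering number into an actual cover. *)
Lemma signal_class_net n (x_min x_max a b : R) k (S : set 'cV[R]_n) (e : R) :
  signal_class x_min x_max a b k S -> 0 < e -> e <= a * n%:R `^ b ->
  exists N (c : 'I_N -> 'cV[R]_n),
    [/\ N%:R <= 2 * (a * n%:R `^ b / e) ^+ k, forall i, S (c i) &
        forall x, S x -> exists i, sqnorm (c i - x) <= 4 * e ^+ 2].
Proof.
move=> [[s0 Ss0] _ cov] e0 ea; set V := (_ / e) ^+ k.
have V1 : 1 <= V by rewrite exprn_ege1// ler_pdivlMr// mul1r.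
have : (covering_number S e < (2 * V)%:E)%E.
  by apply: (le_lt_trans (cov e e0 ea)); rewrite lte_fin -/V; lra.
move=> /ereal_inf_lt[_ [N [c cS] <-]]; rewrite lte_fin => NV.
have /choice[c' c'P] : forall i, exists y, S y /\
    ((exists2 z, S z & l2ball (c i) e z) -> l2ball (c i) e y).
  move=> i; have [[z Sz cz]|no] := pselect (exists2 z, S z & l2ball (c i) e z).
    by exists z.
  by exists s0; split => // /no.
exists N, c'; split; [exact: ltW|by move=> i; case: (c'P i)|].
move=> x Sx; have [i _ cx] := cS x Sx; exists i.
have [_ /(_ (ex_intro2 _ _ x Sx cx)) cc'] := c'P i.
have ball y : l2ball (c i) e y -> sqnorm (y - c i) <= e ^+ 2.
  move=> ye; rewrite -l2norm_sqr lerXn2r ?nnegrE ?(ltW e0)// /l2norm sqrtr_ge0//.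
have -> : c' i - x = (c' i - c i) - (x - c i) by rewrite opprB addrA subrK.
apply: (le_trans (sqnormB_le _ _)).
by have := ball _ cc'; have := ball _ cx; lra.
Qed.

(** x^2 - y^2 = (x - y) (x + y): positivity of the coordinates makes the signal
    recoverable from its squares, at the cost of 1 / u^2. *)
Lemma sum_sqr_gap_ge n (x y : 'cV[R]_n) (u : R) : 0 <= u ->
  (forall i, u <= x i 0) -> (forall i, u <= y i 0) ->
  4 * u ^+ 2 * sqnorm (x - y) <= \sum_i (x i 0 ^+ 2 - y i 0 ^+ 2) ^+ 2.
Proof.
move=> u0 ux uy; rewrite sqnorm_colE mulr_sumr; apply: ler_sum => i _.
rewrite !mxE subr_sqr exprMn mulrC ler_wpM2l ?sqr_ge0//.
rewrite (_ : 4 * u ^+ 2 = (2 * u) ^+ 2); last by ring.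
have := ux i; have := uy i => h1 h2.
by rewrite lerXn2r ?nnegrE; lra.
Qed.

Lemma sum_sqr_gap_le n (x y : 'cV[R]_n) (u : R) :
  (forall i, 0 <= x i 0 <= u) -> (forall i, 0 <= y i 0 <= u) ->
  \sum_i (x i 0 ^+ 2 - y i 0 ^+ 2) ^+ 2 <= 4 * u ^+ 2 * sqnorm (x - y).
Proof.
move=> ux uy; rewrite sqnorm_colE mulr_sumr; apply: ler_sum => i _.
rewrite !mxE subr_sqr exprMn mulrC ler_wpM2r ?sqr_ge0//.
rewrite (_ : 4 * u ^+ 2 = (2 * u) ^+ 2); last by ring.
have /andP[h1 h2] := ux i; have /andP[h3 h4] := uy i.
by rewrite lerXn2r ?nnegrE; lra.
Qed.

(** e <= 4, from e^(-1/2) >= 1/2. *)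
Lemma ln_nat_ge1 n : (3 < n)%N -> 1 <= ln n%:R :> R.
Proof.
move=> n3; have n0 : 0 < n%:R :> R by rewrite ltr0n (leq_trans _ n3).
rewrite -ler_expR lnK ?posrE//; apply: (@le_trans _ _ 4); last by rewrite ler_nat.
have h : (2^-1 : R) <= expR (- 2^-1) by have := expR_ge1Dx (- 2^-1 : R); lra.
have h2 : expR (- 2^-1 : R) * expR 2^-1 = 1 by rewrite -expRD addNr expR0.
have h3 : expR (2^-1 : R) * expR 2^-1 = expR 1 by rewrite -expRD; congr expR; lra.
have h4 := expR_gt0 (2^-1 : R); rewrite -h3; nra.
Qed.

Lemma exprn_le_expR (N : nat) (x : R) : (0 < N)%N -> 0 <= x ->
  x ^+ N <= N%:R ^+ N * expR x.
Proof.
move=> N0 x0; have Np : 0 < N%:R :> R by rewrite ltr0n.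
have -> : expR x = expR (x / N%:R) ^+ N.
  by rewrite -expRM_natl mulrCA mulfV ?mulr1 ?gt_eqF.
rewrite -exprMn lerXn2r ?nnegrE ?mulr_ge0 ?expR_ge0//.
rewrite mulrC -ler_pdivrMr//.
by have := expR_ge1Dx (x / N%:R); lra.
Qed.

End signal_nets.

Section rates.
Context {R : realType}.

(** For a radius e0 / n^3 with e0 constant, the log-cardinality of the net is
    O(k ln n), as ln n >= 1 absorbs the constants. *)
Lemma net_entropy (a b e0 : R) (n k N : nat) :
  0 < e0 -> e0 <= a -> 0 <= b -> (3 < n)%N -> (0 < k)%N ->
  N%:R <= 2 * (a * n%:R `^ b / (e0 / n%:R ^+ 3)) ^+ k ->
  N%:R <= expR ((ln (2 * (a / e0)) + b + 3) * (k%:R * ln n%:R)).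
Proof.
move=> e0p ea b0 n3 k0 HN; have ell1 := @ln_nat_ge1 R n n3.
have np : 0 < n%:R :> R by rewrite ltr0n (leq_trans _ n3).
have ap : 0 < a by exact: lt_le_trans ea.
have q1 : 1 <= a / e0 by rewrite ler_pdivlMr// mul1r.
apply: (le_trans HN); set Y' := n%:R `^ b.
have Yp : 0 < Y' by exact: powR_gt0.
have -> : a * Y' / (e0 / n%:R ^+ 3) = (a / e0) * (Y' * n%:R ^+ 3).
  by field; rewrite !gt_eqF// exprn_gt0.
set Z := a / e0 * _.
have Zp : 0 < Z.
  by apply: mulr_gt0; [exact: divr_gt0|apply: mulr_gt0 => //; exact: exprn_gt0].
apply: (@le_trans _ _ ((2 * Z) ^+ k)).
  rewrite [leRHS]exprMn ler_wpM2r//; first by rewrite exprn_ge0// ltW.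
  by rewrite -[leLHS]expr1 ler_weXn2l// ler1n.
have -> : 2 * Z = expR (ln (2 * Z)) by rewrite lnK// posrE mulr_gt0.
rewrite -expRM_natl ler_expR [leRHS]mulrCA ler_wpM2l//.
have -> : ln (2 * Z) = ln (2 * (a / e0)) + b * ln n%:R + 3 * ln n%:R.
  have Xp : 0 < 2 * (a / e0) by rewrite mulr_gt0// (lt_le_trans ltr01).
  have -> : 2 * Z = 2 * (a / e0) * Y' * n%:R ^+ 3 by rewrite /Z !mulrA.
  rewrite lnM; [|by rewrite posrE mulr_gt0|by rewrite posrE exprn_gt0].
  rewrite lnM; [|by rewrite posrE|by rewrite posrE].
  by rewrite /Y' ln_powR lnXn// -[_ *+ 3]mulr_natl.
have l0 : 0 <= ln (2 * (a / e0)) by apply: ln_ge0; lra.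
by have := ler_wpM2l l0 ell1; lra.
Qed.

Lemma sqr_max3 (x y z : R) : 0 <= x -> 0 <= y -> 0 <= z ->
  Num.max (Num.max x y) z ^+ 2 = Num.max (Num.max (x ^+ 2) (y ^+ 2)) (z ^+ 2).
Proof.
have max2 (u v : R) : 0 <= u -> 0 <= v ->
    Num.max u v ^+ 2 = Num.max (u ^+ 2) (v ^+ 2).
  move=> u0 v0; have [uv|vu] := leP u v; symmetry.
    by apply: max_r; rewrite lerXn2r.
  by apply: max_l; rewrite lerXn2r ?nnegrE// ltW.
by move=> x0 y0 z0; rewrite !max2// le_max x0.
Qed.

End rates.

(** * Minimax bound *)

Theorem theorem2p7 (R : realType) (x_min x_max a b : R)
    (hx_min : 0 < x_min) (hx_max : x_min < x_max) (ha : 0 < a) (hb : 0 <= b) :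
  exists (C : R) (n0 : nat), 0 < C /\
    forall (n m L k : nat) (sigma_z : R),
      (n0 < n)%N -> (1 <= m)%N -> (1 <= L)%N -> (1 <= k <= n)%N ->
      0 <= sigma_z ->
      (m * L)%:R <= n%:R ^+ 4 * k%:R * ln n%:R :> R ->
    forall (d : measure_display) (Omega : measurableType d)
      (P : probability Omega R)
      (A : 'I_L -> {RV P >-> 'M[R]_(m, n)})
      (w : 'I_L -> {RV P >-> 'cV[R]_n})
      (z : 'I_L -> {RV P >-> 'cV[R]_m}),
      gaussian_model sigma_z A w z ->
    forall C_k : set 'cV[R]_n,
      signal_class x_min x_max a b k C_k ->
      (minimax_risk A w z C_k <=
       (C * Num.min
              (Num.max (Num.max (sigma_z ^+ 4) (m%:R ^+ 2)) (n%:R ^+ 2)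
                 * k%:R * ln n%:R / (m%:R ^+ 2 * n%:R * L%:R))
              1)%:E)%E.
Proof.
have x_max0 : 0 < x_max by exact: lt_trans hx_max.
have [c0 [kap [Cx [c0p kapp Cx0 risk]]]] := gibbs_risk (ltW x_max0).
pose e0 := Num.min a 1.
have e0p : 0 < e0 by rewrite lt_min ha ltr01.
have e0a : e0 <= a by rewrite ge_min lexx.
have e01 : e0 <= 1 by rewrite ge_min lexx orbT.
have ae1 : 1 <= a / e0 by rewrite ler_pdivlMr// mul1r.
(* constant of the entropy bound; C2 makes the exponent of the distant candidates
   exceed it by 5 k ln n *)
pose B1 := ln (2 * (a / e0)) + b + 3.
have B10 : 0 <= B1 by rewrite !addr_ge0// ln_ge0//; lra.
pose C2 := (B1 + 5) / kap.
have C20 : 0 <= C2 by rewrite divr_ge0 ?(ltW kapp)// addr_ge0.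
pose K11 : R := 11%:R ^+ 11.
have K0 : 0 <= K11 by apply: exprn_ge0; exact: ler0n.
pose E1 := expR (16 * Cx * x_max ^+ 2).
have E10 : 0 <= E1 := expR_ge0 _.
pose C3 := C2 / (2 * x_min ^+ 2) + 8 + x_max ^+ 2 * (K11 + E1).
have xmin2 : 0 < 2 * x_min ^+ 2 by rewrite mulr_gt0// exprn_gt0.
have C30 : 0 <= C3.
  apply: addr_ge0; last by apply: mulr_ge0; [exact: sqr_ge0|exact: addr_ge0].
  by apply: addr_ge0 => //; apply: divr_ge0 => //; exact: ltW.
exists (C3 + x_max ^+ 2), 3%N; split; first by rewrite ltr_wpDl// exprn_gt0.
move=> n m L k sig n3 m1 L1 /andP[k1 kn] sig0 mL d Omega P A w z model S classS.
set Lam := Num.max _ _; set ell := ln n%:R; set T := _ / _.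
pose nu : R := n%:R.
have nu1 : 1 <= nu by rewrite ler1n (leq_trans _ n3).
have nup : 0 < nu by exact: lt_le_trans nu1.
have ell1 : 1 <= ell := ln_nat_ge1 n3.
have kp : 1 <= k%:R :> R by rewrite ler1n.
have Lp : 1 <= L%:R :> R by rewrite ler1n.
have mp : 1 <= m%:R :> R by rewrite ler1n.
pose s := Num.max (Num.max (sig ^+ 2) m%:R) (n%:R : R).
have s2 : s ^+ 2 = Lam by rewrite sqr_max3 ?sqr_ge0// -exprM.
have ms : m%:R <= s by rewrite !le_max lexx orbT.
have ns : n%:R <= s by rewrite le_max lexx orbT.
have sigs : sig ^+ 2 <= s by rewrite !le_max lexx.
(* L <= n^6, so this radius keeps L times the squared discretisation error
   bounded *)
pose e := e0 / nu ^+ 3.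
have ep : 0 < e by rewrite divr_gt0// exprn_gt0.
have powb1 : 1 <= nu `^ b by rewrite -[1](powRr0 nu) ler_powR.
have eY : e <= a * nu `^ b.
  apply: (@le_trans _ _ a); last by rewrite ler_peMr// ltW.
  by apply: le_trans e0a; rewrite ler_pdivrMr ?exprn_gt0// ler_peMr ?(ltW e0p)// exprn_ege1.
have [N [c [NV cS cnet]]] := signal_class_net classS ep eY.
have [[x1 Sx1] box _] := classS.
have boxS x : S x -> forall j, 0 <= x j 0 <= x_max.
  move=> Sx j; have /andP[h1 ->] := box x Sx j.
  by rewrite (le_trans _ h1)// ltW.
apply: ge_ereal_inf; exists (ereal_sup [set mean_squared_error A w z
    (gibbs_mean sig (c0 / s ^+ 2) c) x | x in S]).
  by exists (gibbs_mean sig (c0 / s ^+ 2) c) => //; exact: measurable_gibbs_mean.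
apply: ub_ereal_sup => _ [x0 Sx0 <-].
have [i0 ci0] := cnet x0 Sx0.
have N0 : (0 < N)%N by exact: leq_ltn_trans (ltn_ord i0).
set loss := fun x => sqnorm (gibbs_mean sig (c0 / s ^+ 2) c (data A w z x0 x) - x0).
have mse : mean_squared_error A w z (gibbs_mean sig (c0 / s ^+ 2) c) x0 =
    ((nu^-1)%:E * \int[P]_x (loss x)%:E)%E.
  rewrite /mean_squared_error unlock -ge0_integralZl//.
  - by apply: eq_integral => x _; rewrite l2norm_sqr -EFinM mulrC.
  - by apply/measurable_EFinP; exact: measurable_gibbs_loss.
  - by move=> x _; rewrite lee_fin sqnorm_ge0.
  by rewrite lee_fin invr_ge0 ltW.
rewrite {}mse.
have trivial : (\int[P]_x (loss x)%:E <= (nu * x_max ^+ 2)%:E)%E.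
  rewrite -[leRHS](integral_probability_cst P); apply: ge0_le_integral => //.
  - by move=> x _; rewrite lee_fin sqnorm_ge0.
  - by apply/measurable_EFinP; exact: measurable_gibbs_loss.
  move=> x _; rewrite lee_fin /loss.
  set D := data A w z x0 x.
  apply: (le_trans (sqnorm_gibbs_mean_le sig _ c D x0 N0)).
  rewrite -[leRHS]mul1r -(gibbs_weight_sum sig (c0 / s ^+ 2) c D N0) mulr_suml.
  apply: ler_sum => i _; rewrite ler_wpM2l ?expR_ge0//.
  by apply: sqnorm_box_le; [exact: ltW|exact: boxS|exact: boxS].
have scale (v : R) : (\int[P]_x (loss x)%:E <= (nu * v)%:E)%E ->
    ((nu^-1)%:E * \int[P]_x (loss x)%:E <= v%:E)%E.
  move=> h; apply: (@le_trans _ _ ((nu^-1)%:E * (nu * v)%:E)%E).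
    by rewrite lee_wpmul2l// lee_fin invr_ge0 ltW.
  by rewrite -EFinM mulrA mulVf ?mul1r// gt_eqF.
have [T1|T1] := leP T 1; last first.
  apply: le_trans (scale _ trivial) _.
  by rewrite mulr1 lee_fin lerDr.
have T0 : 0 <= T.
  rewrite /T -s2; apply: divr_ge0; last by rewrite !mulr_ge0// sqr_ge0.
  by apply: mulr_ge0; [apply: mulr_ge0 => //; exact: sqr_ge0|exact: le_trans ell1].
apply: (@le_trans _ _ (C3 * T)%:E); last first.
  by rewrite lee_fin ler_wpM2r// lerDl sqr_ge0.
apply: scale.
have nu5 : 0 < nu ^+ 5 by rewrite exprn_gt0.
have mL4 : L%:R <= nu ^+ 4 * (k%:R * ell).
  have : L%:R <= m%:R * L%:R :> R by rewrite ler_peMl.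
  by move/le_trans; apply; rewrite -natrM mulrA.
have den0 : 0 < m%:R ^+ 2 * nu * L%:R.
  by rewrite !mulr_gt0// ?exprn_gt0// (lt_le_trans ltr01).
have kell0 : 0 <= k%:R * ell by rewrite mulr_ge0// (le_trans ler01).
(* the rate dominates the remainders, which are all of order n^-5 at most *)
have nuT : nu ^- 5 <= T.
  rewrite ler_pdivlMr// -s2 -[leRHS]mulrA.
  apply: (@le_trans _ _ (m%:R ^+ 2 * (k%:R * ell))); last first.
    by rewrite ler_wpM2r// lerXn2r ?nnegrE// (le_trans _ ms).
  have -> : m%:R ^+ 2 * (k%:R * ell) =
      nu ^- 5 * (m%:R ^+ 2 * nu * (nu ^+ 4 * (k%:R * ell))).
    by field; rewrite gt_eqF.
  by rewrite ler_wpM2l ?invr_ge0 ?(ltW nu5)// ler_wpM2l.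
have nu6 : L%:R <= nu ^+ 6.
  apply: (le_trans mL4); rewrite (_ : nu ^+ 6 = nu ^+ 4 * (nu * nu)); last by ring.
  rewrite ler_wpM2l ?exprn_ge0 ?(ltW nup)// ler_pM ?ler_nat ?(le_trans ler01)//.
  have h : ln (1 + (nu - 1)) <= nu - 1 by apply: le_ln1Dx; lra.
  by move: h; rewrite subrKC -/ell; lra.
have iT (v : R) : v <= nu ^- 6 -> v <= T.
  move=> /le_trans; apply; apply: le_trans nuT.
  by rewrite -!exprVn ler_wiXn2l ?invr_ge0 ?invf_le1// ltW.
(* the threshold between near and distant candidates *)
pose r := C2 * (nu * T).
pose rho := r / (2 * x_min ^+ 2) + 8 * e ^+ 2.
have r0 : 0 <= r by apply: mulr_ge0 => //; apply: mulr_ge0 => //; exact: ltW.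
have rho0 : 0 <= rho.
  apply: addr_ge0; first by apply: divr_ge0 => //; exact: ltW.
  by apply: mulr_ge0; [exact: ler0n|exact: sqr_ge0].
have near i : \sum_j (c i j 0 ^+ 2 - c i0 j 0 ^+ 2) ^+ 2 < r ->
     sqnorm (c i - x0) <= rho.
  move=> Qr; have lb y : S y -> forall j, x_min <= y j 0.
    by move=> Sy j; have /andP[] := box y Sy j.
  have h1 := le_lt_trans (sum_sqr_gap_ge (ltW hx_min) (lb _ (cS i)) (lb _ (cS i0))) Qr.
  have h2 : 2 * sqnorm (c i - c i0) <= r / (2 * x_min ^+ 2).
    by rewrite ler_pdivlMr//; lra.
  have -> : c i - x0 = (c i - c i0) - (x0 - c i0) by rewrite opprB addrA subrK.
  rewrite opprB; apply: (le_trans (sqnormD_le _ _)); rewrite /rho; lra.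
have bound := risk _ _ _ _ _ _ _ _ _ _ _ c x0 i0 s r rho model
  (fun i => boxS _ (cS i)) (boxS _ Sx0) m1 ms ns sigs rho0 near.
apply: (le_trans bound); rewrite lee_fin -/nu.
have e2 : e ^+ 2 <= nu ^- 6.
  rewrite expr_div_n -exprM ler_pdivrMr ?exprn_gt0// mulVf ?gt_eqF ?exprn_gt0//.
  by rewrite exprn_ile1// ltW.
set w1 := expR _; set w2 := expR _.
(* n^11 exp(- 2 n) is bounded *)
have tail : L%:R * w1 <= K11 * nu ^- 5.
  rewrite /w1 expRN ler_pdivrMr ?expR_gt0// mulrAC ler_pdivlMr//.
  apply: (@le_trans _ _ ((2 * nu) ^+ 11)); last first.
    by apply: exprn_le_expR => //; rewrite mulr_ge0// ltW.
  rewrite exprMn; apply: (@le_trans _ _ (nu ^+ 6 * nu ^+ 5)).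
    by rewrite ler_wpM2r// ltW.
  rewrite -exprD ler_peMl ?exprn_ge0 ?(ltW nup)// exprn_ege1//; lra.
have eta : \sum_j (c i0 j 0 ^+ 2 - x0 j 0 ^+ 2) ^+ 2 <= 16 * x_max ^+ 2 * nu ^- 6.
  apply: (le_trans (sum_sqr_gap_le (boxS _ (cS i0)) (boxS _ Sx0))).
  have h := sqr_ge0 x_max.
  have := ler_wpM2l h ci0; have := ler_wpM2l h e2; lra.
have gap : N%:R * w2 <= E1 * nu ^- 5.
  have NB : N%:R <= expR (B1 * (k%:R * ell)) by exact: net_entropy NV.
  have drift : L%:R * (kap * m%:R ^+ 2 / s ^+ 2 * r) = (B1 + 5) * (k%:R * ell).
    rewrite s2 /r /T /C2; field.
    have s0 : 0 < s by exact: lt_le_trans ns.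
    by rewrite -s2 (gt_eqF kapp) (gt_eqF nup) (gt_eqF (exprn_gt0 2 s0)) !gt_eqF
      ?ltr0n.
  have LE : L%:R * (Cx * \sum_j (c i0 j 0 ^+ 2 - x0 j 0 ^+ 2) ^+ 2) <=
      16 * Cx * x_max ^+ 2.
    have h := ler_wpM2l Cx0 eta.
    apply: (@le_trans _ _ (nu ^+ 6 * (Cx * (16 * x_max ^+ 2 * nu ^- 6)))).
      apply: ler_pM => //; rewrite mulr_ge0//.
      by apply: sumr_ge0 => j _; exact: sqr_ge0.
    by rewrite le_eqVlt; apply/orP; left; apply/eqP; field; rewrite gt_eqF.
  apply: (@le_trans _ _ (expR (B1 * (k%:R * ell)) * w2)).
    by rewrite ler_wpM2r// expR_ge0.
  have -> : nu ^- 5 = expR (- (5 * ell)).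
    by rewrite expRN expRM_natl lnK ?posrE.
  rewrite -!expRD ler_expR mulrDr mulrN drift.
  have : ell <= k%:R * ell by rewrite ler_peMl// (le_trans ler01).
  lra.
have t1 : K11 * nu ^- 5 <= K11 * T by rewrite ler_wpM2l.
have t2 : E1 * nu ^- 5 <= E1 * T by rewrite ler_wpM2l.
have t3 : e ^+ 2 <= nu * T.
  by apply: (le_trans (iT _ e2)); rewrite ler_peMl.
have t4 : nu * x_max ^+ 2 * (L%:R * w1 + N%:R * w2) <=
    nu * x_max ^+ 2 * ((K11 + E1) * T).
  rewrite ler_wpM2l//; first by rewrite mulr_ge0 ?sqr_ge0// ltW.
  by rewrite mulrDl; apply: lerD; [exact: le_trans t1|exact: le_trans t2].
apply: (@le_trans _ _ (rho + nu * x_max ^+ 2 * ((K11 + E1) * T))).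
  by rewrite lerD2l.
have -> : nu * (C3 * T) = r / (2 * x_min ^+ 2) + 8 * (nu * T) +
    nu * x_max ^+ 2 * ((K11 + E1) * T) by rewrite /C3 /r; ring.
by rewrite lerD2r lerD2l ler_wpM2l.
Qed.
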